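(* Let $(X_n)_{n\in\mathbb N}$ be a Markov chain in the random environment $(Y_n)_{n\in\mathbb N}$ with parametric kernel $Q$, where $X_0$ is independent of $(Y_n)_{n\in\mathbb N}$. Suppose that Assumption (A) of the context holds and that $Y$ is $\alpha$-mixing. Set $r_i=\sum_{\ell\ge i}d_\ell$ for positive integers $i$. Then there exist a measurable function $f:\mathcal X\times\mathcal Y\times[0,1]\to\mathcal X$ and an i.i.d. process $(\varepsilon_n)_{n\in\mathbb N}$ on $[0,1]$, independent of both $(Y_n)_{n\in\mathbb N}$ and $(X_n)_{n\in\mathbb N}$, with $$Q(y,x,B)=\mathbb E\big[\mathbf 1_{\{f(x,y,\varepsilon_0)\in B\}}\big],\qquad y\in\mathcal Y,\ x\in\mathcal X,\ B\in\mathcal B(\mathcal X),$$ a deterministic point $x_0\in\mathcal X$, and constants $\kappa\in(0,1)$ and $c>0$ such that for all $n\ge1$ $$b(n)\le c\inf_{1\le i\le q\le n}\left\{r_i+\kappa^{n/q}+\alpha^Y(q+1-i)\right\},$$ where $i,q$ range over integers and $$b(n):=\sup_{j\in\mathbb N}\mathbb P\left(Z_{j,j+n}^{X_j}\neq Z_{j,j+n}^{x_0}\right),$$ with, for a (possibly random) $x\in\mathcal X$, $Z_{s,s}^x=x$ and $Z_{s,t}^x=f(Z_{s,t-1}^x,Y_{t-1},\varepsilon_t)$ for $t>s$.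
   Context: $\mathcal X,\mathcal Y$ are complete separable metric spaces with Borel $\sigma$-algebras. A parametric kernel is a map $Q:\mathcal Y\times\mathcal X\times\mathcal B(\mathcal X)\to[0,1]$ such that $Q(y,x,\cdot)$ is a probability measure for each $(y,x)$ and $(x,y)\mapsto Q(y,x,B)$ is measurable for each $B$. For measurable $\phi\ge0$, $[Q(y)\phi](x)=\int\phi(z)Q(y,x,dz)$. $(X_n)_{n\in\mathbb N}$ is a Markov chain in the random environment $(Y_n)_{n\in\mathbb N}$ (a $\mathcal Y$-valued process) with kernel $Q$ if $\mathbb P(X_{n+1}\in B\mid (X_k)_{k\le n},(Y_k)_{k\in\mathbb N})=Q(Y_n,X_n,B)$ for all $B\in\mathcal B(\mathcal X)$, $n\in\mathbb N$. Mixing: for sub-$\sigma$-algebras, $\alpha(\mathcal G,\mathcal H)=\sup\{|\mathbb P(G\cap H)-\mathbb P(G)\mathbb P(H)|:G\in\mathcal G,H\in\mathcal H\}$. For a process $W=(W_t)_{t\in I}$, $\mathcal F^W_{t,s}=\sigma(W_k:k\in I,t\le k\le s)$ (trivial if the index set is empty) and $\alpha^W(n)=\sup_{j\in\mathbb Z}\alpha(\mathcal F^W_{-\infty,j},\mathcal F^W_{j+n,\infty})$. $W$ is $\alpha$-mixing if $\alpha^W(n)\to0$. Assumption (A): (drift) there are measurable $V:\mathcal X\to[0,\infty)$ and $\gamma,K:\mathcal Y\to(0,\infty)$ with $[Q(y)V](x)\le\gamma(y)V(x)+K(y)$ for all $(y,x)\in\mathcal Y\times\mathcal X$; (minorization)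 for every $R>0$ there is a probability kernel $\kappa_R:\mathcal Y\times\mathcal B(\mathcal X)\to[0,1]$, and there is a measurable $\beta:[0,\infty)\times\mathcal Y\to[0,1)$, with $Q(y,x,A)\ge(1-\beta(R,y))\kappa_R(y,A)$ for all $y\in\mathcal Y$, $x$ with $V(x)\le R$, $A\in\mathcal B(\mathcal X)$; (A1) $r_0:=\sum_{\ell\ge0}d_\ell<\infty$, where $d_0=\sup_{t\ge0}\mathbb E[K(Y_t)+\gamma(Y_t)]<\infty$ and $d_\ell=\sup_{t\ge-1}\mathbb E\big[K(Y_t)\prod_{i=1}^\ell\gamma(Y_{t+i})\big]$ for $\ell\ge1$, with the convention $K(Y_{-1}):=1$; (A2) for every $R>0$, $\lim_{\bar\beta\uparrow1}\sup_{t\in\mathbb N}\mathbb P(\beta(R,Y_t)>\bar\beta)=0$.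
   Formalization: Two hypotheses are added because the claim fails without them: E V(X_0) is finite, and K is bounded below by a positive constant. The noise ε is constructed on an enlargement of the given probability space. *)

(* Defs.v *)
From HB Require Import structures.
From mathcomp Require Import all_boot all_order all_algebra.
From mathcomp Require Import all_classical all_reals all_analysis.
From mathcomp Require Import measurable_realfun.

Set Implicit Arguments.
Unset Strict Implicit.
Unset Printing Implicit Defensive.

Import Order.TTheory GRing.Theory Num.Theory.
Import numFieldNormedType.Exports.

Local Open Scope classical_set_scope.
Local Open Scope ring_scope.
Local Open Scope ereal_scope.

#[short(type="completeMetricType")]
HB.structure Definition CompleteMetric (R : numDomainType) :=
  {T of Metric R T & CompletePseudoMetric R T}.

Definition separable (T : topologicalType) : Prop :=
  exists2 D : set T, countable D & dense D.

(* The carrier T with its Borel sigma-algebra; products of such types carry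
   the product sigma-algebra, which is the Borel one for separable metrics. *)
Notation borel T := (g_sigma_algebraType (@open T)).

Section sigma_algebras.
Context {d : measure_display} {Om : measurableType d} {R : realType}.
Variable P : probability Om R.

(* The events {W_k \in B} for k in D and B measurable. *)
Definition gen_events {d' : measure_display} {T : measurableType d'}
    (D : set nat) (W : nat -> Om -> T) : set (set Om) :=
  \bigcup_(k in D) preimage_set_system setT (W k) measurable.

Definition indep_sigma (G H : set (set Om)) : Prop :=
  forall A B, G A -> H B -> P (A `&` B) = P A * P B.

(* g is a version of P(E | G), for a sub-sigma-algebra G. *)
Definition is_cond_prob (G : set (set Om)) (E : set Om) (g : Om -> \bar R) :
    Prop :=
  (forall B : set (\bar R), measurable B -> G (g @^-1` B)) /\
  (forall A, G A -> \int[P]_(w in A) g w = P (E `&` A)).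

Definition alpha_dep (G H : set (set Om)) : \bar R :=
  ereal_sup [set `|P (AB.1 `&` AB.2) - P AB.1 * P AB.2| | AB in G `*` H].

(* When the index set is empty, <<s gen_events _ W >> is the trivial
   sigma-algebra. *)
Definition alpha_coef {d' : measure_display} {T : measurableType d'}
    (W : nat -> Om -> T) (n : nat) : \bar R :=
  ereal_sup [set alpha_dep
      <<s gen_events [set k : nat | (k%:Z <= j)%R] W >>
      <<s gen_events [set k : nat | (j + n%:Z <= k%:Z)%R] W >>
    | j in [set: int]].

Definition alpha_mixing {d' : measure_display} {T : measurableType d'}
    (W : nat -> Om -> T) : Prop :=
  alpha_coef W n @[n --> \oo] --> (0 : \bar R).

Definition iid {d' : measure_display} {T : measurableType d'}
    (W : nat -> Om -> T) : Prop :=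
  [/\ forall n, measurable_fun setT (W n),
      forall n B, measurable B -> P (W n @^-1` B) = P (W 0%N @^-1` B) &
      forall (s : seq nat) (B : nat -> set T), uniq s ->
        (forall k, measurable (B k)) ->
        P (\bigcap_(k in [set` s]) (W k @^-1` B k)) =
        \prod_(k <- s) P (W k @^-1` B k)].

End sigma_algebras.

Section random_environment.
Context {R : realType} {dX dY : measure_display}
  {X : measurableType dX} {Y : measurableType dY}.

Definition markov_chain_in_env {d : measure_display} {Om : measurableType d}
    (P : probability Om R) (Q : R.-pker (Y * X)%type ~> X)
    (Yp : nat -> Om -> Y) (Xp : nat -> Om -> X) : Prop :=
  forall (n : nat) (B : set X), measurable B ->
    is_cond_prob P
      <<s gen_events [set k : nat | (k <= n)%N] Xp `|` gen_events setT Yp >>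
      (Xp n.+1 @^-1` B)
      (fun w => Q (Yp n w, Xp n w) B).

Definition drift_condition (Q : R.-pker (Y * X)%type ~> X)
    (V : X -> R) (gam K : Y -> R) : Prop :=
  [/\ measurable_fun setT V /\ (forall x, (0 <= V x)%R),
      measurable_fun setT gam /\ (forall y, (0 < gam y)%R),
      measurable_fun setT K /\ (forall y, (0 < K y)%R) &
      forall y x,
        \int[Q (y, x)]_z (V z)%:E <= (gam y * V x + K y)%:E].

(* Only the values of bet on [0, +oo[ * Y matter. *)
Definition minorization_condition (Q : R.-pker (Y * X)%type ~> X)
    (V : X -> R) (bet : R -> Y -> R) : Prop :=
  [/\ measurable_fun ([set a : R | (0 <= a)%R] `*` [set: Y])
        (fun p : R * Y => bet p.1 p.2),
      forall (a : R) y, (0 <= a)%R -> (0 <= bet a y < 1)%R &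
      forall a : R, (0 < a)%R -> exists kap : R.-pker Y ~> X,
        forall y x (A : set X), (V x <= a)%R -> measurable A ->
          (1 - bet a y)%:E * kap y A <= Q (y, x) A].

Section environment_moments.
Context {d : measure_display} {Om : measurableType d}.
Variables (P : probability Om R) (Yp : nat -> Om -> Y) (gam K : Y -> R).

(* K(Y_{s-1}), with the convention K(Y_{-1}) = 1. *)
Definition K_prev (s : nat) (w : Om) : R :=
  if s is t.+1 then K (Yp t w) else 1%R.

(* For l >= 1 the supremum over t >= -1 is taken over s = t + 1 >= 0, so that
   gam(Y_{t+1}) ... gam(Y_{t+l}) = gam(Y_s) ... gam(Y_{s+l-1}). *)
Definition d_coef (l : nat) : \bar R :=
  if l is 0 then
    ereal_sup [set 'E_P[(fun w => K (Yp t w) + gam (Yp t w))%R]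
              | t in [set: nat]]
  else
    ereal_sup [set 'E_P[(fun w =>
                 K_prev s w * \prod_(i < l) gam (Yp (s + i)%N w))%R]
              | s in [set: nat]].

Definition r_coef (i : nat) : \bar R := \sum_(i <= l <oo) d_coef l.

Definition condition_A1 : Prop := d_coef 0 < +oo /\ r_coef 0 < +oo.

End environment_moments.

Definition condition_A2 {d : measure_display} {Om : measurableType d}
    (P : probability Om R) (Yp : nat -> Om -> Y) (bet : R -> Y -> R) : Prop :=
  forall a : R, (0 < a)%R ->
    ereal_sup [set P [set w | (b < bet a (Yp t w))%R] | t in [set: nat]]
      @[b --> (1%R : R)^'-] --> (0 : \bar R).

(* Z_iter f Yp eps s x m is Z_{s,s+m}^x. *)
Fixpoint Z_iter {Om : Type} (f : X -> Y -> R -> X) (Yp : nat -> Om -> Y)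
    (eps : nat -> Om -> R) (s : nat) (x : Om -> X) (m : nat) : Om -> X :=
  if m is m'.+1 then
    fun w => f (Z_iter f Yp eps s x m' w) (Yp (s + m')%N w)
               (eps (s + m').+1 w)
  else x.

Definition b_coef {d : measure_display} {Om : measurableType d}
    (P : probability Om R) (f : X -> Y -> R -> X) (Yp : nat -> Om -> Y)
    (Xp : nat -> Om -> X) (eps : nat -> Om -> R) (x0 : X) (n : nat) : \bar R :=
  ereal_sup [set P [set w | Z_iter f Yp eps j (Xp j) n w <>
                            Z_iter f Yp eps j (cst x0) n w]
            | j in [set: nat]].

End random_environment.

(* (Om', P') enlarges (Om, P) through the projection p; a random variable Z on
   Om is seen on Om' as Z \o p. *)
Definition enlarges {R : realType} {d d' : measure_display}
    {Om : measurableType d} {Om' : measurableType d'}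
    (P : probability Om R) (P' : probability Om' R) (p : Om' -> Om) : Prop :=
  measurable_fun setT p /\
  forall A, measurable A -> P' (p @^-1` A) = P A.

(* Main.v *)
(** The chain is realised by a random map [f x y u] that splits mass: for [u <= 1 - bet a y]
    and [V x <= a] it samples the minorising kernel (so it forgets [x]), otherwise it samples
    the rest of [Q (y, x)].  Two trajectories driven by the same noise and environment
    therefore merge with probability at least [1 - bet a y] whenever both lie in [V <= a].

    Freeze the environment.  Time is cut into blocks of length [q + 1].  The drift inequality,
    iterated over a block, bounds the mean of [V] at the end of the block by a local part,
    which only involves the last [i] values of the environment, and a remainder whose
    expectation is of order [r_i].  With probability at least 1/2 the local part is at most
    [rho] and [bet] is at most [bb < 1] at the end of the block; the trajectories then merge
    with a probability bounded below.  This good event depends on the last [i + 1] values of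
    the environment, whereas the conditional probability of not having merged before the block
    depends on the environment strictly before the block: the gap is [q + 1 - i].  Hence the
    probabilities [e_k] of not having merged after [k] blocks satisfy
    [e_(k+1) <= k2 * e_k + alpha (q + 1 - i) + C * r_i] with [k2 < 1]. *)
Require Import Defs.
From mathcomp Require Import all_boot all_order all_algebra.
From mathcomp Require Import all_classical all_reals all_analysis.
From mathcomp Require Import measurable_realfun.
From mathcomp Require Import lra ring zify.

Set Implicit Arguments.
Unset Strict Implicit.
Unset Printing Implicit Defensive.

Import Order.TTheory GRing.Theory Num.Theory.
Import numFieldNormedType.Exports.

Local Open Scope classical_set_scope.
Local Open Scope ring_scope.
Local Open Scope ereal_scope.

(** * The uniform law on [0, 1] and image measures *)

(** The expectation of [V (Xp j w)] times a product of [gam] does not factorise, since [Xp j]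
    depends on the environment. The drift is therefore unrolled from every block back to time [j],
    and from [j] back to time 0, where the start is independent of the environment. Unrolled this
    far, each [K] of the remainder is followed by at least [i] factors [gam]; this is why its
    expectation is bounded by the tail [r_i] and not merely by [r_0]. The fixed point [x0]
    contributes products of [gam] with no [K] in front, whereas [d_l] carries a factor [K] except at
    time -1: here the lower bound [k0] enters. Conditioning on the environment is replaced by
    operators that integrate out the noise with the sample point [w] held fixed; dependence on part
    of the environment is measurability on a copy of [Om] with a smaller sigma-algebra. Sampling by
    quantiles needs real values, hence the Borel coding of Polish spaces. As [Om] need not carry
    noise, a factor with uniform law is adjoined; one uniform variable yields the whole i.i.d.
    sequence because it splits into two independent ones, the second of which is split again. *)

Notation lam R := (uniform_prob (@ltr01 R)).

Section uniform.
Context {R : realType}.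

Lemma lamE (A : set R) : measurable A ->
  lam R A = lebesgue_measure (A `&` `[0%R, 1%R]).
Proof.
move=> mA; rewrite /uniform_prob integral_uniform_pdf.
rewrite (eq_integral (cst 1)) => [|x]; last first.
  rewrite inE => -[_ /=]; rewrite in_itv/= /uniform_pdf => ->.
  by rewrite subr0 invr1.
by rewrite integral_cst ?mul1e//; exact: measurableI.
Qed.

Lemma lam_itv_oc (a b : R) : (0 <= a)%R -> (a <= b)%R -> (b <= 1)%R ->
  lam R `]a, b] = (b - a)%:E.
Proof.
move=> a0 ab b1; rewrite lamE// setIidl; last first.
  move=> x /=; rewrite !in_itv/= => /andP[ax xb].
  by rewrite (le_trans xb b1) (ltW (le_lt_trans a0 ax)).
rewrite lebesgue_measure_itv/= lte_fin EFinB.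
have [//|ba] := ltP a b.
by rewrite (@le_anti _ _ a b) ?ab// subee.
Qed.

Lemma lam_itv_cc (b : R) : (0 <= b)%R -> (b <= 1)%R -> lam R `[0%R, b] = b%:E.
Proof.
move=> b0 b1; rewrite lamE// setIidl; last first.
  move=> x /=; rewrite !in_itv/= => /andP[-> xb].
  by rewrite (le_trans xb b1).
rewrite lebesgue_measure_itv/= lte_fin sube0.
have [//|ba] := ltP 0%R b.
by have -> : b = 0%R by apply/le_anti; rewrite ba b0.
Qed.

Lemma lam_supp (A : set R) : measurable A -> lam R A = lam R (A `&` `[0%R, 1%R]).
Proof.
by move=> mA; rewrite !lamE//; [rewrite -setIA setIid|exact: measurableI].
Qed.

Lemma prob_ray_unique (m1 m2 : {measure set (measurableTypeR R) -> \bar R}) :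
  m1 setT = 1 -> m2 setT = 1 ->
  (forall r : R, m1 `]-oo, r]%classic = m2 `]-oo, r]%classic) ->
  forall A, measurable A -> m1 A = m2 A.
Proof.
move=> m1T m2T mr.
have mo r : m1 `]r, +oo[%classic = m2 `]r, +oo[%classic.
  have h (m : {measure set (measurableTypeR R) -> \bar R}) : m setT = 1 ->
      m `]r, +oo[%classic = 1 - m `]-oo, r]%classic.
    move=> mT; rewrite -setCitvl -setTD measureD//; last first.
      by apply: (@eq_ind_r _ 1 (fun z => z < +oo) (ltry 1%R)); exact: mT.
    by congr (_ - _); rewrite ?setTI//; exact: mT.
  by rewrite !h// mr.
(* [setT] joins the rays since the exhausting sequence, here constantly [setT], has to lie in the
   generating pi-system. *)
move=> A; apply: (@measure_unique _ R (measurableTypeR R) (@RGenOInfty.G R `|` [set setT]) (cst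
    setT)) => // {A}.
- apply/seteqP; split.
    have e : (measurable : set (set (measurableTypeR R))) = <<s @RGenOInfty.G R >>.
      exact: RGenOInfty.measurableE.
    apply: (@subset_trans _ <<s @RGenOInfty.G R >>); first by case: _ / e.
    apply: smallest_sub; first exact: smallest_sigma_algebra.
    by move=> A GA; apply: sub_sigma_algebra; left.
  apply: smallest_sub; first exact: sigma_algebra_measurable.
  by move=> A [[x ->]|->//].
- move=> A B [[x ->]|->] [[y ->]|->]; rewrite ?setIT ?setTI; try by right.
  + left; exists (Order.max x y); by apply/seteqP; split => z /=; rewrite !in_itv/= !andbT
      gt_max; [case=> -> ->|move=> /andP[-> ->]].
  + by left; exists x.
  + by left; exists y.
- by move=> i; right.
- by apply/seteqP; split => // x _; exists 0%N.
- by move=> A [[x ->]|->]; [exact: mo|exact: etrans m1T (esym m2T)].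
- by move=> k; apply: (@eq_ind_r _ 1 (fun z => z < +oo) (ltry 1%R)); exact: m1T.
Qed.

End uniform.

Section law.
Context {d1 d2 : measure_display} {T1 : measurableType d1}
  {T2 : measurableType d2} {R : realType}.
Variables (m : {measure set T1 -> \bar R}) (f : T1 -> T2).

Definition law (mf : measurable_fun setT f) : {measure set T2 -> \bar R} :=
  measure_function_pushforward__canonical__measure_function_Measure m mf.

End law.

Lemma ge0_integral_image d1 d2 (T1 : measurableType d1) (T2 : measurableType d2)
    (R : realType) (m1 : {measure set T1 -> \bar R}) (m2 : {measure set T2 -> \bar R})
    (h : T1 -> T2) (phi : T2 -> \bar R) :
  measurable_fun setT h -> (forall A, measurable A -> m1 (h @^-1` A) = m2 A) ->
  measurable_fun setT phi -> (forall y, 0 <= phi y) ->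
  \int[m1]_x phi (h x) = \int[m2]_y phi y.
Proof.
move=> mh hE mphi phi0; transitivity (\int[pushforward m1 h]_y phi y).
  by rewrite ge0_integral_pushforward// => y _; exact: phi0.
apply: (@eq_measure_integral _ _ _ _ m2 (law m1 mh)) => // A mA _.
exact: hE.
Qed.

Lemma measurable_bool_set d (T : measurableType d) (b : T -> bool) :
  measurable_fun setT b -> measurable [set x | b x].
Proof.
move=> mb; have := mb measurableT [set true] I.
by rewrite setTI; congr measurable; apply/seteqP; split.
Qed.

(** * Quantile coupling of parametric laws *)

Section quantile.
Context {R : realType}.
Local Open Scope ring_scope.

(** The alternative [r = 1] keeps the set nonempty for every [u], so the infimum is a genuine one
    and lies in [0, 1]. *)
Definition quantile (h : R -> R) (u : R) : R :=
  inf [set r | 0 <= r <= 1 /\ (u <= h r \/ r = 1)].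

(** The second clause is right-continuity, in the one-sided form that makes the infimum in
    [quantile] attained; it concerns only points below 1, where [quantile] stops. *)
Definition cdf01 (h : R -> R) : Prop :=
  {homo h : r s / r <= s} /\
  forall r u, r < 1 -> (forall s, r < s -> s <= 1 -> u <= h s) -> u <= h r.

Let quantile_set0 (h : R -> R) (u : R) :
  [set r | 0 <= r <= 1 /\ (u <= h r \/ r = 1)] !=set0.
Proof. by exists 1; split; [rewrite ler01 lexx|right]. Qed.

Let quantile_lbound (h : R -> R) (u : R) :
  lbound [set r | 0 <= r <= 1 /\ (u <= h r \/ r = 1)] 0.
Proof. by move=> r [/andP[]]. Qed.

Lemma quantile_ge0 h u : 0 <= quantile h u.
Proof. exact: lb_le_inf. Qed.

Lemma quantile_le1 h u : quantile h u <= 1.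
Proof.
by apply: ge_inf; [exists 0; exact: quantile_lbound|split; [rewrite ler01 lexx|right]].
Qed.

(** Galois connection between a distribution function and its generalised inverse; it turns the law
    and the measurability of [quantile] into statements on [h]. Right-continuity serves the
    left-to-right direction, where [u <= h s] is first known for [s > r] only. *)
Lemma quantile_leE h u r : cdf01 h ->
  (quantile h u <= r) = (1 <= r) || (0 <= r) && (u <= h r).
Proof.
move=> [hh hr]; apply/idP/idP => [qr|/orP[r1|/andP[r0 uh]]]; last 2 first.
- by rewrite (le_trans _ r1)// quantile_le1.
- have [r1|r1] := leP 1 r; first by rewrite (le_trans _ r1)// quantile_le1.
  apply: ge_inf; first by exists 0; exact: quantile_lbound.
  by split; [rewrite r0 ltW|left].
have [//|r1] := leP 1 r.
rewrite (le_trans (quantile_ge0 h u) qr) /=.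
apply: hr => // s rs s1.
have [|t [/andP[t0 t1] [ut|te]] ts] := @inf_lt _ _ s (quantile_set0 h u).
- exact: le_lt_trans qr rs.
- by rewrite (le_trans ut)// hh// ltW.
- by move: ts; rewrite te ltNge s1.
Qed.

Lemma measurable_quantile d (T : measurableType d) (H : T -> R -> R) (v : T -> R) :
  (forall t, cdf01 (H t)) -> (forall r, measurable_fun setT (H ^~ r)) ->
  measurable_fun setT v ->
  measurable_fun setT (fun t => quantile (H t) (v t)).
Proof.
move=> cH mH mv; apply: (measurability (@RGenOInfty.G R)).
  exact: RGenOInfty.measurableE.
move=> _ [_ [r ->] <-]; rewrite setTI.
rewrite -setCitvl -preimage_setC; apply: measurableC.
rewrite (_ : _ @^-1` _ = setT `&` [set t | (1 <= r) || (0 <= r) && (v t <= H t r)]); last first.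
  apply/seteqP; split=> t /=; rewrite in_itv/= quantile_leE//.
  by case.
have [r1|r1] := leP 1 r; first by rewrite (_ : [set _ | _] = setT) ?setIT//; apply/seteqP; split.
have [r0|r0] := leP 0 r; last by rewrite (_ : [set _ | _] = set0) ?setI0//; apply/seteqP; split.
by apply: measurable_fun_le.
Qed.

(* Mass [a] is sampled from [h1] and the remaining mass from [h2]. *)
Definition split_quantile (a : R) (h1 h2 : R -> R) (u : R) : R :=
  if u <= a then quantile h1 u else quantile h2 (u - a).

(** The event is the disjoint union of []-oo, h1 r]] and []a, a + h2 r]]; since [h1 r <= a] and
    [h2 r <= 1 - a], these meet [0, 1] in lengths [h1 r] and [h2 r]. *)
Lemma lam_split_quantile a h1 h2 r : cdf01 h1 -> cdf01 h2 ->
  0 <= a <= 1 -> h1 1 = a -> h2 1 = 1 - a ->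
  (0 <= h1 0) -> (0 <= h2 0) -> 0 <= r < 1 ->
  lam R [set u | split_quantile a h1 h2 u <= r] = (h1 r + h2 r)%:E.
Proof.
move=> c1 c2 /andP[a0 a1] e1 e2 p1 p2 /andP[r0 r1].
have h1a : h1 r <= a by rewrite -e1; apply: c1.1; exact: ltW.
have h2a : h2 r <= 1 - a by rewrite -e2; apply: c2.1; exact: ltW.
have h10 : 0 <= h1 r by rewrite (le_trans p1)//; apply: c1.1.
have h20 : 0 <= h2 r by rewrite (le_trans p2)//; apply: c2.1.
pose A : set (measurableTypeR R) := [set` `]-oo, h1 r]].
pose B : set (measurableTypeR R) := [set` `]a, a + h2 r]].
have -> : [set u | split_quantile a h1 h2 u <= r] = A `|` B.
  apply/seteqP; split=> u; rewrite /A /B /split_quantile /=; case: ifPn => ua;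
    rewrite !in_itv/= quantile_leE// (lt_geF r1) r0 /=.
  - by left.
  - by move=> h; right; rewrite ltNge ua/= -lerBlDl.
  - by case=> [//|/andP[]]; rewrite ltNge ua.
  - case=> [h|/andP[_ h]]; last by rewrite lerBlDl.
    by move: ua; rewrite (le_trans h).
have mA : measurable A by exact: measurable_itv.
have mB : measurable B by exact: measurable_itv.
transitivity (lam R A + lam R B)%E.
  apply: measureU => //.
  apply/seteqP; split=> // u []; rewrite /A /B /= !in_itv/= => h /andP[+ _].
  by rewrite ltNge (le_trans h).
have -> : lam R B = (h2 r)%:E.
  transitivity (a + h2 r - a)%:E; last by rewrite addrAC subrr add0r.
  by apply: lam_itv_oc; rewrite ?lerDl// -lerBrDl.
have -> : lam R A = (h1 r)%:E.
  transitivity (lam R [set` `[0, h1 r]]); last first.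
    by apply: lam_itv_cc; rewrite ?(le_trans h1a).
  rewrite lam_supp//; congr (lam R _).
  apply/seteqP; split => u; rewrite /A /= !in_itv/=; first by case=> -> /andP[->].
  by move=> /andP[-> h]; rewrite h/= (le_trans h)// (le_trans h1a).
by rewrite EFinD.
Qed.

Lemma measurable_split_quantile d (T : measurableType d)
    (a : T -> R) (H1 H2 : T -> R -> R) (v : T -> R) :
  measurable_fun setT a ->
  (forall t, cdf01 (H1 t)) -> (forall r, measurable_fun setT (H1 ^~ r)) ->
  (forall t, cdf01 (H2 t)) -> (forall r, measurable_fun setT (H2 ^~ r)) ->
  measurable_fun setT v ->
  measurable_fun setT (fun t => split_quantile (a t) (H1 t) (H2 t) (v t)).
Proof.
move=> ma c1 m1 c2 m2 mv; apply: measurable_fun_ifT.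
- exact: measurable_fun_ler.
- exact: measurable_quantile.
- by apply: measurable_quantile => //; exact: measurable_funB.
Qed.

End quantile.

Section randomization.
Context {R : realType} {dX : measure_display} {X : measurableType dX}.
Variables (c : X -> R) (psi : R -> X).
Hypotheses (mc : measurable_fun setT c) (c01 : forall x, (0 <= c x <= 1)%R).
Hypotheses (mpsi : measurable_fun setT psi) (cK : cancel c psi).

Definition kcdf (m : set X -> \bar R) (r : R) : R := fine (m [set x | (c x <= r)%R]).

Lemma measurable_ray r : measurable [set x | (c x <= r)%R].
Proof.
rewrite (_ : [set _ | _] = c @^-1` `]-oo, r]); last first.
  by apply/seteqP; split => x /=; rewrite in_itv.
by rewrite -[X in measurable X]setTI; exact: mc.
Qed.
Hint Resolve measurable_ray : core.

Section fixed_measures.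
Variables m1 m2 : {measure set X -> \bar R}.
Hypotheses (m1T : m1 setT = 1) (m2T : m2 setT = 1).

Let fin1 A : measurable A -> m1 A \is a fin_num.
Proof.
move=> mA; rewrite ge0_fin_numE ?measure_ge0//.
apply: (@le_lt_trans _ _ (m1 setT)); last by rewrite m1T ltry.
by apply: le_measure; rewrite ?inE.
Qed.

Let fin2 A : measurable A -> m2 A \is a fin_num.
Proof.
move=> mA; rewrite ge0_fin_numE ?measure_ge0//.
apply: (@le_lt_trans _ _ (m2 setT)); last by rewrite m2T ltry.
by apply: le_measure; rewrite ?inE.
Qed.

Lemma kcdf_ge0 r : (0 <= kcdf m1 r)%R.
Proof. exact: fine_ge0. Qed.

Lemma kcdfE r : m1 [set x | (c x <= r)%R] = (kcdf m1 r)%:E.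
Proof. by rewrite /kcdf fineK ?fin1. Qed.

Lemma kcdf1 : kcdf m1 1 = 1%R.
Proof.
rewrite /kcdf (_ : [set _ | _] = setT) ?m1T//.
by apply/seteqP; split => x //= _; case/andP: (c01 x).
Qed.

(** Continuity from above along [r + 1/(n+1)]; [s <= 1] is imposed because [cdf01] only tests such
    [s]. *)
Lemma kcdf_right (r e : R) : (0 < e)%R -> (r < 1)%R ->
  exists s, [/\ (r < s)%R, (s <= 1)%R & (kcdf m1 s - kcdf m1 r < e)%R].
Proof.
move=> e0 r1.
pose F n := [set x | (c x <= r + n.+1%:R^-1)%R].
have FE : \bigcap_n F n = [set x | (c x <= r)%R].
  apply/seteqP; split => [x Fx /=|x /= xr n _]; last first.
    by rewrite /F/= (le_trans xr)// lerDl.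
  rewrite leNgt; apply/negP => rx.
  have [n nx] := ltr_add_invr rx.
  by have := lt_le_trans nx (Fx n I); rewrite ltxx.
have mF n : measurable (F n) by exact: measurable_ray.
have : (m1 \o F) n @[n --> \oo] --> m1 (\bigcap_n F n).
  apply: nonincreasing_cvg_mu => //.
  - by rewrite -ge0_fin_numE ?fin1.
  - by rewrite FE.
  - move=> n m nm; apply/subsetPset => x; rewrite /F/= => /le_trans; apply.
    by rewrite lerD2l lef_pV2 ?posrE// ler_nat.
rewrite FE kcdfE => /fine_cvg /cvgrPdist_lt /(_ _ e0) cv.
near \oo => n.
exists (r + n.+1%:R^-1)%R; split.
- by rewrite ltrDl.
- rewrite -lerBrDl ltW//; near: n.
  have r10 : (0 < 1 - r)%R by rewrite subr_gt0.
  exact: (near_infty_natSinv_lt (PosNum r10)).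
- have : (`|kcdf m1 r - fine (m1 (F n))| < e)%R by near: n; exact: cv.
  by rewrite distrC; apply: le_lt_trans; exact: ler_norm.
Unshelve. all: by end_near. Qed.

(** This is the distribution function of the residual measure [b * m1 - a * m2], which thus never
    has to be constructed. Domination gives monotonicity. Right-continuity is needed for [m1] alone:
    the other term is subtracted and nondecreasing. *)
Lemma cdf01_kcdf (a b : R) : (0 <= a)%R -> (0 <= b)%R ->
  (forall A, measurable A -> a%:E * m2 A <= b%:E * m1 A) ->
  cdf01 (fun r => b * kcdf m1 r - a * kcdf m2 r)%R.
Proof.
move=> a0 b0 h.
have incr (m : {measure set X -> \bar R}) r s :
    (forall A, measurable A -> m A \is a fin_num) -> (r <= s)%R ->
    (kcdf m s - kcdf m r)%:E = m [set x | (r < c x <= s)%R].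
  move=> mfin rs; rewrite /kcdf EFinB !fineK ?mfin//.
  rewrite (_ : [set x | (r < c x <= s)%R] =
      [set x | (c x <= s)%R] `\` [set x | (c x <= r)%R]); last first.
    apply/seteqP; split => x /=; first by case/andP => rx ->; split => //; apply/negP; rewrite
        -ltNge.
    by case=> -> /negP; rewrite -ltNge => ->.
  rewrite measureD//; last by rewrite -ge0_fin_numE ?mfin.
  rewrite setIidr// => x /= /le_trans; exact.
have mrs r s : measurable [set x | (r < c x <= s)%R].
  rewrite (_ : [set _ | _] = c @^-1` `]r, s]); last first.
    by apply/seteqP; split => x /=; rewrite in_itv.
  by rewrite -[X in measurable X]setTI; exact: mc.
have homo1 r s : (r <= s)%R -> (kcdf m2 r <= kcdf m2 s)%R.
  by move=> rs; rewrite -subr_ge0 -lee_fin incr.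
split=> [r s rs|r u r1 us].
  have : (a * (kcdf m2 s - kcdf m2 r) <= b * (kcdf m1 s - kcdf m1 r))%R.
    by rewrite -lee_fin !EFinM !incr//; exact: h.
  lra.
rewrite leNgt; apply/negP => ru.
set e := (u - (b * kcdf m1 r - a * kcdf m2 r))%R.
(* Dividing by [b + 1] instead of [b] covers [b = 0]. *)
have e0 : (0 < e / (b + 1))%R by rewrite divr_gt0 ?subr_gt0// ltr_wpDl.
have [s [rs s1 hs]] := kcdf_right e0 r1.
have := us s rs s1; rewrite leNgt => /negP; apply.
have h1 : (b * (kcdf m1 s - kcdf m1 r) < e)%R.
  have d0 : (0 <= kcdf m1 s - kcdf m1 r)%R by rewrite -lee_fin incr// ltW.
  have b10 : (0 < b + 1)%R by rewrite ltr_wpDl.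
  move: hs; rewrite ltr_pdivlMr//; lra.
have h2 : (a * kcdf m2 r <= a * kcdf m2 s)%R.
  by rewrite ler_wpM2l// homo1// ltW.
move: h1; rewrite /e; lra.
Qed.

End fixed_measures.
End randomization.

Section sampler.
Context {R : realType} {dX dS : measure_display} {X : measurableType dX}
  {S : measurableType dS}.
Variables (c : X -> R) (psi : R -> X).
Hypotheses (mc : measurable_fun setT c) (c01 : forall x, (0 <= c x <= 1)%R).
Hypotheses (mpsi : measurable_fun setT psi) (cK : cancel c psi).
Variables (Q kap : S -> {measure set X -> \bar R}) (a : S -> R).
Hypotheses (QT : forall s, Q s setT = 1) (kapT : forall s, kap s setT = 1).
Hypotheses (mQ : forall B, measurable B -> measurable_fun setT (fun s => Q s B)).
Hypotheses (mkap : forall B, measurable B -> measurable_fun setT (fun s => kap s B)).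
Hypotheses (ma : measurable_fun setT a) (a01 : forall s, (0 <= a s <= 1)%R).
Hypothesis kapQ : forall s A, measurable A -> (a s)%:E * kap s A <= Q s A.

Let F1 s r := (a s * kcdf c (kap s) r)%R.
Let F2 s r := (kcdf c (Q s) r - a s * kcdf c (kap s) r)%R.

(** Nummelin splitting: [F1] and [F2] are the distribution functions of the minorising part and of
    the residual, read through the code [c]. *)
Definition sampler (s : S) (u : R) : X :=
  psi (split_quantile (a s) (F1 s) (F2 s) u).

Let a0 s : (0 <= a s)%R. Proof. by case/andP: (a01 s). Qed.

Let cdf1 s : cdf01 (F1 s).
Proof.
have := @cdf01_kcdf _ _ _ c mc (kap s) (kap s) (kapT s) (kapT s) 0%R (a s) (lexx 0%R) (a0 s).
rewrite (_ : (fun r => _) = F1 s); last by apply/funext => r; rewrite mul0r subr0.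
apply=> A mA; rewrite mul0e mule_ge0//; exact: a0.
Qed.

Let cdf2 s : cdf01 (F2 s).
Proof.
have := @cdf01_kcdf _ _ _ c mc (Q s) (kap s) (QT s) (kapT s) (a s) 1%R (a0 s) ler01.
rewrite (_ : (fun r => _) = F2 s); last by apply/funext => r; rewrite mul1r.
by apply=> A mA; rewrite mul1e kapQ.
Qed.

Let mk (K : S -> {measure set X -> \bar R}) r :
  (forall B, measurable B -> measurable_fun setT (fun s => K s B)) ->
  measurable_fun setT (fun s => kcdf c (K s) r).
Proof.
move=> mK; apply: (measurableT_comp (f := fine)) => //.
exact/mK/measurable_ray.
Qed.

Let m1 r : measurable_fun setT (F1 ^~ r).
Proof. exact: (measurable_funM ma (mk r mkap)). Qed.

Let m2 r : measurable_fun setT (F2 ^~ r).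
Proof. exact: (measurable_funB (mk r mQ) (m1 r)). Qed.

Lemma measurable_sampler :
  measurable_fun setT (fun su : S * measurableTypeR R => sampler su.1 su.2).
Proof.
apply: (measurableT_comp (f := psi)) => //.
apply: (@measurable_split_quantile _ _ _ (a \o fst) (fun su => F1 su.1)
  (fun su => F2 su.1) snd).
- exact: measurableT_comp.
- by move=> t; exact: cdf1.
- by move=> r; apply: (measurableT_comp (m1 r) measurable_fst).
- by move=> t; exact: cdf2.
- by move=> r; apply: (measurableT_comp (m2 r) measurable_fst).
- exact: measurable_snd.
Qed.

Lemma measurable_sampler2 s : measurable_fun [set: measurableTypeR R] (sampler s).
Proof. exact: (measurableT_comp measurable_sampler (pair1_measurable s)). Qed.

Let code s u := split_quantile (a s) (F1 s) (F2 s) u.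

Let mcode s : measurable_fun [set: measurableTypeR R] (code s).
Proof.
apply: (@measurable_split_quantile _ _ _ (cst (a s)) (fun=> F1 s)
  (fun=> F2 s) id) => //.
Qed.

(** The laws of the codes are compared on half-lines, where [F1 + F2] is the distribution function
    of [Q s]; [psi] then undoes [c]. For [r] outside [[0, 1[] both sides are 0 or both are 1. *)
Lemma sampler_law s B : measurable B -> lam R (sampler s @^-1` B) = Q s B.
Proof.
move=> mB.
pose mu1 : {measure set (measurableTypeR R) -> \bar R} :=
  @law _ _ _ (measurableTypeR R) _ (lam R) (code s) (mcode s).
pose mu2 : {measure set (measurableTypeR R) -> \bar R} :=
  @law _ _ _ (measurableTypeR R) _ (Q s) c mc.
have -> : Q s B = mu2 (psi @^-1` B).
  by apply: (congr1 (Q s)); apply/seteqP; split => x /=; rewrite cK.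
apply: (@prob_ray_unique _ mu1 mu2) => //; last first.
- by rewrite -[X in measurable X]setTI; exact: mpsi.
- move=> r.
  have e2 : mu2 `]-oo, r]%classic = (kcdf c (Q s) r)%:E.
    rewrite -(kcdfE mc (QT s)); apply: (congr1 (Q s)).
    by apply/seteqP; split => x /=; rewrite in_itv.
  rewrite e2.
  have e1 : mu1 `]-oo, r]%classic = lam R [set u | (code s u <= r)%R].
    apply: (congr1 (lam R)).
    by apply/seteqP; split => x /=; rewrite in_itv.
  rewrite e1.
  have codeE u : (0 <= code s u <= 1)%R.
    by rewrite /code /split_quantile; case: ifP => _; rewrite quantile_ge0 quantile_le1.
  have [r0|r0] := ltP r 0%R.
    rewrite (_ : [set u | _] = set0) ?measure0; last first.
      apply/seteqP; split => // u /= h; have /andP[+ _] := codeE u.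
      by move=> /le_trans /(_ h); rewrite leNgt r0.
    rewrite -(kcdfE mc (QT s)) (_ : [set u | _] = set0) ?measure0//.
    apply/seteqP; split => // u /= h; have /andP[+ _] := c01 u.
    by move=> /le_trans /(_ h); rewrite leNgt r0.
  have [r1|r1] := leP 1%R r.
    rewrite (_ : [set u | _] = setT); last first.
      apply/seteqP; split => // u /= h; have /andP[_ +] := codeE u.
      by move=> /le_trans; exact.
    rewrite -(kcdfE mc (QT s)) (_ : [set u | _] = setT) ?QT ?probability_setT//.
    apply/seteqP; split => // u /= h; have /andP[_ +] := c01 u.
    by move=> /le_trans; exact.
  rewrite lam_split_quantile//; first by rewrite /F1 /F2 addrC subrK.
  - by rewrite /F1 kcdf1 ?mulr1.
  - by rewrite /F2 !kcdf1 ?mulr1.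
  - by rewrite /F1 mulr_ge0// kcdf_ge0.
  - rewrite /F2 subr_ge0 -lee_fin EFinM -!(kcdfE mc)//; apply: kapQ.
    exact: measurable_ray.
  - by rewrite r0.
- exact: QT.
- exact: (@probability_setT _ _ _ (lam R)).
Qed.

(** For [u <= a s] only [F1] is read, and [F1] depends on [s] through [a s] and [kap s] alone. *)
Lemma sampler_coupled s s' u : a s = a s' ->
  (forall A, measurable A -> kap s A = kap s' A) ->
  (u <= a s)%R -> sampler s u = sampler s' u.
Proof.
move=> aa kk ua; rewrite /sampler /split_quantile -aa ua; congr (psi (quantile _ u)).
apply/funext => r; rewrite /F1 -aa /kcdf kk//; exact: measurable_ray.
Qed.

End sampler.

(** * Coding a Polish space by reals *)

Section ternary.
Context {R : realType}.
Local Open Scope ring_scope.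
Implicit Type b : nat -> bool.

(** Base 3 with digits 0 and 2 only, the Cantor set: such expansions are unique, so every bit can be
    read back from the sum. *)
Fixpoint ternary_sum (n : nat) (b : nat -> bool) : R :=
  if n is m.+1 then 2 / 3 * (b 0%N)%:R + ternary_sum m (b \o succn) / 3 else 0.

Definition ternary b : R := limn (ternary_sum ^~ b).

Lemma ternary_sum_bound n b : 0 <= ternary_sum n b <= 1.
Proof.
elim: n b => [|n ih] b /=; first by rewrite lexx ler01.
have := ih (b \o succn); case: (b 0%N) => /=; lra.
Qed.

Lemma ternary_sum_nd b : nondecreasing_seq (ternary_sum ^~ b).
Proof.
apply/nondecreasing_seqP => n; elim: n b => [|n ih] b.
  by case/andP: (ternary_sum_bound 1 b).
have := ih (b \o succn).
rewrite -[ternary_sum n.+2 b]/(2 / 3 * (b 0%N)%:R + ternary_sum n.+1 (b \o succn) / 3).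
rewrite -[ternary_sum n.+1 b]/(2 / 3 * (b 0%N)%:R + ternary_sum n (b \o succn) / 3).
lra.
Qed.

Lemma ternary_sum_is_cvg b : cvgn (ternary_sum ^~ b).
Proof.
apply: nondecreasing_is_cvgn; first exact: ternary_sum_nd.
by exists 1 => _ [n _ <-]; case/andP: (ternary_sum_bound n b).
Qed.

Lemma ternary_rec b : ternary b = 2 / 3 * (b 0%N)%:R + ternary (b \o succn) / 3.
Proof.
apply/cvg_lim => //; rewrite -cvg_shiftS /=.
apply: cvgD; first exact: cvg_cst.
by apply: cvgMl; exact: ternary_sum_is_cvg.
Qed.

Lemma ternary_bound b : 0 <= ternary b <= 1.
Proof.
apply/andP; split.
  by apply: limr_ge; [exact: ternary_sum_is_cvg|apply: nearW => n; case/andP: (ternary_sum_bound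
      n b)].
by apply: limr_le; [exact: ternary_sum_is_cvg|apply: nearW => n; case/andP: (ternary_sum_bound n
    b)].
Qed.

(** The shift of the Cantor set: it drops the first digit. The threshold 1/2 lies in the removed gap
    between 1/3 and 2/3, so it decides that digit. *)
Definition ternary_shift (r : R) : R := 3 * r - 2 * (2^-1 < r)%R%:R.

Definition ternary_bit (n : nat) (r : R) : bool := 2^-1 < iter n ternary_shift r.

Lemma ternaryK n b : ternary_bit n (ternary b) = b n.
Proof.
have b0 b' : (2^-1 < ternary b') = b' 0%N.
  have := ternary_bound (b' \o succn); rewrite [ternary b']ternary_rec; case: (b' 0%N) => /= h.
    by apply/idP; lra.
  by apply/negbTE; rewrite -leNgt; lra.
rewrite /ternary_bit; elim: n b => [|n ih] b; first exact: b0.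
rewrite iterSr (_ : ternary_shift (ternary b) = ternary (b \o succn)) ?ih//.
by rewrite /ternary_shift b0 [ternary b]ternary_rec; lra.
Qed.

Lemma measurable_ternary_shift : measurable_fun setT ternary_shift.
Proof.
apply: measurable_funB; first by apply: measurable_funM.
apply: measurable_funM => //.
rewrite (_ : (fun _ => _) = (fun r : R => if 2^-1 < r then 1 else 0)); last first.
  by apply/funext => r; case: ifP.
by apply: measurable_fun_ifT => //; exact: measurable_fun_ltr.
Qed.

Lemma measurable_ternary_bit n : measurable_fun setT (ternary_bit n).
Proof.
apply: measurable_fun_ltr => //; elim: n => [|n ih]; first exact: measurable_id.
by rewrite (_ : iter _ _ = ternary_shift \o iter n ternary_shift)//; exact: (measurableT_comp
    measurable_ternary_shift).
Qed.

Lemma measurable_ternary d (T : measurableType d) (b : nat -> T -> bool) :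
  (forall n, measurable_fun setT (b n)) ->
  measurable_fun setT (fun x => ternary (b ^~ x)).
Proof.
move=> mb; apply: (measurable_fun_cvg (h := fun n x => ternary_sum n (b ^~ x))); last first.
  by move=> x _; exact: (@ternary_sum_is_cvg (b ^~ x)).
move=> n; elim: n b mb => [|n ih] b mb /=; first exact: measurable_cst.
apply: measurable_funD.
  apply: measurable_funM => //.
  rewrite (_ : (fun _ => _) = (fun x => if b 0%N x then 1 else 0)); last first.
    by apply/funext => x; case: ifP.
  by apply: measurable_fun_ifT => //; exact: mb.
by apply: measurable_funM => //; exact: (ih (b \o succn) (fun k => mb k.+1)).
Qed.

End ternary.

(** * Splitting one uniform variable into two independent ones *)

Section doubling.
Context {R : realType}.
Notation U := (measurableTypeR R).

Definition rat_seq (n : nat) : R := if unpickle n is Some q then ratr q else 0%R.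

(** Rebuilds a real from its Dedekind cut, given along an enumeration of the rationals; [-oo]
    removes an index from the supremum. *)
Definition cut_sup (b : nat -> bool) : R :=
  fine (esups (fun n => if b n then (rat_seq n)%:E else -oo) 0%N).

Lemma cut_supK (x : R) : cut_sup (fun n => (rat_seq n < x)%R) = x.
Proof.
rewrite /cut_sup; suff -> : esups (fun n => if (rat_seq n < x)%R then (rat_seq n)%:E else -oo)
    0%N = x%:E by [].
rewrite /esups /=.
apply/le_anti/andP; split.
  apply: ge_ereal_sup => _ [n _ <-]; case: ifP => [h|_]; last exact: leNye.
  by rewrite lee_fin ltW.
apply/lee_addgt0Pr => /= e e0.
have [q] := @rat_in_itvoo R (x - e)%R x (ltac:(by rewrite ltrBlDl ltrDr)).
rewrite in_itv/= => /andP[q1 q2].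
have qE : rat_seq (pickle q) = ratr q by rewrite /rat_seq pickleK.
apply: (@le_trans _ _ ((ratr q)%:E + e%:E)).
  by rewrite -EFinD lee_fin -lerBlDr ltW.
rewrite leeD2r//; apply: ereal_sup_ubound; exists (pickle q) => //=.
by rewrite qE q2.
Qed.

Lemma measurable_cut_sup d (T : measurableType d) (b : nat -> T -> bool) :
  (forall n, measurable_fun setT (b n)) ->
  measurable_fun setT (fun x => cut_sup (b ^~ x)).
Proof.
move=> mb; apply: (measurableT_comp (f := fine)) => //.
apply: (@measurable_fun_esups _ _ _ _ (fun n x => if b n x then (rat_seq n)%:E else -oo)) => n.
by apply: measurable_fun_ifT => //; exact: mb.
Qed.

(** Two Dedekind cuts are interleaved into a single point of the Cantor set. *)
Let code (p : U * U) : R := ternary (fun n =>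
  if odd n then (rat_seq n./2 < p.2)%R else (rat_seq n./2 < p.1)%R).

Let decode (r : R) : U * U :=
  (cut_sup (fun n => ternary_bit n.*2 r), cut_sup (fun n => ternary_bit n.*2.+1 r)).

Let codeK : cancel code decode.
Proof.
move=> [x y]; rewrite /decode /code; congr (_, _).
  rewrite -[RHS]cut_supK; congr cut_sup; apply/funext => n.
  by rewrite ternaryK odd_double doubleK.
rewrite -[RHS]cut_supK; congr cut_sup; apply/funext => n.
by rewrite ternaryK /= odd_double /= uphalf_double.
Qed.

Let mcode : measurable_fun setT code.
Proof.
apply: (@measurable_ternary _ _ _ (fun n (p : U * U) =>
  if odd n then (rat_seq n./2 < p.2)%R else (rat_seq n./2 < p.1)%R)) => n.
case: (odd n); apply: measurable_fun_ltr => //.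
Qed.

Let mdecode : measurable_fun setT decode.
Proof.
apply: measurable_fun_pair; apply: (measurable_cut_sup (b := fun n r => ternary_bit _ r)) => n;
  exact: measurable_ternary_bit.
Qed.

(** The quantile sampler for the law [lam R \x lam R], with the plane coded by [code]; the weight 0
    switches the splitting off. *)
Lemma uniform_doubling : exists tau : U -> U * U, measurable_fun setT tau /\
  forall A, measurable A -> lam R (tau @^-1` A) = (lam R \x lam R) A.
Proof.
pose Q (s : U) : {measure set (U * U) -> \bar R} := (lam R \x lam R)%E.
have QT s : Q s setT = 1.
  rewrite /Q -setXTT /= product_measure1E//.
  have h : lam R [set: U] = 1 by exact: probability_setT.
  by rewrite [X in X * _]h [X in _ * X]h mule1.
have mQ B : measurable B -> measurable_fun setT (fun s => Q s B) by [].
have a01 (s : U) : (0 <= cst (0%R : R) s <= 1)%R by rewrite lexx ler01.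
have kQ s A : measurable A -> (cst (0%R : R) s)%:E * Q s A <= Q s A.
  by move=> mA; rewrite mul0e measure_ge0.
have code01 p : (0 <= code p <= 1)%R by exact: ternary_bound.
exists (sampler code decode Q Q (cst 0%R) (0%R : U)); split.
  exact: (measurable_sampler2 mcode mdecode QT QT mQ mQ _ a01 kQ).
move=> A mA.
exact: (sampler_law mcode code01 mdecode codeK QT QT a01 kQ (0%R : U) mA).
Qed.

End doubling.

(** * Borel coding of points by first admissible centres *)

Section first_index.
Context {d : measure_display} {T : measurableType d}.

(** A total minimum, with value 0 when no index qualifies, so that decoding is defined at every
    real. *)
Definition first_index (b : nat -> bool) : nat :=
  xget 0%N [set k | b k /\ forall k', (k' < k)%N -> ~~ b k'].

Lemma first_indexP (b : nat -> bool) : (exists k, b k) -> b (first_index b).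
Proof.
move=> ex; rewrite /first_index; case: xgetP => [k _ [] //|].
move=> /(_ (ex_minn ex)) []; case: ex_minnP => m bm mm; split => // k' k'm.
by apply/negP => /mm; rewrite leqNgt k'm.
Qed.

Lemma first_index_eq (b : nat -> bool) k : first_index b = k <->
  (b k /\ forall k', (k' < k)%N -> ~~ b k') \/ (k = 0%N /\ forall k', ~~ b k').
Proof.
rewrite /first_index; case: xgetP => [j _ [bj hj]|nb].
  split=> [<-|[[bk hk]|[_ /(_ j)]]]; [by left| |by rewrite bj].
  case: (ltngtP j k) => // [/hk|/hj]; first by rewrite bj.
  by rewrite bk.
have nb' k' : ~~ b k'.
  apply/negP => bk; have ex : exists k, b k by exists k'.
  move: (nb (ex_minn ex)); case: ex_minnP => m bm mm []; split => // i im.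
  by apply/negP => /mm; rewrite leqNgt im.
split=> [<-|[[bk]|[->]]//]; first by right.
by rewrite (negbTE (nb' k)) in bk.
Qed.

Lemma measurable_first_index (b : nat -> T -> bool) (A : set nat) :
  (forall n, measurable_fun setT (b n)) ->
  measurable [set x | A (first_index (b ^~ x))].
Proof.
move=> mb.
have mb1 n : measurable [set x | b n x].
  by have := mb n measurableT [set true] I; rewrite setTI; congr measurable; apply/seteqP; split.
have mb0 n : measurable [set x | ~~ b n x].
  have := measurableC (mb1 n); congr measurable; apply/seteqP; split => x /=.
    by move/negP.
  by move/negP.
rewrite (_ : [set x | _] = \bigcup_(k in A) (([set x | b k x] `&`
    \bigcap_(k' in [set k' | (k' < k)%N]) [set x | ~~ b k' x]) `|`
    [set x | k = 0%N /\ forall k', ~~ b k' x])); last first.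
  apply/seteqP; split => x /=.
    move=> Ax; exists (first_index (b ^~ x)) => //.
    have /first_index_eq := erefl (first_index (b ^~ x)).
    by case=> [[h1 h2]|h]; [left|right].
  case=> k Ak h; rewrite (_ : first_index _ = k)//; apply/first_index_eq.
  by case: h => [[h1 h2]|h]; [left|right].
apply: bigcup_measurable => k _; apply: measurableU.
  apply: measurableI => //; exact: bigcap_measurableType.
have [->|k0] := eqVneq k 0%N; last first.
  rewrite (_ : [set _ | _] = set0)//; apply/seteqP; split => // x /= [k0'].
  by rewrite k0' in k0.
rewrite (_ : [set _ | _] = \bigcap_k [set x | ~~ b k x]); last first.
  by apply/seteqP; split => x /= => [[_ h] i _|h]; [exact: h|split => // i; exact: h].
exact: bigcap_measurableType.
Qed.

End first_index.

Section polish_coding.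
Context {R : realType} {X : completeMetricType R}.
Hypothesis sepX : separable X.
Local Open Scope ring_scope.

Lemma dense_seq : exists u : nat -> X, forall (x : X) (e : R), 0 < e ->
  exists k, mdist (u k) x < e.
Proof.
have [D cD dD] := sepX.
have [D0|[f]] := pfcard_geP cD.
  have := dD setT; rewrite D0 setI0; case=> //; last exact: openT.
  by exists point.
exists f => x e e0.
have ne : interior (ball x e) !=set0 by exists x; exact: nbhsx_ballx.
have [y [/interior_subset]] := dD _ ne (open_interior (ball x e)).
rewrite ballEmdist /= => xy Dy.
have [k _ fk] := 'surj_f Dy.
by exists k; rewrite fk metric_sym.
Qed.

Lemma open_mball (x : X) (e : R) : open [set y | mdist x y < e].
Proof.
rewrite openE => y /= xy.
apply/nbhs_ballP; exists (e - mdist x y) => /=; first by rewrite subr_gt0.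
move=> z; rewrite ballEmdist /= => yz.
by rewrite (le_lt_trans (metric_triangle x y z))// addrC -ltrBrDr.
Qed.

Lemma open_mdist (U : set X) : open U -> forall x, U x ->
  exists2 e : R, 0 < e & forall y, mdist x y < e -> U y.
Proof.
move=> oU x Ux; have /nbhs_ballP[e e0 h] : nbhs x U by exact: open_nbhs_nbhs.
by exists e => // y xy; apply: h; rewrite ballEmdist.
Qed.

Let delta (m : nat) : R := 2^-1 ^+ m.

Let delta_gt0 m : 0 < delta m. Proof. by rewrite exprn_gt0. Qed.
Let deltaS m : delta m = 2 * delta m.+1.
Proof. by rewrite /delta exprS mulrA mulfV// mul1r. Qed.

Let delta_small (e : R) : 0 < e -> exists m, delta m < e.
Proof.
move=> e0.
have : (2^-1 : R) ^+ n @[n --> \oo] --> (0 : R).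
  by apply: cvg_expr; rewrite gtr0_norm// invf_lt1// ltr1n.
move=> /cvgrPdist_lt /(_ _ e0) [m _ /(_ m (leqnn m))].
by rewrite sub0r normrN gtr0_norm; [exists m|exact: delta_gt0].
Qed.

(** A point is coded by the answers to all questions [mdist (u k) x < 2^-m]. Decoding picks at each
    scale the first centre answered positively and takes the limit, which exists by completeness. *)
Lemma polish_coding : exists (c : borel X -> R) (psi : R -> borel X),
  [/\ measurable_fun setT c, forall x, 0 <= c x <= 1,
      measurable_fun setT psi & cancel c psi].
Proof.
have [u du] := dense_seq.
pose idx (n : nat) : nat * nat := odflt (0%N, 0%N) (unpickle n).
pose bX (n : nat) (x : borel X) : bool := mdist (u (idx n).1) x < delta (idx n).2.
pose c (x : borel X) : R := ternary (bX ^~ x).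
pose bit (m k : nat) (r : R) := ternary_bit (pickle (k, m)) r.
have bitE m k x : bit m k (c x) = (mdist (u k) x < delta m).
  by rewrite /bit ternaryK /bX /idx pickleK.
pose K m r := first_index (bit m ^~ r).
have mK m A : measurable [set r | A (K m r)].
  by apply: measurable_first_index => n; exact: measurable_ternary_bit.
(* A condition under which the centres form a Cauchy sequence, made of countably many comparisons so
   that [C] is Borel. Codes of points satisfy it, since both centres are within their radii of the
   point. *)
pose C := [set r | forall m, mdist (u (K m r)) (u (K m.+1 r)) < delta m + delta m.+1].
have mC : measurable C.
  rewrite (_ : C = \bigcap_m [set r | mdist (u (K m r)) (u (K m.+1 r)) < delta m + delta m.+1]);
      last first.
    by apply/seteqP; split => r /= h m => [_|]; exact: h.
  apply: bigcap_measurableType => m _.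
  rewrite (_ : [set r | _] = \bigcup_k ([set r | [set k] (K m r)] `&`
      [set r | [set j | mdist (u k) (u j) < delta m + delta m.+1] (K m.+1 r)])); last first.
    apply/seteqP; split => r /=; first by exists (K m r).
    by case=> k _ [/= ->].
  by apply: bigcup_measurable => k _; apply: measurableI; exact: mK.
(* [3 * delta m] is the sum over [k >= m] of [delta k + delta k.+1]. *)
have step r m j : C r -> mdist (u (K m r)) (u (K (m + j)%N r)) <= 3 * delta m.
  move=> Cr; elim: j m => [|j ih] m.
    by rewrite addn0 mdistxx mulr_ge0// ltW.
  have := metric_triangle (u (K m r)) (u (K m.+1 r)) (u (K (m + j.+1)%N r)).
  have := ih m.+1; have := Cr m; rewrite addSnnS.
  have := deltaS m; lra.
(* One more [delta m] pays for approximating the limit. *)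
have lim_ex r : C r -> exists y : X, forall m, mdist (u (K m r)) y < 4 * delta m.
  move=> Cr.
  have cv : cvg (u (K m r) @[m --> \oo]).
    apply: cauchy_cvg; apply: cauchy_exP => e e0.
    have e40 : 0 < e / 4 by rewrite divr_gt0.
    have [m me] := delta_small e40.
    exists (u (K m r)); exists m => // n /= mn.
    rewrite ballEmdist /= -(subnKC mn).
    have := step r m (n - m)%N Cr; have := delta_gt0 m; lra.
  exists (lim (u (K m r) @[m --> \oo])) => m.
  move/cvg_ballP : cv => /(_ _ (delta_gt0 m)) [n _ hn].
  have := hn (m + n)%N; rewrite /= leq_addl ballEmdist /= => /(_ isT).
  rewrite metric_sym => h.
  have := metric_triangle (u (K m r)) (u (K (m + n)%N r)) (lim (u (K m r) @[m --> \oo])).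
  have := step r m n Cr; lra.
have cC x : C (c x).
  have hK m : mdist (u (K m (c x))) x < delta m.
    rewrite -bitE; apply: (@first_indexP (bit m ^~ (c x))).
    by have [k hk] := du x _ (delta_gt0 m); exists k; rewrite bitE.
  move=> m; apply: (le_lt_trans (metric_triangle _ x _)).
  by rewrite ltrD// metric_sym.
pose psi (r : R) : borel X := if pselect (C r) is left Cr then sval (cid (lim_ex r Cr)) else point.
have psiP r : C r -> forall m, mdist (u (K m r)) (psi r) < 4 * delta m.
  by move=> Cr; rewrite /psi; case: pselect => // Cr'; case: cid.
exists c, psi; split.
- apply: measurable_ternary => n.
  apply: (measurable_fun_bool true); rewrite setTI.
  apply: sub_sigma_algebra; rewrite (_ : _ @^-1` _ = [set y | mdist (u (idx n).1) y < delta (idx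
      n).2]); last first.
    by apply/seteqP; split.
  exact: open_mball.
- by move=> x; exact: ternary_bound.
- apply: (@measurability _ _ _ (borel X) setT psi (@open X)); first by [].
  move=> _ [U oU <-]; rewrite setTI.
  (* For codes in [C], membership of the limit in [U] is decided at a finite scale: the ball of
     radius [4 * delta m] around the centre lies in [U]. This depends on the index of the centre,
     which ranges over a discrete set. *)
  pose A m : set nat := [set k | forall z, mdist (u k) z < 4 * delta m -> U z].
  have -> : psi @^-1` U = (C `&` \bigcup_m [set r | A m (K m r)]) `|` (~` C `&` [set r | U point]).
    apply/seteqP; split => r /=.
      move=> Ur; have [Cr|Cr] := pselect (C r); last first.
        by right; split => //; move: Ur; rewrite /psi; case: pselect.
      left; split => //.
      have [e e0 he] := open_mdist oU Ur.
      (* Two distances below [4 * delta m] have to fit into [e]. *)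
      have e80 : 0 < e / 8 by rewrite divr_gt0.
      have [m me] := delta_small e80.
      exists m => // z mz; apply: he.
      have := metric_triangle (psi r) (u (K m r)) z.
      have := psiP r Cr m; rewrite [mdist (psi r) (u _)]metric_sym; lra.
    case=> [[Cr [m _ /=]]|[Cr Up]]; first by apply; exact: psiP.
    by rewrite /psi; case: pselect.
  apply: measurableU.
    apply: measurableI => //; apply: bigcup_measurable => m _; exact: mK.
  apply: measurableI; first exact: measurableC.
  have [Up|Up] := pselect (U point).
    by rewrite (_ : [set r | _] = setT)//; apply/seteqP; split.
  by rewrite (_ : [set r | _] = set0)//; apply/seteqP; split.
- move=> x; apply: mdist_positivity; apply/eqP; rewrite eq_le mdist_ge0 andbT.
  rewrite leNgt; apply/negP => d0.
  have d80 : 0 < mdist (psi (c x)) x / 8 by rewrite divr_gt0.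
  have [m md] := delta_small d80.
  have hK : mdist (u (K m (c x))) x < delta m.
    rewrite -bitE; apply: (@first_indexP (bit m ^~ (c x))).
    by have [k hk] := du x _ (delta_gt0 m); exists k; rewrite bitE.
  have := metric_triangle (psi (c x)) (u (K m (c x))) x.
  have := psiP _ (cC x) m; rewrite [mdist (psi _) (u _)]metric_sym.
  have := delta_gt0 m; lra.
Qed.

End polish_coding.

(** * I.i.d. noise from a single uniform variable *)

Section iid_from_doubling.
Context {R : realType}.
Notation U := (measurableTypeR R).
Variable tau : U -> U * U.
Hypothesis mtau : measurable_fun setT tau.
Hypothesis tauE : forall A, measurable A -> lam R (tau @^-1` A) = (lam R \x lam R) A.

(** A generator: [tau] splits each seed into an output and the next seed. *)
Definition seed (n : nat) : U -> U := iter n (snd \o tau).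
Definition noise (n : nat) (u : U) : U := (tau (seed n u)).1.

Lemma seedSr n u : seed n.+1 u = seed n (tau u).2.
Proof. by rewrite /seed iterSr. Qed.

Lemma noiseSr n u : noise n.+1 u = noise n (tau u).2.
Proof. by rewrite /noise seedSr. Qed.

Lemma measurable_seed n : measurable_fun setT (seed n).
Proof.
elim: n => [|n ih]; first exact: measurable_id.
exact: (measurableT_comp (measurableT_comp measurable_snd mtau) ih).
Qed.

Lemma measurable_noise n : measurable_fun setT (noise n).
Proof.
exact: (measurableT_comp (measurableT_comp measurable_fst mtau) (measurable_seed n)).
Qed.

Let preim d (T : measurableType d) (h : U -> T) (mh : measurable_fun setT h) (A : set T) :
  measurable A -> measurable (h @^-1` A).
Proof. by move=> mA; rewrite -[X in measurable X]setTI; exact: mh. Qed.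

Let lamT : lam R (setT : set U) = 1.
Proof. exact: probability_setT. Qed.

Lemma tau_rect A B : measurable A -> measurable B ->
  lam R (tau @^-1` (A `*` B)) = lam R A * lam R B.
Proof. by move=> mA mB; rewrite tauE; [exact: product_measure1E|exact: measurableX]. Qed.

Lemma lam_seed n A : measurable A -> lam R (seed n @^-1` A) = lam R A.
Proof.
move=> mA; elim: n => [//|n ih]; rewrite -[RHS]ih.
rewrite (_ : seed n.+1 @^-1` A = tau @^-1` (setT `*` (seed n @^-1` A))); last first.
  apply/seteqP; split => u; first by move=> h; split => //; rewrite /preimage/mkset -seedSr.
  by case=> _; rewrite /preimage/mkset -seedSr.
by rewrite tau_rect ?lamT ?mul1e//; apply: preim => //; exact: measurable_seed.
Qed.

Lemma lam_noise n A : measurable A -> lam R (noise n @^-1` A) = lam R A.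
Proof.
move=> mA; rewrite (_ : noise n @^-1` A = seed n @^-1` (tau @^-1` (A `*` setT))); last first.
  by apply/seteqP; split => u //= [].
rewrite lam_seed; last by apply: preim => //; exact: measurableX.
by rewrite tau_rect// lamT mule1.
Qed.

(** [tau] makes [noise 0] independent of the next seed, and the later noises are the same functions
    of that seed, shifted by one. *)
Lemma lam_noises N (B : nat -> set U) : (forall k, measurable (B k)) ->
  lam R (\bigcap_(k in [set k | (k < N)%N]) (noise k @^-1` B k)) =
  \prod_(0 <= k < N) lam R (B k).
Proof.
elim: N B => [|N ih] B mB.
  rewrite big_nil (_ : \bigcap_(k in _) _ = setT) ?lamT//.
  by apply/seteqP; split.
rewrite big_nat_recl// -[X in _ * X](ih (fun k => B k.+1))//.
rewrite -tau_rect//; last first.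
  apply: bigcap_measurableType => k _; apply: preim => //; exact: measurable_noise.
congr (lam R _); apply/seteqP; split => u /=.
  move=> h; split; first exact: (h 0%N).
  by move=> k /= kN; rewrite -noiseSr; exact: (h k.+1).
by case=> h0 h [|k] //= kN; rewrite noiseSr; exact: h.
Qed.

Lemma ge0_integral_tau (phi : U * U -> \bar R) : measurable_fun setT phi ->
  (forall p, 0 <= phi p) ->
  \int[lam R]_u phi (tau u) = \int[lam R]_a \int[lam R]_b phi (a, b).
Proof.
move=> mphi phi0; rewrite -(fubini_tonelli1 phi)//.
exact: (ge0_integral_image mtau tauE mphi phi0).
Qed.

Lemma ge0_integral_seed n (phi : U -> \bar R) : measurable_fun setT phi ->
  (forall p, 0 <= phi p) ->
  \int[lam R]_u phi (seed n u) = \int[lam R]_u phi u.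
Proof.
move=> mphi phi0; apply: (ge0_integral_image (measurable_seed n)) => //.
exact: lam_seed.
Qed.

End iid_from_doubling.

(** * The transfer operator of a chain in a frozen environment *)

Section transfer.
Context {R : realType} {S Y Om : Type}.
Variables (g : S -> Y -> R -> S) (env : nat -> Om -> Y).

(** The Markov operator in a frozen environment. The sample point [w] is carried along so that
    functions may also read the environment at other times. *)
Definition transfer (s : nat) (phi : S * Om -> \bar R) (p : S * Om) : \bar R :=
  \int[lam R]_u phi (g p.1 (env s p.2) u, p.2).

Fixpoint transfers (s m : nat) (phi : S * Om -> \bar R) : S * Om -> \bar R :=
  if m is m'.+1 then transfer s (transfers s.+1 m' phi) else phi.

Lemma transfers_add s m n phi :
  transfers s (m + n) phi = transfers s m (transfers (s + m) n phi).
Proof.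
by elim: m s => [|m ih] s /=; rewrite ?addn0// ih addSnnS.
Qed.

Lemma transfersSr s m phi :
  transfers s m.+1 phi = transfers s m (transfer (s + m) phi).
Proof. by rewrite -addn1 transfers_add. Qed.

Lemma transfer_ge0 s phi : (forall p, 0 <= phi p) -> forall p, 0 <= transfer s phi p.
Proof. by move=> phi0 p; exact: integral_ge0. Qed.

Lemma transfers_ge0 s m phi : (forall p, 0 <= phi p) ->
  forall p, 0 <= transfers s m phi p.
Proof.
move=> phi0; elim: m s => [//|m ih] s; apply: transfer_ge0; exact: ih.
Qed.

End transfer.

Section measurable_transfer.
Context {R : realType} {dS dY dO : measure_display} {S : measurableType dS}
  {Y : measurableType dY} {Om : measurableType dO}.
Variables (g : S -> Y -> R -> S) (env : nat -> Om -> Y).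
Notation U := (measurableTypeR R).
Hypothesis mg : measurable_fun setT (fun q : S * Y * U => g q.1.1 q.1.2 q.2).

Lemma measurable_transfer s phi : measurable_fun setT (env s) ->
  measurable_fun setT phi -> (forall p, 0 <= phi p) ->
  measurable_fun setT (transfer g env s phi).
Proof.
move=> menv mphi phi0.
pose h (q : (S * Om) * U) : S * Om := (g q.1.1 (env s q.1.2) q.2, q.1.2).
have mh : measurable_fun setT h.
  apply: measurable_fun_pair; last exact: (measurableT_comp measurable_snd measurable_fst).
  apply: (measurableT_comp mg (f := fun q : S * Y * U => g q.1.1 q.1.2 q.2)
    (g := fun q : (S * Om) * U => ((q.1.1, env s q.1.2), q.2))).
  apply: measurable_fun_pair; last exact: measurable_snd.
  apply: measurable_fun_pair; first exact: (measurableT_comp measurable_fst measurable_fst).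
  by apply: (measurableT_comp menv); exact: (measurableT_comp measurable_snd measurable_fst).
exact: (@measurable_fun_fubini_tonelli_F _ _ _ _ _ (lam R) (phi \o h)
  (measurableT_comp mphi mh) (fun q => phi0 (h q))).
Qed.

Lemma measurable_transfers s m phi :
  (forall k, (s <= k < s + m)%N -> measurable_fun setT (env k)) ->
  measurable_fun setT phi -> (forall p, 0 <= phi p) ->
  measurable_fun setT (transfers g env s m phi).
Proof.
move=> menv mphi phi0; elim: m s menv => [//|m ih] s menv.
apply: measurable_transfer.
- by apply: menv; rewrite leqnn addnS ltnS leq_addr.
- by apply: ih => k /andP[sk km]; apply: menv; rewrite (ltnW sk) addnS -addSn.
- exact: transfers_ge0.
Qed.

End measurable_transfer.

Section fibre.
Context {R : realType} {dS dY : measure_display} {S : measurableType dS}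
  {Y : measurableType dY} {Om : Type}.
Variables (g : S -> Y -> R -> S) (env : nat -> Om -> Y).
Notation U := (measurableTypeR R).
Hypothesis mg : measurable_fun setT (fun q : S * Y * U => g q.1.1 q.1.2 q.2).

(** [Om] is a bare type here: comparisons at a fixed [w] need measurability in the state only, and
    the lemmas then serve for every sigma-algebra put on [Om]. *)
Definition fibre_measurable (phi : S * Om -> \bar R) : Prop :=
  forall w, measurable_fun setT (fun x => phi (x, w)).

Lemma measurable_step y : measurable_fun setT (fun q : S * U => g q.1 y q.2).
Proof.
apply: (measurableT_comp mg (f := fun q : S * Y * U => g q.1.1 q.1.2 q.2)
    (g := fun q : S * U => ((q.1, y), q.2))).
apply: measurable_fun_pair; last exact: measurable_snd.
by apply: measurable_fun_pair; first exact: measurable_fst.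
Qed.

Lemma measurable_fibre_step x y w phi : fibre_measurable phi ->
  measurable_fun [set: U] (fun u => phi (g x y u, w)).
Proof.
move=> mphi; apply: (measurableT_comp (mphi w)).
exact: (measurableT_comp (measurable_step y) (pair1_measurable x)).
Qed.

Lemma fibre_measurable_transfer s phi : fibre_measurable phi ->
  (forall p, 0 <= phi p) -> fibre_measurable (transfer g env s phi).
Proof.
move=> mphi phi0 w.
exact: (@measurable_fun_fubini_tonelli_F _ _ _ _ _ (lam R)
  (fun q : S * U => phi (g q.1 (env s w) q.2, w))
  (measurableT_comp (mphi w) (measurable_step (env s w))) (fun q => phi0 _)).
Qed.

Lemma fibre_measurable_transfers s m phi : fibre_measurable phi ->
  (forall p, 0 <= phi p) -> fibre_measurable (transfers g env s m phi).
Proof.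
move=> mphi phi0; elim: m s => [//|m ih] s.
by apply: fibre_measurable_transfer => //; exact: transfers_ge0.
Qed.

(* The comparison is fibrewise because a transfer keeps the environment fixed. *)
Lemma le_transfer s phi1 phi2 w : fibre_measurable phi1 -> fibre_measurable phi2 ->
  (forall p, 0 <= phi1 p) -> (forall x, phi1 (x, w) <= phi2 (x, w)) ->
  forall x, transfer g env s phi1 (x, w) <= transfer g env s phi2 (x, w).
Proof.
move=> m1 m2 p1 h x; apply: ge0_le_integral => //.
- exact: measurable_fibre_step.
- exact: measurable_fibre_step.
Qed.

Lemma le_transfers s m phi1 phi2 w : fibre_measurable phi1 -> fibre_measurable phi2 ->
  (forall p, 0 <= phi1 p) -> (forall p, 0 <= phi2 p) ->
  (forall x, phi1 (x, w) <= phi2 (x, w)) ->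
  forall x, transfers g env s m phi1 (x, w) <= transfers g env s m phi2 (x, w).
Proof.
move=> m1 m2 p1 p2 h; elim: m s => [//|m ih] s x.
apply: le_transfer; [| | |exact: ih].
- exact: fibre_measurable_transfers.
- exact: fibre_measurable_transfers.
- exact: transfers_ge0.
Qed.

(** [c] and [b] depend on [w] only, which a transfer leaves fixed, so they behave as constants. *)
Lemma transfer_affine s phi (c b : Om -> \bar R) : fibre_measurable phi ->
  (forall p, 0 <= phi p) -> (forall w, 0 <= c w) -> (forall w, 0 <= b w) ->
  transfer g env s (fun p => c p.2 * phi p + b p.2) =
  (fun p => c p.2 * transfer g env s phi p + b p.2).
Proof.
move=> mphi phi0 c0 b0; apply/funext => -[x w]; rewrite /transfer /=.
rewrite ge0_integralD//; last 2 first.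
- by move=> u _; rewrite mule_ge0.
- by apply: measurable_funeM; exact: measurable_fibre_step.
congr (_ + _).
  by rewrite ge0_integralZl//; exact: measurable_fibre_step.
by rewrite integral_cst// [X in _ * X]probability_setT mule1.
Qed.

Lemma transfers_affine s m phi (c b : Om -> \bar R) : fibre_measurable phi ->
  (forall p, 0 <= phi p) -> (forall w, 0 <= c w) -> (forall w, 0 <= b w) ->
  transfers g env s m (fun p => c p.2 * phi p + b p.2) =
  (fun p => c p.2 * transfers g env s m phi p + b p.2).
Proof.
move=> mphi phi0 c0 b0; elim: m s => [//|m ih] s /=.
rewrite ih transfer_affine//; first exact: fibre_measurable_transfers.
exact: transfers_ge0.
Qed.

End fibre.

(** * The drift inequality along a frozen environment *)

Section products.
Context {R : realType} {Y Om : Type}.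
Variables (env : nat -> Om -> Y) (gam K : Y -> R).
Local Open Scope ring_scope.

Definition gam_prod (s m : nat) (w : Om) : R := \prod_(i < m) gam (env (s + i)%N w).

(** For [l >= 1], the integrand of [d_coef l] at [t = s]. *)
Definition Kgam_prod (s l : nat) (w : Om) : R := K (env s w) * gam_prod s.+1 l w.

Lemma gam_prodS s m w : gam_prod s m.+1 w = gam (env s w) * gam_prod s.+1 m w.
Proof.
rewrite /gam_prod big_ord_recl addn0; congr (_ * _).
by apply: eq_bigr => i _; rewrite lift0 addSnnS.
Qed.

Lemma gam_prodD s m n w : gam_prod s (m + n) w = gam_prod s m w * gam_prod (s + m) n w.
Proof.
rewrite /gam_prod big_split_ord /=; congr (_ * _).
by apply: eq_bigr => i _; rewrite addnA.
Qed.

Hypotheses (gam_gt0 : forall y, 0 < gam y) (K_gt0 : forall y, 0 < K y).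

Lemma gam_prod_ge0 s m w : 0 <= gam_prod s m w.
Proof. by apply: prodr_ge0 => i _; exact: ltW. Qed.

Lemma Kgam_prod_ge0 s l w : 0 <= Kgam_prod s l w.
Proof. by rewrite mulr_ge0 ?gam_prod_ge0// ltW. Qed.

End products.

Section drift.
Context {R : realType} {dS dY : measure_display} {S : measurableType dS}
  {Y : measurableType dY} {Om : Type}.
Variables (g : S -> Y -> R -> S) (env : nat -> Om -> Y).
Notation U := (measurableTypeR R).
Hypothesis mg : measurable_fun setT (fun q : S * Y * U => g q.1.1 q.1.2 q.2).
Variables (W : S -> R) (gam K : Y -> R).
Hypotheses (mW : measurable_fun setT W) (W0 : forall x, (0 <= W x)%R).
Hypotheses (gam_gt0 : forall y, (0 < gam y)%R) (K_gt0 : forall y, (0 < K y)%R).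
Hypothesis drift : forall x y,
  \int[lam R]_u (W (g x y u))%:E <= (gam y * W x + K y)%:E.

(** In the sum, [l] counts the factors [gam] after [K]: the [K] added at time [s + m - 1 - l] is
    multiplied by all later [gam]. The expectation of that term is thus at most [d_l], whatever the
    time. *)
Lemma transfers_drift s m x w :
  transfers g env s m (fun p => (W p.1)%:E) (x, w) <=
  (gam_prod env gam s m w * W x +
   \sum_(l < m) Kgam_prod env gam K (s + (m - l.+1)) l w)%:E.
Proof.
have mWf : fibre_measurable (fun p : S * Om => (W p.1)%:E).
  by move=> w'; apply/measurable_EFinP.
have W0f p : 0 <= (W p.1)%:E :> \bar R by rewrite lee_fin.
elim: m s x w => [|m ih] s x w.
  by rewrite /= /gam_prod !big_ord0 mul1r addr0.
pose c w' := (gam_prod env gam s.+1 m w')%:E.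
pose b w' := (\sum_(l < m) Kgam_prod env gam K (s.+1 + (m - l.+1)) l w')%R%:E.
have c0 w' : 0 <= c w' by rewrite lee_fin gam_prod_ge0.
have b0 w' : 0 <= b w'.
  by rewrite lee_fin sumr_ge0// => l _; exact: Kgam_prod_ge0.
apply: (@le_trans _ _ (transfer g env s (fun p => c p.2 * (W p.1)%:E + b p.2) (x, w))).
  apply: (@le_transfer _ _ _ _ _ _ g env mg s
    (transfers g env s.+1 m (fun p => (W p.1)%:E))).
  - exact: fibre_measurable_transfers.
  - by move=> w' /=; apply: emeasurable_funD => //; apply: measurable_funeM; exact: (mWf w').
  - exact: transfers_ge0.
  - by move=> x'; rewrite (le_trans (ih _ _ _))// EFinD EFinM.
rewrite (@transfer_affine _ _ _ _ _ _ _ _ mg)//=.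
apply: (@le_trans _ _ (c w * (gam (env s w) * W x + K (env s w))%:E + b w)).
  by rewrite leeD2r// lee_wpmul2l//; exact: drift.
rewrite -EFinM -EFinD lee_fin gam_prodS big_ord_recr /= subnn addn0 mulrDr.
rewrite (_ : \sum_(i < m) Kgam_prod env gam K (s + (m.+1 - i.+1)) i w =
   \sum_(l < m) Kgam_prod env gam K (s.+1 + (m - l.+1)) l w)%R; last first.
  apply: eq_bigr => l _; congr (Kgam_prod _ _ _ _ _ _).
  by rewrite addSnnS -subSn// ltn_ord.
by rewrite {3}/Kgam_prod; lra.
Qed.

End drift.

(** * Coupling two trajectories in a frozen environment *)

Section coupling.
Context {R : realType} {dX dY : measure_display} {X : measurableType dX}
  {Y : measurableType dY} {Om : Type}.
Variables (f : X -> Y -> R -> X) (env : nat -> Om -> Y).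
Notation U := (measurableTypeR R).
Hypothesis mf : measurable_fun setT (fun q : X * Y * U => f q.1.1 q.1.2 q.2).
Hypothesis mdiag : measurable_fun setT (fun p : X * X => p.1 != p.2).

Definition step2 (p : X * X) (y : Y) (u : R) : X * X := (f p.1 y u, f p.2 y u).

Lemma measurable_step2 :
  measurable_fun setT (fun q : (X * X) * Y * U => step2 q.1.1 q.1.2 q.2).
Proof.
have h (h1 : X * X -> X) : measurable_fun setT h1 ->
    measurable_fun setT (fun q : (X * X) * Y * U => f (h1 q.1.1) q.1.2 q.2).
  move=> mh; apply: (measurableT_comp mf (f := fun q : X * Y * U => f q.1.1 q.1.2 q.2)
    (g := fun q : (X * X) * Y * U => ((h1 q.1.1, q.1.2), q.2))).
  apply: measurable_fun_pair; last exact: measurable_snd.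
  apply: measurable_fun_pair; last exact: (measurableT_comp measurable_snd measurable_fst).
  by apply: (measurableT_comp mh); exact: (measurableT_comp measurable_fst measurable_fst).
by apply: measurable_fun_pair; apply: h; [exact: measurable_fst|exact: measurable_snd].
Qed.

Definition differ (p : (X * X) * Om) : \bar R := (p.1.1 != p.1.2)%:R%:E.

Lemma differ_ge0 p : 0 <= differ p. Proof. by rewrite lee_fin. Qed.

Lemma differ_le1 p : differ p <= 1.
Proof. by rewrite lee_fin lern1; case: (_ != _). Qed.

Lemma measurable_neq_EFin : measurable_fun setT (fun p : X * X => (p.1 != p.2)%:R%:E : \bar R).
Proof.
apply/measurable_EFinP.
rewrite (_ : (fun _ => _) = (fun p : X * X => if p.1 != p.2 then 1%R else 0%R)).
  exact: measurable_fun_ifT.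
by apply/funext => p; case: ifP.
Qed.

Lemma fibre_measurable_differ : fibre_measurable differ.
Proof. by move=> w; exact: measurable_neq_EFin. Qed.

Notation T := (transfers step2 env).

Lemma transfers_differ_ge0 s m p : 0 <= T s m differ p.
Proof. by apply: transfers_ge0; exact: differ_ge0. Qed.

(** The diagonal is absorbing, because both coordinates read the same noise. *)
Lemma transfers_differ_le s m p : T s m differ p <= differ p.
Proof.
have fm := fibre_measurable_transfers env measurable_step2.
elim: m s p => [//|m ih] s [x w].
rewrite /=; apply: (@le_trans _ _ (transfer step2 env s differ (x, w))).
  apply: (le_transfer env measurable_step2).
  - by apply: fm; [exact: fibre_measurable_differ|exact: differ_ge0].
  - exact: fibre_measurable_differ.
  - exact: transfers_differ_ge0.
  - by move=> x'; exact: ih.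
rewrite /transfer /differ /=; have [e|ne] := eqVneq x.1 x.2.
  by rewrite (eq_integral (cst 0)) ?integral0// => u _; rewrite e eqxx.
apply: (@le_trans _ _ (\int[lam R]_u (cst 1) u)).
  apply: ge0_le_integral => //.
  - exact: (measurable_fibre_step measurable_step2 x (env s w) w fibre_measurable_differ).
  - by move=> u _; rewrite lee_fin lern1; case: (_ != _).
by rewrite integral_cst// mul1e; apply: probability_le1.
Qed.

Lemma transfers_differ_le1 s m p : T s m differ p <= 1.
Proof. exact: le_trans (transfers_differ_le _ _ _) (differ_le1 _). Qed.

Variables (V : X -> R) (gam K bet : Y -> R) (a : R).
Hypotheses (mV : measurable_fun setT V) (V0 : forall x, (0 <= V x)%R).
Hypotheses (gam_gt0 : forall y, (0 < gam y)%R) (K_gt0 : forall y, (0 < K y)%R).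
Hypotheses (a_gt0 : (0 < a)%R) (bet01 : forall y, (0 <= bet y < 1)%R).
Hypothesis driftV : forall x y,
  \int[lam R]_u (V (f x y u))%:E <= (gam y * V x + K y)%:E.
Hypothesis coupled : forall x x' y u, (V x <= a)%R -> (V x' <= a)%R ->
  (u <= 1 - bet y)%R -> f x y u = f x' y u.

Lemma lam_gt (b : R) : (0 <= b <= 1)%R -> lam R [set u | (1 - b < u)%R] = b%:E.
Proof.
move=> /andP[b0 b1].
have mA : measurable ([set u | (1 - b < u)%R] : set U).
  rewrite (_ : [set _ | _] = `](1 - b)%R, +oo[%classic)//.
  by apply/seteqP; split => u /=; rewrite in_itv/= andbT.
rewrite lam_supp// (_ : _ `&` _ = `](1 - b)%R, 1%R]%classic).
  by rewrite lam_itv_oc ?subKr// ?subr_ge0// gerBl.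
apply/seteqP; split => u /=; rewrite !in_itv/=; first by case=> -> /andP[].
by move=> /andP[h ->]; rewrite h andbT (le_trans _ (ltW h))// subr_ge0.
Qed.

(** Markov's inequality in pointwise form: if some [V] exceeds [a], the right-hand side is at least
    1. A bound affine in [V x.1 + V x.2] can be carried through the transfer operators by the
    drift. *)
Lemma transfer_differ_le t (bb : R) x w : (0 <= bb <= 1)%R -> (bet (env t w) <= bb)%R ->
  transfer step2 env t differ (x, w) <=
  (bb + (1 - bb) * ((V x.1 + V x.2) / a))%:E.
Proof.
move=> /andP[bb0 bb1] hb.
have [/andP[Vx Vx']|nV] := boolP ((V x.1 <= a) && (V x.2 <= a))%R; last first.
  apply: (@le_trans _ _ 1); first exact: (transfers_differ_le1 t 1%N (x, w)).
  have : (1 <= (V x.1 + V x.2) / a)%R.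
    rewrite ler_pdivlMr// mul1r; have := V0 x.1; have := V0 x.2.
    by move: nV; rewrite negb_and -!ltNge => /orP[]; lra.
  rewrite lee_fin; nra.
apply: (@le_trans _ _ (\int[lam R]_u (\1_[set u | (1 - bet (env t w) < u)%R] u)%:E)).
  apply: ge0_le_integral => //.
  - by move=> u _; exact: differ_ge0.
  - exact: (measurable_fibre_step measurable_step2 x (env t w) w fibre_measurable_differ).
  - apply/measurable_EFinP; apply: measurable_indic.
    rewrite (_ : [set _ | _] = `](1 - bet (env t w))%R, +oo[%classic)//.
    by apply/seteqP; split => u /=; rewrite in_itv/= andbT.
  - move=> u _; rewrite lee_fin indicE /=.
    have [ub|ub] := leP (u : R) (1 - bet (env t w))%R; last by rewrite mem_set//= lern1; case:
        (_ != _).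
    by rewrite (coupled Vx Vx' ub) eqxx.
rewrite integral_indic//; last first.
  rewrite (_ : [set _ | _] = `](1 - bet (env t w))%R, +oo[%classic)//.
  by apply/seteqP; split => u /=; rewrite in_itv/= andbT.
have /andP[b0 b1] := bet01 (env t w).
rewrite setIT; apply: (@le_trans _ _ (bet (env t w))%:E).
  suff : lam R [set u | (1 - bet (env t w) < u)%R] <= (bet (env t w))%:E by [].
  by rewrite lam_gt// b0 ltW.
rewrite lee_fin.
have : (0 <= (V x.1 + V x.2) / a)%R by rewrite divr_ge0 ?addr_ge0// ltW.
have : (0 <= 1 - bb)%R by rewrite subr_ge0.
by move=> h1 h2; have := mulr_ge0 h1 h2; lra.
Qed.

Let V2 (p : X * X) := (V p.1 + V p.2)%R.

Let mV2 : measurable_fun setT V2.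
Proof.
apply: measurable_funD; first exact: (measurableT_comp mV measurable_fst).
exact: (measurableT_comp mV measurable_snd).
Qed.

Let V20 p : (0 <= V2 p)%R. Proof. exact: addr_ge0. Qed.

(** The sum of two copies of [V] satisfies the drift condition with the same [gam] and with
    [2 * K]. *)
Lemma transfers_V2 s m x w :
  T s m (fun p => (V p.1.1 + V p.1.2)%:E) (x, w) <=
  (gam_prod env gam s m w * (V x.1 + V x.2) +
   2 * \sum_(l < m) Kgam_prod env gam K (s + (m - l.+1)) l w)%:E.
Proof.
have mfV x0 y : measurable_fun [set: U] (fun u => (V (f x0 y u))%:E).
  apply/measurable_EFinP; apply: (measurableT_comp mV).
  exact: (measurableT_comp (measurable_step mf y) (pair1_measurable x0)).
have := @transfers_drift _ _ _ _ _ Om step2 env measurable_step2 V2 gam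
  (fun y => 2 * K y)%R mV2 V20 gam_gt0 _ _ s m x w.
rewrite (_ : \sum_(l < m) Kgam_prod env gam (fun y => 2 * K y)%R (s + (m - l.+1)) l w =
    2 * \sum_(l < m) Kgam_prod env gam K (s + (m - l.+1)) l w)%R; last first.
  by rewrite mulr_sumr; apply: eq_bigr => l _; rewrite /Kgam_prod mulrA.
apply; first by move=> y; rewrite mulr_gt0.
move=> {}x y; rewrite /V2 /=.
under eq_integral do rewrite EFinD.
rewrite ge0_integralD//; try by move=> u _; rewrite lee_fin.
apply: (le_trans (leeD (driftV _ _) (driftV _ _))).
by rewrite -EFinD lee_fin; lra.
Qed.

Definition good_env (q i : nat) (rho bb : R) (s : nat) (w : Om) : bool :=
  (\sum_(l < i) Kgam_prod env gam K (s + (q - l.+1)) l w <= rho)%R &&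
  (bet (env (s + q) w) <= bb)%R.

(** [q] steps bring [V] down and the last one attempts the merge, whence the length [q + 1]. The
    factor [differ] stays on the right because pairs that have already merged must not count as
    failing again. *)
Lemma block_bound s q i (bb rho : R) x w : (i <= q)%N -> (0 <= bb <= 1)%R ->
  a = (4 * rho)%R ->
  T s q.+1 differ (x, w) <=
  (if good_env q i rho bb s w then (1 + bb) / 2 else 1)%:E * differ (x, w) +
  ((gam_prod env gam s q w * (V x.1 + V x.2) +
    2 * \sum_(i <= l < q) Kgam_prod env gam K (s + (q - l.+1)) l w) / a)%:E.
Proof.
move=> iq /andP[bb0 bb1] arho.
set rest := (_ + 2 * _)%R.
have rest0 : (0 <= rest)%R.
  by rewrite addr_ge0 ?mulr_ge0 ?addr_ge0 ?gam_prod_ge0// sumr_ge0// => l _; exact: Kgam_prod_ge0.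
have resta0 : (0 <= rest / a)%R by rewrite divr_ge0// ltW.
have [e|ne] := eqVneq x.1 x.2.
  have d0 : differ (x, w) = 0 by rewrite /differ /= e eqxx.
  by rewrite (le_trans (transfers_differ_le _ _ _))// d0 mule0 add0e lee_fin.
have d1 : differ (x, w) = 1 by rewrite /differ /= ne.
rewrite d1 mule1; case: ifPn => [/andP[hL hb]|_]; last first.
  by rewrite (le_trans (transfers_differ_le1 _ _ _))// leeDl// lee_fin.
rewrite transfersSr.
pose c := ((1 - bb) / a)%R.
have c0 : (0 <= c)%R by rewrite divr_ge0 ?subr_ge0// ltW.
have fV2 : fibre_measurable (fun p : (X * X) * Om => (V p.1.1 + V p.1.2)%:E).
  by move=> w'; apply/measurable_EFinP.
have pV2 (p : (X * X) * Om) : 0 <= (V p.1.1 + V p.1.2)%:E :> \bar R by rewrite lee_fin addr_ge0.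
apply: (@le_trans _ _ (T s q (fun p => (cst c%:E) p.2 * (V p.1.1 + V p.1.2)%:E + (cst bb%:E)
    p.2) (x, w))).
  apply: (le_transfers env measurable_step2).
  - apply: (fibre_measurable_transfer env measurable_step2); first exact: fibre_measurable_differ.
    exact: differ_ge0.
  - move=> w' /=; apply: emeasurable_funD => //; apply: measurable_funeM; exact: (fV2 w').
  - by apply: transfer_ge0; exact: differ_ge0.
  - by move=> p; rewrite adde_ge0// ?mule_ge0// ?lee_fin.
  - move=> x'; apply: (le_trans (transfer_differ_le _ _ hb)); first by rewrite bb0.
    by rewrite /= -EFinM -EFinD lee_fin /c addrC mulrA mulrAC.
rewrite (@transfers_affine _ _ _ _ _ _ _ env measurable_step2)//; last first.
apply: (@le_trans _ _ (c%:E * (gam_prod env gam s q w * (V x.1 + V x.2) +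
   2 * \sum_(l < q) Kgam_prod env gam K (s + (q - l.+1)) l w)%:E + bb%:E)).
  by rewrite leeD2r// lee_wpmul2l//; exact: transfers_V2.
rewrite -EFinM -!EFinD lee_fin.
rewrite -(big_mkord xpredT (fun l => Kgam_prod env gam K (s + (q - l.+1)) l w)).
rewrite (big_cat_nat _ iq)//= big_mkord.
set L := (\sum_(i0 < i) _)%R in hL *.
rewrite [X in (c * X)%R](_ : _ = 2 * L + rest)%R; last by rewrite /rest; ring.
have h1 : (c * (2 * L + rest) <= c * (2 * rho + rest))%R.
  by rewrite ler_wpM2l// lerD2r ler_pM2l.
have a0 : a != 0%R by rewrite gt_eqF.
(* As [a = 4 * rho], the local part contributes [(1 - bb) / 2], and
   [bb + (1 - bb) / 2 = (1 + bb) / 2]. *)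
have h2 : (c * (2 * rho + rest) = (1 - bb) / 2 + rest / a - bb * (rest / a))%R.
  rewrite /c (_ : rho = a / 4)%R; last by rewrite arho mulrC mulKf.
  by field.
have := mulr_ge0 bb0 resta0; lra.
Qed.

End coupling.

(** * Trajectories driven by a single seed *)

Section run.
Context {R : realType} {dS dY : measure_display} {S : measurableType dS}
  {Y : measurableType dY} {Om : Type}.
Notation U := (measurableTypeR R).
Variable tau : U -> U * U.
Hypothesis mtau : measurable_fun setT tau.
Hypothesis tauE : forall A, measurable A -> lam R (tau @^-1` A) = (lam R \x lam R) A.
Variables (g : S -> Y -> R -> S) (env : nat -> Om -> Y).

(* [(tau v).1] drives the current step and [(tau v).2] seeds all later ones. *)
Fixpoint run (m j : nat) (x : S) (w : Om) (v : U) : S :=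
  if m is m'.+1 then run m' j.+1 (g x (env j w) (tau v).1) w (tau v).2 else x.

(** [run] consumes the noise from the front, as Fubini requires, whereas [Z_iter] adds steps at the
    end; this equation links the two. *)
Lemma runSr m j x w v :
  run m.+1 j x w v = g (run m j x w v) (env (j + m)%N w) (noise tau m v).
Proof.
elim: m j x v => [|m ih] j x v; first by rewrite /= addn0.
rewrite -[LHS]/(run m.+1 j.+1 (g x (env j w) (tau v).1) w (tau v).2) ih /=.
by rewrite addSnnS noiseSr.
Qed.

Hypothesis mg : measurable_fun setT (fun q : S * Y * U => g q.1.1 q.1.2 q.2).

Lemma measurable_run m j w : measurable_fun setT (fun p : S * U => run m j p.1 w p.2).
Proof.
elim: m j => [|m ih] j /=; first exact: measurable_fst.
apply: (measurableT_comp (ih j.+1) (f := fun p : S * U => run m j.+1 p.1 w p.2)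
  (g := fun p : S * U => (g p.1 (env j w) (tau p.2).1, (tau p.2).2))).
apply: measurable_fun_pair; last first.
  by apply: (measurableT_comp measurable_snd); exact: (measurableT_comp mtau measurable_snd).
apply: (measurableT_comp (measurable_step mg (env j w)) (f := fun p : S * U => g p.1 (env j w) p.2)
  (g := fun p : S * U => (p.1, (tau p.2).1))).
apply: measurable_fun_pair; first exact: measurable_fst.
by apply: (measurableT_comp measurable_fst); exact: (measurableT_comp mtau measurable_snd).
Qed.

(** By [tauE] the first noise and the seed of the later ones are independent and uniform, so Fubini
    peels off one transfer per step. *)
Lemma integral_run m j x w phi : fibre_measurable phi -> (forall p, 0 <= phi p) ->
  \int[lam R]_v phi (run m j x w v, w) = transfers g env j m phi (x, w).
Proof.
move=> mphi phi0; elim: m j x => [|m ih] j x.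
  by rewrite /= integral_cst// [X in _ * X]probability_setT mule1.
rewrite /= /transfer /=.
rewrite (@ge0_integral_tau _ tau mtau tauE
  (fun ab => phi (run m j.+1 (g x (env j w) ab.1) w ab.2, w)))//.
  by apply: eq_integral => a _; rewrite /= -[RHS]ih.
apply: (measurableT_comp (mphi w)).
apply: (measurableT_comp (measurable_run m j.+1 w) (f := fun p : S * U => run m j.+1 p.1 w p.2)
  (g := fun ab : U * U => (g x (env j w) ab.1, ab.2))).
apply: measurable_fun_pair; last exact: measurable_snd.
apply: (measurableT_comp (measurable_step mg (env j w)) (f := fun p : S * U => g p.1 (env j w) p.2)
  (g := fun ab : U * U => (x, ab.1))).
by apply: measurable_fun_pair => //; exact: measurable_fst.
Qed.

End run.

Section Z_iter.
Context {R : realType} {dX dY dO : measure_display} {X : measurableType dX}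
  {Y : measurableType dY} {Om : measurableType dO}.
Notation U := (measurableTypeR R).
Variable tau : U -> U * U.
Hypothesis mtau : measurable_fun setT tau.
Hypothesis tauE : forall A, measurable A -> lam R (tau @^-1` A) = (lam R \x lam R) A.
Variables (f : X -> Y -> R -> X) (env : nat -> Om -> Y) (eps : nat -> Om * U -> R).
Hypothesis mf : measurable_fun setT (fun q : X * Y * U => f q.1.1 q.1.2 q.2).
Hypothesis mdiag : measurable_fun setT (fun p : X * X => p.1 != p.2).
Hypothesis f_eps : forall x y n p, f x y (eps n p) = f x y (noise tau n p.2).

Lemma noise_seed m j u : noise tau m (seed tau j u) = noise tau (m + j) u.
Proof. by rewrite /noise /seed iterD. Qed.

(** The seed has index [j.+1] since the step from [j] to [j + 1] uses the noise of time [j + 1]. *)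
Lemma Z_iter_run j (x1 : Om * U -> X) m p :
  Z_iter f (fun n => env n \o fst) eps j x1 m p =
  run tau f env m j (x1 p) p.1 (seed tau j.+1 p.2).
Proof.
elim: m => [//|m ih]; rewrite runSr noise_seed /= ih f_eps.
by rewrite addnS [(m + j)%N]addnC.
Qed.

Lemma run_step2 m j x x' w v :
  run tau (step2 f) env m j (x, x') w v = (run tau f env m j x w v, run tau f env m j x' w v).
Proof. by elim: m j x x' v => [//|m ih] j x x' v /=; rewrite /step2/= ih. Qed.

Lemma prob_Z_iter_neq (P : probability Om R) (x1 : Om -> X) (x0 : X) j m :
  (P \x lam R) [set p | Z_iter f (fun n => env n \o fst) eps j (x1 \o fst) m p <>
                   Z_iter f (fun n => env n \o fst) eps j (cst x0) m p] =
  \int[P]_w transfers (step2 f) env j m (@differ R _ _ Om) ((x1 w, x0), w).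
Proof.
(* The product measure is the integral of the measures of the sections: environment and start [x1 w]
   are frozen, only the noise is random. *)
apply: eq_integral => w _.
rewrite -(integral_run mtau tauE env (measurable_step2 mf) m j (x1 w, x0) w
   (fibre_measurable_differ mdiag)) ?differ_ge0//; last exact: differ_ge0.
have mrun2 : measurable_fun [set: U] (fun v => run tau (step2 f) env m j (x1 w, x0) w v).
  exact: (measurableT_comp (measurable_run mtau env (measurable_step2 mf) m j w)
    (pair1_measurable (x1 w, x0))).
rewrite -(ge0_integral_seed mtau tauE j.+1 (phi := fun v => differ (run tau (step2 f) env m j
    (x1 w, x0) w v, w))); last first.
- by move=> v; exact: differ_ge0.
- exact: (measurableT_comp (measurable_neq_EFin mdiag) mrun2).
pose A := [set u : U | (run tau (step2 f) env m j (x1 w, x0) w (seed tau j.+1 u)).1 !=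
   (run tau (step2 f) env m j (x1 w, x0) w (seed tau j.+1 u)).2].
have mA : measurable A.
  have := measurableT_comp mdiag (measurableT_comp mrun2 (measurable_seed mtau j.+1)).
  by move=> /(_ measurableT [set true] I); rewrite setTI; congr measurable; apply/seteqP; split.
transitivity (lam R A).
  apply: (congr1 (lam R)); apply/seteqP; split => u /=.
    by rewrite /xsection/= inE/= !Z_iter_run/= /A/= run_step2/= => /eqP.
  by rewrite /xsection/= inE/= !Z_iter_run/= /A/= run_step2/= => /eqP.
rewrite -[X in lam R X]setIT -integral_indic//.
apply: eq_integral => u _; rewrite indicE /differ /=; congr ((nat_of_bool _)%:R%:E).
by apply/idP/idP; rewrite inE.
Qed.

End Z_iter.

(** * Joint law of the chain and the environment *)

Lemma rect_measure_unique d1 d2 (T1 : measurableType d1) (T2 : measurableType d2)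
    (R : realType) (m1 m2 : {measure set (T1 * T2) -> \bar R}) :
  m1 setT < +oo ->
  (forall A B, measurable A -> measurable B -> m1 (A `*` B) = m2 (A `*` B)) ->
  forall C, measurable C -> m1 C = m2 C.
Proof.
move=> m1oo m12 C.
apply: (measure_unique [set A `*` B | A in measurable & B in measurable] (cst setT)) => //.
- exact: measurable_prod_measurableType.
- move=> _ _ [A1 mA1 [B1 mB1 <-]] [A2 mA2 [B2 mB2 <-]]; rewrite -setXI.
  by exists (A1 `&` A2); [exact: measurableI|exists (B1 `&` B2) => //; exact: measurableI].
- by move=> i; exists setT => //; exists setT => //; rewrite setXTT.
- by apply/seteqP; split => // x _; exists 0%N.
- by move=> _ [A mA [B mB <-]]; exact: m12.
Qed.

Section environment.
Context {R : realType} {d dY : measure_display} {Om : measurableType d}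
  {Y : measurableType dY}.
Variables (P : probability Om R) (Yp : nat -> Om -> Y).
Hypothesis mY : forall n, measurable_fun setT (Yp n).

(** [Om] with the sigma-algebra generated by the environment at times in [D]: depending on these
    times only becomes measurability on this type. *)
Definition env_space (D : set nat) := g_sigma_algebraType (gen_events D Yp).

Lemma gen_events_measurable D A : <<s gen_events D Yp >> A -> measurable A.
Proof.
apply: smallest_sub; first exact: sigma_algebra_measurable.
by move=> _ [k _ [B mB <-]]; exact: mY.
Qed.

Lemma measurable_id_env D : measurable_fun [set: Om] (idfun : Om -> env_space D).
Proof. by move=> _ A mA; rewrite setTI; exact: (gen_events_measurable mA). Qed.

Lemma measurable_env D k : D k ->
  measurable_fun [set: env_space D] (Yp k : env_space D -> Y).
Proof.
move=> Dk _ B mB; apply: sub_sigma_algebra; exists k => //.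
by exists B => //; rewrite setTI.
Qed.

End environment.

Section joint_law.
Context {R : realType} {d dX dY : measure_display} {Om : measurableType d}
  {X : measurableType dX} {Y : measurableType dY}.
Variables (P : probability Om R) (Q : R.-pker (Y * X)%type ~> X).
Variables (Yp : nat -> Om -> Y) (Xp : nat -> Om -> X).
Hypotheses (mY : forall n, measurable_fun setT (Yp n))
  (mX : forall n, measurable_fun setT (Xp n)).
Hypothesis XY_markov : markov_chain_in_env P Q Yp Xp.
Hypothesis X0_indep : indep_sigma P <<s gen_events [set 0%N] Xp >>
                              <<s gen_events setT Yp >>.
Variable f : X -> Y -> R -> X.
Notation U := (measurableTypeR R).
Hypothesis mf : measurable_fun setT (fun q : X * Y * U => f q.1.1 q.1.2 q.2).
Hypothesis f_law : forall y x B, measurable B -> lam R (f x y @^-1` B) = Q (y, x) B.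

Notation OmY := (env_space Yp setT).

Let PT : P setT = 1. Proof. exact: probability_setT. Qed.

(** By independence, the laws of [(Xp 0 w, w)] under [P] and of [(Xp 0 w', w)] under the product
    agree on rectangles whose second side is an event of the environment. *)
Lemma integral_start (psi : X * OmY -> \bar R) : measurable_fun setT psi ->
  (forall p, 0 <= psi p) ->
  \int[P]_w psi (Xp 0%N w, w) = \int[P]_w \int[P]_w' psi (Xp 0%N w', w).
Proof.
move=> mpsi psi0.
pose k (w : Om) : X * OmY := (Xp 0%N w, w).
have mk : measurable_fun setT k by apply: measurable_fun_pair => //; exact: measurable_id_env.
pose h (p : Om * Om) : X * OmY := (Xp 0%N p.1, p.2).
have mh : measurable_fun setT h.
  apply: measurable_fun_pair; first exact: (measurableT_comp (mX 0%N) measurable_fst).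
  exact: (measurableT_comp (measurable_id_env mY (D := setT)) measurable_snd).
transitivity (\int[P \x P]_p psi (h p)); last first.
  exact: (fubini_tonelli2 (psi \o h) (measurableT_comp mpsi mh) (fun p => psi0 _)).
transitivity (\int[law (P \x P)%E mh]_p psi p).
  apply: (ge0_integral_image mk _ mpsi psi0) => A mA.
  apply: (rect_measure_unique (m1 := law P mk) (m2 := law (P \x P)%E mh)) => //.
    by rewrite [X in X < _]PT ltry.
  move=> B C mB mC.
  transitivity (P ((Xp 0%N @^-1` B) `&` C)); first by [].
  rewrite X0_indep//; last first.
    by apply: sub_sigma_algebra; exists 0%N => //; exists B => //; rewrite setTI.
  apply/esym; apply: product_measure1E.
    by rewrite -[X in measurable X]setTI; exact: mX.
  exact: (gen_events_measurable mY mC).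
by apply/esym; apply: (ge0_integral_image mh _ mpsi psi0).
Qed.

(** Rectangles suffice again: an event of the whole environment belongs to the conditioning
    sigma-algebra, so the Markov property gives their measure, and [f_law] expresses the kernel
    through the noise. *)
Lemma integral_next n (psi : X * OmY -> \bar R) : measurable_fun setT psi ->
  (forall p, 0 <= psi p) ->
  \int[P]_w psi (Xp n.+1 w, w) = \int[P]_w transfer f Yp n psi (Xp n w, w).
Proof.
move=> mpsi psi0.
pose k (w : Om) : X * OmY := (Xp n.+1 w, w).
have mk : measurable_fun setT k by apply: measurable_fun_pair => //; exact: measurable_id_env.
pose h (p : Om * U) : X * OmY := (f (Xp n p.1) (Yp n p.1) p.2, p.1).
have mh : measurable_fun setT h.
  apply: measurable_fun_pair; last first.
    exact: (measurableT_comp (measurable_id_env mY (D := setT)) measurable_fst).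
  apply: (measurableT_comp mf (f := fun q : X * Y * U => f q.1.1 q.1.2 q.2)
    (g := fun p : Om * U => ((Xp n p.1, Yp n p.1), p.2))).
  apply: measurable_fun_pair; last exact: measurable_snd.
  by apply: measurable_fun_pair; [exact: (measurableT_comp (mX n) measurable_fst)|
    exact: (measurableT_comp (mY n) measurable_fst)].
transitivity (\int[P \x lam R]_p psi (h p)); last first.
  exact: (fubini_tonelli1 (psi \o h) (measurableT_comp mpsi mh) (fun p => psi0 _)).
transitivity (\int[law (P \x lam R)%E mh]_p psi p).
  apply: (ge0_integral_image mk _ mpsi psi0) => A mA.
  apply: (rect_measure_unique (m1 := law P mk) (m2 := law (P \x lam R)%E mh)) => //.
    by rewrite [X in X < _]PT ltry.
  move=> B C mB mC.
  transitivity (P ((Xp n.+1 @^-1` B) `&` C)); first by [].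
  have [_ <-] := XY_markov n mB; last first.
    move: mC; apply: smallest_sub; first exact: smallest_sigma_algebra.
    by move=> D hD; apply: sub_sigma_algebra; right.
  rewrite integral_mkcond; apply: eq_integral => w _; rewrite patchE.
  case: ifPn => [|]; rewrite ?inE => Cw.
    rewrite -(f_law _ _ mB); apply: (congr1 (lam R)); apply/seteqP; split => u /=.
      by rewrite /xsection/= inE.
    by rewrite /xsection/= inE => -[].
  transitivity (lam R set0); first by rewrite measure0.
  apply: (congr1 (lam R)); apply/seteqP; split => // u.
  by rewrite /xsection/= inE => -[_ /=]; move: Cw; rewrite notin_setE.
by apply/esym; apply: (ge0_integral_image mh _ mpsi psi0).
Qed.

(** Iterating [integral_next] back to time 0 leaves the start, which independence separates from the
    environment: this is the quenched law of [Xp j]. *)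
Lemma integral_chain j (psi : X * OmY -> \bar R) : measurable_fun setT psi ->
  (forall p, 0 <= psi p) ->
  \int[P]_w psi (Xp j w, w) =
  \int[P]_w \int[P]_w' transfers f Yp 0 j psi (Xp 0%N w', w).
Proof.
elim: j psi => [|j ih] psi mpsi psi0; first exact: integral_start.
rewrite integral_next// ih ?transfersSr//; last exact: transfer_ge0.
apply: (@measurable_transfer _ _ _ _ _ _ OmY f Yp mf j psi _ mpsi psi0).
exact: measurable_env.
Qed.

End joint_law.

(** * Covariance inequality for the mixing coefficient *)

Section covariance.
Context {R : realType} {d : measure_display} {Om : measurableType d}.
Variable P : probability Om R.
Notation U := (measurableTypeR R).
Variables G1 G2 : set (set Om).
Hypotheses (sG1 : <<s G1 >> `<=` (measurable : set (set Om)))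
  (sG2 : <<s G2 >> `<=` (measurable : set (set Om))).

Lemma alpha_dep_ge A B : <<s G1 >> A -> <<s G2 >> B ->
  P (A `&` B) <= P A * P B + alpha_dep P <<s G1 >> <<s G2 >>.
Proof.
move=> gA gB; have mA := sG1 gA; have mB := sG2 gB.
have f1 : P A * P B \is a fin_num by rewrite fin_numM// fin_num_measure.
rewrite -leeBlDl//; apply: le_trans (lee_abs _) _.
by apply: ereal_sup_ubound; exists (A, B).
Qed.

Lemma alpha_dep_ge0 : 0 <= alpha_dep P <<s G1 >> <<s G2 >>.
Proof.
have h0 (G : set (set Om)) : <<s G >> set0 by exact: sigma_algebra0.
have := alpha_dep_ge (h0 G1) (h0 G2).
by rewrite set0I measure0 mul0e add0e.
Qed.

(* Layer-cake: [h w] is the probability that a uniform variable is at most [h w]. *)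
Lemma covariance_alpha_dep (h : Om -> R) (A : set Om) :
  measurable_fun setT (h : g_sigma_algebraType G1 -> R) ->
  (forall w, (0 <= h w <= 1)%R) -> <<s G2 >> A ->
  \int[P]_w ((\1_A w)%:E * (h w)%:E) <=
  P A * \int[P]_w (h w)%:E + alpha_dep P <<s G1 >> <<s G2 >>.
Proof.
move=> mh h01 gA; have mA := sG2 gA.
have mhO : measurable_fun [set: Om] h.
  by move=> _ B mB; have := mh measurableT B mB; rewrite !setTI => /sG1.
pose C : set (Om * U) := [set p | (p.2 <= h p.1)%R].
have mC : measurable C.
  rewrite -[X in measurable X]setTI; apply: measurable_fun_le => //.
  exact: (measurableT_comp mhO measurable_fst).
pose CA : set (Om * U) := C `&` (A `*` setT).
have mCA : measurable CA by apply: measurableI => //; exact: measurableX.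
have ind (T : Type) (B : set T) t : 0 <= ((\1_B t)%:E : \bar R) by rewrite lee_fin.
have lam_h w : \int[lam R]_u (\1_C (w, u))%:E = (h w)%:E.
  pose D : set U := [set u | (u <= h w)%R].
  have mD : measurable D.
    rewrite (_ : D = [set` `]-oo, (h w)]]); first exact: measurable_itv.
    by apply/seteqP; split => u /=; rewrite /D in_itv.
  transitivity (lam R D).
    by rewrite -[X in lam R X]setIT -integral_indic//.
  have /andP[h0 h1] := h01 w.
  rewrite lam_supp// -[RHS](lam_itv_cc h0 h1); apply: (congr1 (lam R)).
  apply/seteqP; split => u /=; rewrite /D /= !in_itv/=; first by case=> -> /andP[->].
  by move=> /andP[-> uh]; rewrite uh (le_trans uh).
have mi (D : set (Om * U)) : measurable D -> measurable_fun setT (fun p => (\1_D p)%:E : \bar R).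
  by move=> mD; apply/measurable_EFinP; exact: measurable_indic.
have mlevel u : measurable [set w | (u <= h w)%R].
  by rewrite -[X in measurable X]setTI; exact: measurable_fun_le.
have secC u : \int[P]_w (\1_C (w, u))%:E = P [set w | (u <= h w)%R].
  by rewrite -[X in P X]setIT -integral_indic.
have secCA u : \int[P]_w (\1_CA (w, u))%:E = P ([set w | (u <= h w)%R] `&` A).
  rewrite -[X in P X]setIT -integral_indic//; last exact: measurableI.
  apply: eq_integral => w _; rewrite !indicE; congr ((nat_of_bool _)%:R%:E).
  by apply/idP/idP; rewrite !inE /CA /C /=; tauto.
have -> : \int[P]_w ((\1_A w)%:E * (h w)%:E) = \int[lam R]_u P ([set w | (u <= h w)%R] `&` A).
  transitivity (\int[P]_w \int[lam R]_u (\1_CA (w, u))%:E).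
    apply: eq_integral => w _; rewrite -lam_h -ge0_integralZl//; last first.
      apply: (measurableT_comp (mi _ mC)); exact: pair1_measurable.
    apply: eq_integral => u _; rewrite !indicE -EFinM -natrM mulnb; congr ((nat_of_bool _)%:R%:E).
    by apply/andP/idP; rewrite !inE /CA /C /=; tauto.
  rewrite (@fubini_tonelli _ _ _ _ _ P (lam R) (fun p => (\1_CA p)%:E) (mi _ mCA))//.
  by apply: eq_integral => u _; exact: secCA.
have -> : \int[P]_w (h w)%:E = \int[lam R]_u P [set w | (u <= h w)%R].
  transitivity (\int[P]_w \int[lam R]_u (\1_C (w, u))%:E).
    by apply: eq_integral => w _; rewrite lam_h.
  rewrite (@fubini_tonelli _ _ _ _ _ P (lam R) (fun p => (\1_C p)%:E) (mi _ mC))//.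
  by apply: eq_integral => u _; exact: secC.
have msec : measurable_fun [set: U] (fun u => P [set w | (u <= h w)%R]).
  rewrite -(funext secC).
  exact: (@measurable_fun_fubini_tonelli_G _ _ _ _ _ P (fun p => (\1_C p)%:E) (mi _ mC)).
have msecA : measurable_fun [set: U] (fun u => P ([set w | (u <= h w)%R] `&` A)).
  rewrite -(funext secCA).
  exact: (@measurable_fun_fubini_tonelli_G _ _ _ _ _ P (fun p => (\1_CA p)%:E) (mi _ mCA)).
rewrite -ge0_integralZl//.
(* The mixing bound is applied to each level set [u <= h w], an event of the first sigma-algebra,
   and integrated over [u]. *)
apply: (@le_trans _ _ (\int[lam R]_u (P A * P [set w | (u <= h w)%R] +
    alpha_dep P <<s G1 >> <<s G2 >>))).
  apply: ge0_le_integral => //.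
  - by apply: emeasurable_funD => //; exact: measurable_funeM.
  - move=> u _; rewrite [P A * _]muleC; apply: alpha_dep_ge => //.
    rewrite -[X in <<s _ >> X]setTI.
    exact: (@measurable_fun_le _ (g_sigma_algebraType G1) _ setT (cst u) h measurableT _ mh).
rewrite ge0_integralD//; last 3 first.
- by move=> u _; rewrite mule_ge0.
- exact: measurable_funeM.
- by move=> u _; exact: alpha_dep_ge0.
by rewrite integral_cst// [X in _ * X]probability_setT mule1.
Qed.

End covariance.

(** * Moments of the environment *)

Section measurable_products.
Context {R : realType} {d dY : measure_display} {Om : measurableType d}
  {Y : measurableType dY}.
Variables (env : nat -> Om -> Y) (gam K : Y -> R).
Hypotheses (mgam : measurable_fun setT gam) (mK : measurable_fun setT K).

Lemma measurable_gam_prod s m :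
  (forall k, (s <= k < s + m)%N -> measurable_fun setT (env k)) ->
  measurable_fun setT (gam_prod env gam s m).
Proof.
elim: m s => [|m ih] s menv.
  rewrite (_ : gam_prod _ _ _ _ = cst 1%R)//.
  by apply/funext => w; rewrite /gam_prod big_ord0.
rewrite (_ : gam_prod _ _ _ _ = (fun w => gam (env s w) * gam_prod env gam s.+1 m w)%R); last first.
  by apply/funext => w; rewrite gam_prodS.
apply: measurable_funM.
  by apply: (measurableT_comp mgam); apply: menv; rewrite leqnn addnS ltnS leq_addr.
by apply: ih => k /andP[sk km]; apply: menv; rewrite (ltnW sk) addnS -addSn.
Qed.

Lemma measurable_Kgam_prod s l :
  (forall k, (s <= k <= s + l)%N -> measurable_fun setT (env k)) ->
  measurable_fun setT (Kgam_prod env gam K s l).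
Proof.
move=> menv; apply: measurable_funM.
  by apply: (measurableT_comp mK); apply: menv; rewrite leqnn leq_addr.
by apply: measurable_gam_prod => k /andP[sk km]; apply: menv; rewrite (ltnW sk) -ltnS -addSn.
Qed.

End measurable_products.

Section moments.
Context {R : realType} {d dY : measure_display} {Om : measurableType d}
  {Y : measurableType dY}.
Variables (P : probability Om R) (Yp : nat -> Om -> Y) (gam K : Y -> R).
Hypothesis mY : forall n, measurable_fun setT (Yp n).
Hypotheses (mgam : measurable_fun setT gam) (mK : measurable_fun setT K).
Hypotheses (gam_gt0 : forall y, (0 < gam y)%R) (K_gt0 : forall y, (0 < K y)%R).

Notation dc := (d_coef P Yp gam K).
Notation rc := (r_coef P Yp gam K).

Lemma Kgam_moment s l : \int[P]_w (Kgam_prod Yp gam K s l w)%:E <= dc l.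
Proof.
case: l => [|l].
  (* [d_0] averages [K + gam], which dominates [K] alone. *)
  apply: (@le_trans _ _ 'E_P[(fun w => K (Yp s w) + gam (Yp s w))%R]); last first.
    by apply: ereal_sup_ubound; exists s.
  rewrite unlock; apply: ge0_le_integral => //.
  - by move=> w _; rewrite lee_fin Kgam_prod_ge0.
  - apply/measurable_EFinP; exact: measurable_Kgam_prod.
  - apply/measurable_EFinP; apply: measurable_funD; exact: measurableT_comp.
  - by move=> w _; rewrite lee_fin /Kgam_prod /gam_prod big_ord0 mulr1 lerDl ltW.
apply: ereal_sup_ubound; exists s.+1 => //.
by rewrite unlock.
Qed.

Lemma d_coef_ge0 l : 0 <= dc l.
Proof.
apply: le_trans (Kgam_moment 0 l); apply: integral_ge0 => w _.
by rewrite lee_fin Kgam_prod_ge0.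
Qed.

(** The case t = -1 of the supremum, where the factor [K] is 1 by convention. *)
Lemma gam0_moment m : \int[P]_w (gam_prod Yp gam 0 m.+1 w)%:E <= dc m.+1.
Proof.
apply: ereal_sup_ubound; exists 0%N => //.
by rewrite unlock; apply: eq_integral => w _; rewrite /= mul1r.
Qed.

(** For a product starting after time 0, [d_l] carries a factor [K] at the preceding time; inserting
    it costs [k0^-1]. The constant [1 + k0^-1] also covers a start at time 0. *)
Lemma gam_moment k0 j m : (0 < k0)%R -> (forall y, (k0 <= K y)%R) ->
  \int[P]_w (gam_prod Yp gam j m.+1 w)%:E <= (1 + k0^-1)%:E * dc m.+1.
Proof.
move=> k00 hk.
have d0 := d_coef_ge0 m.+1.
case: j => [|j].
  apply: (le_trans (gam0_moment m)).
  by rewrite -[leLHS]mul1e lee_wpmul2r// lee_fin lerDl invr_ge0 ltW.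
apply: (@le_trans _ _ (k0^-1%:E * dc m.+1)); last first.
  by rewrite lee_wpmul2r// lee_fin lerDr.
apply: (@le_trans _ _ (k0^-1%:E * \int[P]_w (Kgam_prod Yp gam K j m.+1 w)%:E)); last first.
  by apply: lee_wpmul2l; [rewrite lee_fin invr_ge0 ltW|exact: Kgam_moment].
have mKg : measurable_fun setT (fun w => (Kgam_prod Yp gam K j m.+1 w)%:E).
  by apply/measurable_EFinP; exact: measurable_Kgam_prod.
rewrite -ge0_integralZl//; last 2 first.
- by move=> w _; rewrite lee_fin Kgam_prod_ge0.
- by rewrite lee_fin invr_ge0 ltW.
apply: ge0_le_integral => //.
- by move=> w _; rewrite lee_fin gam_prod_ge0.
- by apply/measurable_EFinP; exact: measurable_gam_prod.
- exact: measurable_funeM.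
- move=> w _; rewrite -EFinM lee_fin /Kgam_prod mulrA ler_peMl ?gam_prod_ge0//.
  by rewrite mulrC ler_pdivlMr// mul1r.
Qed.

Lemma sum_d_coef_le i a b : (i <= a)%N -> \sum_(a <= l < b) dc l <= rc i.
Proof.
move=> ia; have [ab|ba] := leqP a b; last first.
  by rewrite big_geq ?(ltnW ba)//; apply: nneseries_ge0 => l _ _; exact: d_coef_ge0.
apply: (@le_trans _ _ (\sum_(i <= l < b) dc l)).
  rewrite (big_cat_nat ia ab) /= leeDr// sume_ge0// => l _; exact: d_coef_ge0.
by apply: nneseries_lim_ge => l _ _; exact: d_coef_ge0.
Qed.

Lemma d_coef_le i l : (i <= l)%N -> dc l <= rc i.
Proof. by move=> il; have := sum_d_coef_le l.+1 il; rewrite big_nat1. Qed.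

Lemma sum_Kgam_moment (a b : nat) (s : nat -> nat) :
  \int[P]_w (\sum_(a <= l < b) Kgam_prod Yp gam K (s l) l w)%:E <=
  \sum_(a <= l < b) dc l.
Proof.
under eq_integral do rewrite -sumEFin.
rewrite ge0_integral_sum//; last 2 first.
- by move=> l; apply/measurable_EFinP; exact: measurable_Kgam_prod.
- by move=> l w _; rewrite lee_fin Kgam_prod_ge0.
by apply: lee_sum => l _; exact: Kgam_moment.
Qed.

End moments.

Section transfersD.
Context {R : realType} {dS dY : measure_display} {S : measurableType dS}
  {Y : measurableType dY} {Om : Type}.
Variables (g : S -> Y -> R -> S) (env : nat -> Om -> Y).
Notation U := (measurableTypeR R).
Hypothesis mg : measurable_fun setT (fun q : S * Y * U => g q.1.1 q.1.2 q.2).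

Lemma transfersD s m phi1 phi2 :
  fibre_measurable phi1 -> fibre_measurable phi2 ->
  (forall p, 0 <= phi1 p) -> (forall p, 0 <= phi2 p) ->
  transfers g env s m (fun p => phi1 p + phi2 p) =
  (fun p => transfers g env s m phi1 p + transfers g env s m phi2 p).
Proof.
move=> m1 m2 p1 p2; elim: m s => [//|m ih] s; rewrite /= ih.
apply/funext => -[x w]; rewrite /transfer /= ge0_integralD//.
- by move=> u _; exact: transfers_ge0.
- apply: (measurable_fibre_step mg x (env s w) w).
  exact: fibre_measurable_transfers.
- by move=> u _; exact: transfers_ge0.
- apply: (measurable_fibre_step mg x (env s w) w).
  exact: fibre_measurable_transfers.
Qed.

End transfersD.

Section step_bound.
Context {R : realType} {dX dY : measure_display} {X : measurableType dX}
  {Y : measurableType dY} {Om : Type}.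
Variables (f : X -> Y -> R -> X) (env : nat -> Om -> Y).
Notation U := (measurableTypeR R).
Hypothesis mf : measurable_fun setT (fun q : X * Y * U => f q.1.1 q.1.2 q.2).
Hypothesis mdiag : measurable_fun setT (fun p : X * X => p.1 != p.2).
Variables (V : X -> R) (gam K bet : Y -> R) (a : R).
Hypotheses (mV : measurable_fun setT V) (V0 : forall x, (0 <= V x)%R).
Hypotheses (gam_gt0 : forall y, (0 < gam y)%R) (K_gt0 : forall y, (0 < K y)%R).
Hypotheses (a_gt0 : (0 < a)%R) (bet01 : forall y, (0 <= bet y < 1)%R).
Hypothesis driftV : forall x y,
  \int[lam R]_u (V (f x y u))%:E <= (gam y * V x + K y)%:E.
Hypothesis coupled : forall x x' y u, (V x <= a)%R -> (V x' <= a)%R ->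
  (u <= 1 - bet y)%R -> f x y u = f x' y u.

Notation T := (transfers (step2 f) env).
Notation Kg := (Kgam_prod env gam K).
Notation gp := (gam_prod env gam).

Lemma Kgam_prodM s l m w : (Kg s l w * gp (s.+1 + l) m w = Kg s (l + m) w)%R.
Proof. by rewrite /Kgam_prod gam_prodD mulrA. Qed.

(** The block bound at time [j + M], averaged over the first [M] steps. The contraction factor
    depends on [w] only and leaves the operators, so [T j M] of [differ] reappears and a recursion
    on [M] is possible. [V] at time [j + M] is replaced by its drift expansion from time [j]. *)
Lemma step_bound j M q i (bb rho : R) x w : (i <= q)%N -> (0 <= bb <= 1)%R ->
  a = (4 * rho)%R ->
  T j (M + q.+1) (@differ R _ _ Om) (x, w) <=
  (if good_env env gam K bet q i rho bb (j + M) w then (1 + bb) / 2 else 1)%:E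
    * T j M (@differ R _ _ Om) (x, w) +
  ((gp j (M + q) w * (V x.1 + V x.2) +
    2 * \sum_(0 <= l < M) Kg (j + (M - l.+1)) (l + q) w +
    2 * \sum_(i <= l < q) Kg (j + M + (q - l.+1)) l w) / a)%:E.
Proof.
move=> iq bb01 arho; have /andP[bb0 bb1] := bb01.
have m2 := measurable_step2 mf.
pose cG w' : \bar R := (if good_env env gam K bet q i rho bb (j + M) w' then (1 + bb) / 2 else
    1)%:E.
pose c w' : \bar R := (gp (j + M) q w' / a)%:E.
pose b w' : \bar R := (2 * (\sum_(i <= l < q) Kg (j + M + (q - l.+1)) l w') / a)%:E.
pose V2 (p : (X * X) * Om) : \bar R := (V p.1.1 + V p.1.2)%:E.
have cG0 w' : 0 <= cG w'.
  by rewrite /cG; case: ifP => _; rewrite lee_fin// divr_ge0 ?addr_ge0.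
have c0 w' : 0 <= c w' by rewrite lee_fin divr_ge0 ?gam_prod_ge0// ltW.
have b0 w' : 0 <= b w'.
  rewrite lee_fin divr_ge0 ?(ltW a_gt0)// mulr_ge0// sumr_ge0// => l _.
  exact: Kgam_prod_ge0.
have V20 p : 0 <= V2 p by rewrite lee_fin addr_ge0.
have fV2 : fibre_measurable V2.
  move=> w'; apply/measurable_EFinP; apply: measurable_funD.
    exact: (measurableT_comp mV measurable_fst).
  exact: (measurableT_comp mV measurable_snd).
have fd := @fibre_measurable_differ R _ X Om mdiag.
have d0 := @differ_ge0 R _ X Om.
have fphi1 : fibre_measurable (fun p : (X * X) * Om => cG p.2 * differ p + cst 0 p.2).
  move=> w' /=; apply: emeasurable_funD => //; apply: measurable_funeM; exact: (fd w').
have fphi2 : fibre_measurable (fun p : (X * X) * Om => c p.2 * V2 p + b p.2).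
  move=> w' /=; apply: emeasurable_funD => //; apply: measurable_funeM; exact: (fV2 w').
have phi10 (p : (X * X) * Om) : 0 <= cG p.2 * differ p + (cst 0 p.2 : \bar R).
  by rewrite adde0 mule_ge0.
have phi20 (p : (X * X) * Om) : 0 <= c p.2 * V2 p + b p.2 by rewrite adde_ge0// mule_ge0.
rewrite transfers_add.
apply: (@le_trans _ _ (T j M (fun p => (cG p.2 * differ p + cst 0 p.2) +
    (c p.2 * V2 p + b p.2)) (x, w))).
  apply: (le_transfers env m2).
  - by apply: (fibre_measurable_transfers env m2).
  - by move=> w'; apply: (emeasurable_funD (fphi1 w') (fphi2 w')).
  - exact: transfers_ge0.
  - by move=> p; rewrite adde_ge0.
  - move=> x'; apply: (le_trans (block_bound env mf mdiag mV V0 gam_gt0 K_gt0 a_gt0 bet01 driftV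
      coupled (j + M)%N x' w iq bb01 arho)).
    rewrite /= adde0 leeD2l// /c /V2 /b /= -EFinM -EFinD lee_fin.
    by rewrite mulrDl mulrAC.
rewrite (transfersD env m2)// (transfers_affine env m2)// (transfers_affine env m2)//.
rewrite adde0 leeD2l//.
apply: (@le_trans _ _ (c w * (gp j M w * (V x.1 + V x.2) +
   2 * \sum_(l < M) Kg (j + (M - l.+1)) l w)%:E + b w)).
  rewrite leeD2r// lee_wpmul2l//.
  exact: (transfers_V2 env mf mV V0 gam_gt0 K_gt0 driftV).
rewrite -EFinM -EFinD lee_fin.
have -> : (\sum_(0 <= l < M) Kg (j + (M - l.+1)) (l + q) w =
    gp (j + M) q w * \sum_(l < M) Kg (j + (M - l.+1)) l w)%R.
  rewrite big_mkord mulr_sumr; apply: eq_bigr => l _.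
  (* The term with [K] at time [j + M - l - 1] has its last [gam] at [j + M - 1], so the [q] factors
     of the block continue it. *)
  rewrite mulrC -Kgam_prodM; congr (_ * gp _ _ _)%R.
  by have := ltn_ord l; lia.
by rewrite gam_prodD; lra.
Qed.

End step_bound.

(** * Recursion for the probability of not having met *)

Section transfers_le1.
Context {R : realType} {dS dY : measure_display} {S : measurableType dS}
  {Y : measurableType dY} {Om : Type}.
Variables (g : S -> Y -> R -> S) (env : nat -> Om -> Y).
Notation U := (measurableTypeR R).
Hypothesis mg : measurable_fun setT (fun q : S * Y * U => g q.1.1 q.1.2 q.2).

(** Total mass is preserved: the bound 1 is written as [0 * phi + 1] so that [transfers_affine]
    computes its transfer. *)
Lemma transfers_le1 s m phi : fibre_measurable phi ->
  (forall p, 0 <= phi p) -> (forall p, phi p <= 1) ->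
  forall p, transfers g env s m phi p <= 1.
Proof.
move=> mphi phi0 phi1 [x w].
apply: (@le_trans _ _ (transfers g env s m (fun p => cst 0 p.2 * phi p + cst 1 p.2) (x, w))).
  apply: (le_transfers env mg) => //.
  - move=> w'; rewrite (_ : (fun x => _) = cst 1)//.
    by apply/funext => y; rewrite /= mul0e add0e.
  - by move=> p; rewrite /= mul0e add0e.
  - by move=> y; rewrite /= mul0e add0e.
by rewrite (transfers_affine env mg)//= mul0e add0e.
Qed.

End transfers_le1.

Section measurable_good_env.
Context {R : realType} {d dY : measure_display} {Om : measurableType d}
  {Y : measurableType dY}.
Variables (env : nat -> Om -> Y) (gam K bet : Y -> R).
Hypotheses (mgam : measurable_fun setT gam) (mK : measurable_fun setT K)
  (mbet : measurable_fun setT bet).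

(** The hypothesis lists the times that the event reads: none before [s + (q - i)], which leaves the
    first [q - i] values of the block unread. *)
Lemma measurable_good_env q i (rho bb : R) s : (i <= q)%N ->
  (forall k, (s + (q - i) <= k <= s + q)%N -> measurable_fun setT (env k)) ->
  measurable [set w | ~~ good_env env gam K bet q i rho bb s w].
Proof.
move=> iq menv.
have m1 : measurable_fun setT
    (fun w => \sum_(l < i) Kgam_prod env gam K (s + (q - l.+1)) l w)%R.
  apply: measurable_sum => l; apply: measurable_Kgam_prod => // k hk.
  by apply: menv; have := ltn_ord l; lia.
have m2 : measurable_fun setT (fun w => bet (env (s + q)%N w)).
  by apply: (measurableT_comp mbet); apply: menv; lia.
have mgood : measurable_fun setT (good_env env gam K bet q i rho bb s).
  by apply: measurable_and; apply: measurable_fun_ler.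
have := mgood measurableT [set false] I.
rewrite setTI; congr measurable; apply/seteqP; split => w /=; first by move->.
by move/negbTE.
Qed.

End measurable_good_env.

Section estimate.
Context {R : realType} {d dX dY : measure_display} {Om : measurableType d}
  {X : measurableType dX} {Y : measurableType dY}.
Variables (P : probability Om R) (Q : R.-pker (Y * X)%type ~> X).
Variables (Yp : nat -> Om -> Y) (Xp : nat -> Om -> X).
Hypotheses (mY : forall n, measurable_fun setT (Yp n))
  (mX : forall n, measurable_fun setT (Xp n)).
Hypothesis XY_markov : markov_chain_in_env P Q Yp Xp.
Hypothesis X0_indep : indep_sigma P <<s gen_events [set 0%N] Xp >>
                              <<s gen_events setT Yp >>.
Variable f : X -> Y -> R -> X.
Notation U := (measurableTypeR R).
Hypothesis mf : measurable_fun setT (fun q : X * Y * U => f q.1.1 q.1.2 q.2).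
Hypothesis f_law : forall y x B, measurable B -> lam R (f x y @^-1` B) = Q (y, x) B.
Hypothesis mdiag : measurable_fun setT (fun p : X * X => p.1 != p.2).
Variables (V : X -> R) (gam K bet : Y -> R) (a : R).
Hypotheses (mV : measurable_fun setT V) (V0 : forall x, (0 <= V x)%R).
Hypotheses (mgam : measurable_fun setT gam) (mK : measurable_fun setT K)
  (mbet : measurable_fun setT bet).
Hypotheses (gam_gt0 : forall y, (0 < gam y)%R) (K_gt0 : forall y, (0 < K y)%R).
Hypotheses (a_gt0 : (0 < a)%R) (bet01 : forall y, (0 <= bet y < 1)%R).
Hypothesis driftV : forall x y,
  \int[lam R]_u (V (f x y u))%:E <= (gam y * V x + K y)%:E.
Hypothesis coupled : forall x x' y u, (V x <= a)%R -> (V x' <= a)%R ->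
  (u <= 1 - bet y)%R -> f x y u = f x' y u.

Notation OmY := (env_space Yp setT).
Notation dc := (d_coef P Yp gam K).
Notation rc := (r_coef P Yp gam K).
Notation Kg := (Kgam_prod Yp gam K).
Notation gp := (gam_prod Yp gam).

Let EV := \int[P]_w (V (Xp 0%N w))%:E.

Let EV0 : 0 <= EV. Proof. by apply: integral_ge0 => w _; rewrite lee_fin. Qed.

Let mVgp s m (D : set nat) : (forall k, (s <= k < s + m)%N -> D k) ->
  measurable_fun setT (fun p : X * env_space Yp D => (V p.1 * gp s m p.2)%:E : \bar R).
Proof.
move=> hD; apply/measurable_EFinP; apply: measurable_funM.
  exact: (measurableT_comp mV measurable_fst).
have mgp : measurable_fun [set: env_space Yp D] (gp s m).
  by apply: (measurable_gam_prod mgam) => k hk; apply: measurable_env; exact: hD.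
exact: (measurableT_comp mgp measurable_snd).
Qed.

(** The weight closes the recursion on [j]: a drift step trades [V (Xp j.+1)] for
    [gam * V (Xp j) + K], so the product gains its factor at time [j] and a term bounded by
    [d_(m+1)] splits off. At time 0 independence lets the expectation factorise. *)
Lemma V_moment j m : \int[P]_w (V (Xp j w) * gp j m.+1 w)%:E <=
  EV * dc (j + m.+1) + \sum_(m.+1 <= l < m.+1 + j) dc l.
Proof.
elim: j m => [|j ih] m.
  rewrite addn0 big_geq// adde0 add0n.
  rewrite (@integral_start _ _ _ _ _ _ _ P Yp Xp mY mX X0_indep
    (fun p => (V p.1 * gp 0 m.+1 p.2)%:E))//; last 2 first.
  - exact: mVgp.
  - by move=> p; rewrite lee_fin mulr_ge0 ?gam_prod_ge0.
  apply: (@le_trans _ _ (\int[P]_w (EV * (gp 0 m.+1 w)%:E))).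
    rewrite le_eqVlt; apply/orP; left; apply/eqP; apply: eq_integral => w _.
    rewrite /EV muleC -ge0_integralZl//.
    - by apply: eq_integral => w' _; rewrite /= mulrC EFinM.
    - by apply/measurable_EFinP; exact: measurableT_comp.
    - by move=> w' _; rewrite lee_fin.
    - by rewrite lee_fin gam_prod_ge0.
  rewrite ge0_integralZl//.
  - by apply: lee_wpmul2l => //; exact: gam0_moment.
  - by apply/measurable_EFinP; exact: measurable_gam_prod.
  - by move=> w _; rewrite lee_fin gam_prod_ge0.
rewrite (@integral_next _ _ _ _ _ _ _ P Q Yp Xp mY mX XY_markov f mf f_law j
    (fun p => (V p.1 * gp j.+1 m.+1 p.2)%:E))//; last 2 first.
- exact: mVgp.
- by move=> p; rewrite lee_fin mulr_ge0 ?gam_prod_ge0.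
have mVX : measurable_fun setT (fun w => (V (Xp j w) * gp j m.+2 w)%:E).
  apply/measurable_EFinP; apply: measurable_funM; first exact: measurableT_comp.
  exact: measurable_gam_prod.
have mKg : measurable_fun setT (fun w => (Kg j m.+1 w)%:E).
  by apply/measurable_EFinP; exact: measurable_Kgam_prod.
apply: (@le_trans _ _ (\int[P]_w ((V (Xp j w) * gp j m.+2 w)%:E + (Kg j m.+1 w)%:E))).
  apply: ge0_le_integral => //.
  - by move=> w _; apply: transfer_ge0 => p; rewrite lee_fin mulr_ge0 ?gam_prod_ge0.
  - have mh : measurable_fun setT (fun w => (Xp j w, w) : X * OmY).
      by apply: measurable_fun_pair => //; exact: measurable_id_env.
    apply: (measurableT_comp _ mh); apply: (@measurable_transfer _ _ _ _ _ _ OmY f Yp mf).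
    + exact: measurable_env.
    + exact: mVgp.
    + by move=> p; rewrite lee_fin mulr_ge0 ?gam_prod_ge0.
  - exact: emeasurable_funD.
  - move=> w _; rewrite /transfer /=.
    under eq_integral do rewrite mulrC EFinM.
    rewrite ge0_integralZl//; last 3 first.
    + apply/measurable_EFinP; apply: (measurableT_comp mV).
      exact: (measurableT_comp (measurable_step mf (Yp j w)) (pair1_measurable (Xp j w))).
    + by move=> u _; rewrite lee_fin.
    + by rewrite lee_fin gam_prod_ge0.
    apply: (le_trans (lee_wpmul2l _ (driftV _ _))).
      by rewrite lee_fin gam_prod_ge0.
    by rewrite -EFinM -EFinD lee_fin [gp j m.+2 w]gam_prodS /Kgam_prod; lra.
rewrite ge0_integralD//; last 2 first.
- by move=> w _; rewrite lee_fin mulr_ge0 ?gam_prod_ge0.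
- by move=> w _; rewrite lee_fin Kgam_prod_ge0.
apply: (le_trans (leeD (ih m.+1) (Kgam_moment P mY mgam mK gam_gt0 K_gt0 j m.+1))).
rewrite -addeA [X in _ + X]addeC -big_ltn ?addnS ?addSn ?ltnS ?leq_addr//.
Qed.

Variable x0 : X.

Notation T := (transfers (step2 f) Yp).

Definition meet_fail j M : \bar R :=
  \int[P]_w T j M (@differ R _ X Om) ((Xp j w, x0), w).

Lemma measurable_transfers_differ j M (D : set nat) :
  (forall k, (j <= k < j + M)%N -> D k) ->
  measurable_fun setT (fun p : X * env_space Yp D =>
    T j M (@differ R _ X Om) ((p.1, x0), p.2)).
Proof.
move=> hD.
have md : measurable_fun setT (@differ R _ X Om : (X * X) * env_space Yp D -> \bar R).
  exact: (measurableT_comp (measurable_neq_EFin mdiag) measurable_fst).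
have mT : measurable_fun setT (T j M (@differ R _ X Om) : (X * X) * env_space Yp D -> \bar R).
  apply: (@measurable_transfers _ _ _ _ _ _ (env_space Yp D) (step2 f) Yp
    (measurable_step2 mf) j M _ _ md (@differ_ge0 R _ X Om)) => k hk.
  by apply: measurable_env; exact: hD.
apply: (measurableT_comp mT (g := fun p : X * env_space Yp D => ((p.1, x0), p.2))).
apply: measurable_fun_pair; last exact: measurable_snd.
by apply: measurable_fun_pair => //; exact: measurable_fst.
Qed.

Lemma measurable_meet_fail j M :
  measurable_fun setT (fun w => T j M (@differ R _ X Om) ((Xp j w, x0), w)).
Proof.
have mh : measurable_fun setT (fun w => (Xp j w, w) : X * OmY).
  by apply: measurable_fun_pair => //; exact: measurable_id_env.
exact: (measurableT_comp (measurable_transfers_differ (D := setT) (fun _ _ => I)) mh).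
Qed.

Lemma meet_fail_ge0 j M : 0 <= meet_fail j M.
Proof. by apply: integral_ge0 => w _; exact: transfers_differ_ge0. Qed.

Lemma meet_fail_le1 j M : meet_fail j M <= 1.
Proof.
apply: (@le_trans _ _ (\int[P]_w (cst 1) w)).
  apply: ge0_le_integral => //.
  - by move=> w _; exact: transfers_differ_ge0.
  - exact: measurable_meet_fail.
  - by move=> w _; exact: (transfers_differ_le1 Yp mf mdiag).
by rewrite integral_cst// [X in _ * X]probability_setT mule1.
Qed.

Definition bad_env q i (rho bb : R) s : set Om :=
  [set w | ~~ good_env Yp gam K bet q i rho bb s w].

(* Conditionally on the environment, the law of [Xp j] only depends on the past of the
   environment, because the chain started from the independent [Xp 0] does. *)
Lemma decorrelate j M q i (rho bb : R) : (i <= q)%N ->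
  \int[P]_w ((\1_(bad_env q i rho bb (j + M)) w)%:E *
    T j M (@differ R _ X Om) ((Xp j w, x0), w)) <=
  P (bad_env q i rho bb (j + M)) * meet_fail j M + alpha_coef P Yp (q + 1 - i).
Proof.
move=> iq; set bad := bad_env _ _ _ _ _.
(* [t] is the last time before the block, an integer because it is -1 when [j = M = 0]; the past is
   then trivial. The future starts at [t + (q + 1 - i) = j + M + (q - i)]. *)
pose t : int := ((j + M)%N%:Z - 1)%R.
pose D1 := [set k : nat | (k%:Z <= t)%R].
pose D2 := [set k : nat | (t + (q + 1 - i)%N%:Z <= k%:Z)%R].
pose psi (p : X * Om) : \bar R := T j M (@differ R _ X Om) ((p.1, x0), p.2).
have psi0 p : 0 <= psi p by exact: transfers_differ_ge0.
have psi1 p : psi p <= 1 by exact: (transfers_differ_le1 Yp mf mdiag).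
have hD1 k : (k < j + M)%N -> D1 k by rewrite /D1 /t /=; lia.
have mpsi D : (forall k, (j <= k < j + M)%N -> D k) ->
    measurable_fun setT (psi : X * env_space Yp D -> \bar R).
  by move=> hD; exact: measurable_transfers_differ.
have fpsi : fibre_measurable psi.
  move=> w; exact: (measurableT_comp (mpsi setT (fun _ _ => I)) (@pair2_measurable _ _ X OmY w)).
(* The conditional probability, given the environment, that the trajectories have not met by time
   [j + M]; the start is an independent copy of [Xp 0]. *)
pose h (w : Om) : \bar R := \int[P]_w' transfers f Yp 0 j psi (Xp 0%N w', w).
have chi0 p : 0 <= transfers f Yp 0 j psi p by exact: transfers_ge0.
have chi1 p : transfers f Yp 0 j psi p <= 1 by exact: (transfers_le1 Yp mf 0 j fpsi psi0 psi1).
have mchi D : (forall k, (k < j + M)%N -> D k) ->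
    measurable_fun setT (transfers f Yp 0 j psi : X * env_space Yp D -> \bar R).
  move=> hD; apply: (@measurable_transfers _ _ _ _ _ _ (env_space Yp D) f Yp mf) => //.
    by move=> k hk; apply: measurable_env; apply: hD; lia.
  by apply: mpsi => k /andP[_]; exact: hD.
have mjoint D : (forall k, (k < j + M)%N -> D k) ->
    measurable_fun setT (fun p : Om * env_space Yp D => transfers f Yp 0 j psi (Xp 0%N p.1, p.2)).
  move=> hD; apply: (measurableT_comp (mchi D hD) (g := fun p : Om * env_space Yp D => (Xp 0%N
      p.1, p.2))).
  apply: measurable_fun_pair; last exact: measurable_snd.
  exact: (measurableT_comp (mX 0%N) measurable_fst).
(* The chain up to [j] and the pair up to [j + M] both read only environment times before
   [j + M]. *)
have mh : measurable_fun setT (h : env_space Yp D1 -> \bar R).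
  apply: (@measurable_fun_fubini_tonelli_G _ _ _ (env_space Yp D1) _ P
    (fun p => transfers f Yp 0 j psi (Xp 0%N p.1, p.2)) (mjoint D1 hD1)).
  by move=> p; exact: chi0.
have h0 w : 0 <= h w by apply: integral_ge0 => w' _; exact: chi0.
have mchiO w : measurable_fun setT (fun w' => transfers f Yp 0 j psi (Xp 0%N w', w)).
  exact: (measurableT_comp (fibre_measurable_transfers Yp mf 0 j fpsi psi0 w) (mX 0%N)).
have h1 w : h w <= 1.
  apply: (@le_trans _ _ (\int[P]_w (cst 1) w)); first exact: ge0_le_integral.
  by rewrite integral_cst// [X in _ * X]probability_setT mule1.
have hfin w : h w = (fine (h w))%:E.
  by rewrite fineK// ge0_fin_numE// (le_lt_trans (h1 w))// ltry.
have mbadD D : (forall k, (j + M + (q - i) <= k <= j + M + q)%N -> D k) ->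
    @measurable _ (env_space Yp D) bad.
  move=> hD; apply: (@measurable_good_env _ _ _ (env_space Yp D) _ Yp gam K bet mgam mK mbet q i
      rho bb (j + M)%N iq) => k hk.
  by apply: measurable_env; exact: hD.
have ind0 w : 0 <= (\1_bad w)%:E :> \bar R by rewrite lee_fin.
(* The indicator depends on [w] only, so [transfers_affine] moves it out of the operators; [cst 0]
   supplies the affine term. *)
have lhsE : \int[P]_w ((\1_bad w)%:E * psi (Xp j w, w)) = \int[P]_w ((\1_bad w)%:E * h w).
  pose ind (w : Om) : \bar R := (\1_bad w)%:E.
  pose psib (p : X * Om) : \bar R := ind p.2 * psi p + cst 0 p.2.
  transitivity (\int[P]_w psib (Xp j w, w)).
    by apply: eq_integral => w _; rewrite /psib adde0.
  have psib0 p : 0 <= psib p by rewrite /psib adde0 mule_ge0//; exact: ind0.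
  have mpsib : measurable_fun setT (psib : X * OmY -> \bar R).
    apply: emeasurable_funD => //; apply: emeasurable_funM; last exact: mpsi.
    apply/measurable_EFinP.
    have mind : measurable_fun setT (\1_bad : OmY -> R) by apply: measurable_indic; exact: mbadD.
    exact: (measurableT_comp mind measurable_snd).
  rewrite (@integral_chain _ _ _ _ _ _ _ P Q Yp Xp mY mX XY_markov X0_indep f mf f_law j
    psib mpsib psib0).
  apply: eq_integral => w _.
  rewrite /psib (transfers_affine Yp mf 0 j fpsi psi0)//=.
  under eq_integral do rewrite adde0.
  by rewrite ge0_integralZl//; exact: ind0.
have meetE : meet_fail j M = \int[P]_w h w.
  exact: (@integral_chain _ _ _ _ _ _ _ P Q Yp Xp mY mX XY_markov X0_indep f mf f_law j psi
    (mpsi setT (fun _ _ => I)) psi0).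
rewrite [leLHS]lhsE meetE.
have alphaE : alpha_dep P <<s gen_events D1 Yp >> <<s gen_events D2 Yp >> <=
    alpha_coef P Yp (q + 1 - i).
  by apply: ereal_sup_ubound; exists t.
apply: le_trans (leeD2l _ alphaE).
rewrite (eq_integral (fun w => (\1_bad w)%:E * (fine (h w))%:E)); last by move=> w _; rewrite -hfin.
rewrite [X in _ * X](eq_integral (fun w => (fine (h w))%:E)); last by move=> w _; rewrite -hfin.
apply: covariance_alpha_dep.
- by move=> A; exact: (gen_events_measurable mY).
- by move=> A; exact: (gen_events_measurable mY).
- exact: measurableT_comp.
- by move=> w; rewrite -!lee_fin -hfin h0 h1.
- apply: (mbadD D2) => k; rewrite /D2 /t /=; lia.
Qed.

Section rates.
Variables (v0 k0 : R).
Hypotheses (v00 : (0 <= v0)%R) (EVv0 : EV <= v0%:E).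
Hypotheses (k00 : (0 < k0)%R) (Kk0 : forall y, (k0 <= K y)%R).

(** In order: the weighted [V (Xp j)], with [v0] for the start and 1 for the sum of the [d_l]; the
    point [x0] times the constant of [gam_moment]; 2 + 2 for the two sums of [K] terms, doubled
    because two trajectories are followed. All is divided by the threshold [a]. *)
Definition rate_const : R := ((v0 + 1 + V x0 * (1 + k0^-1) + 4) / a)%R.

Lemma rate_const_ge0 : (0 <= rate_const)%R.
Proof.
by rewrite divr_ge0 ?(ltW a_gt0)// !addr_ge0// mulr_ge0// addr_ge0// invr_ge0 ltW.
Qed.

Let rc0 i : 0 <= rc i.
Proof. by apply: le_trans (d_coef_le _ _ _ _ _ _ (leqnn i)) => //; exact: d_coef_ge0. Qed.

Let remainder j M q i (w : Om) : R :=
  (gp j (M + q) w * (V (Xp j w) + V x0) +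
    2 * \sum_(0 <= l < M) Kg (j + (M - l.+1)) (l + q) w +
    2 * \sum_(i <= l < q) Kg (j + M + (q - l.+1)) l w)%R.

(** Every product has at least [i] factors [gam]: [M + q] of them next to [V], [l + q] in the first
    sum, [l >= i] in the second. [0 < q] leaves at least one factor next to [V], as the moment
    bounds require. *)
Lemma remainder_moment j M q i : (i <= q)%N -> (0 < q)%N ->
  \int[P]_w (remainder j M q i w / a)%:E <= rate_const%:E * rc i.
Proof.
move=> iq q0.
have ai0 : (0 <= a^-1)%R by rewrite invr_ge0 ltW.
have mKg s l : measurable_fun setT (Kg s l) by exact: measurable_Kgam_prod.
have Kg0 s l w : (0 <= Kg s l w)%R by exact: Kgam_prod_ge0.
have mS1 : measurable_fun setT (fun w => (\sum_(0 <= l < M) Kg (j + (M - l.+1)) (l + q) w)%:E).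
  by apply/measurable_EFinP; apply: measurable_sum.
have mS2 : measurable_fun setT (fun w => (\sum_(i <= l < q) Kg (j + M + (q - l.+1)) l w)%:E).
  by apply/measurable_EFinP; apply: measurable_sum.
have S10 w : 0 <= (\sum_(0 <= l < M) Kg (j + (M - l.+1)) (l + q) w)%:E by rewrite lee_fin sumr_ge0.
have S20 w : 0 <= (\sum_(i <= l < q) Kg (j + M + (q - l.+1)) l w)%:E by rewrite lee_fin sumr_ge0.
have mgp : measurable_fun setT (fun w => (gp j (M + q) w)%:E).
  by apply/measurable_EFinP; exact: measurable_gam_prod.
have gp0 w : 0 <= (gp j (M + q) w)%:E by rewrite lee_fin gam_prod_ge0.
have mVg : measurable_fun setT (fun w => (V (Xp j w) * gp j (M + q) w)%:E).
  apply/measurable_EFinP; apply: measurable_funM; first exact: measurableT_comp.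
  exact: measurable_gam_prod.
have Vg0 w : 0 <= (V (Xp j w) * gp j (M + q) w)%:E by rewrite lee_fin mulr_ge0 ?gam_prod_ge0.
have b1 : \int[P]_w (V (Xp j w) * gp j (M + q) w)%:E <= (v0 + 1)%:E * rc i.
  have [m mE] : exists m, (M + q = m.+1)%N by exists (M + q).-1; rewrite prednK// addn_gt0 q0 orbT.
  have im : (i <= m.+1)%N by rewrite -mE; lia.
  rewrite mE; apply: (le_trans (V_moment j m)).
  rewrite (_ : (v0 + 1)%:E * rc i = v0%:E * rc i + rc i); last first.
    by rewrite EFinD ge0_muleDl ?mul1e ?lee_fin.
  apply: leeD; last exact: sum_d_coef_le.
  apply: lee_pmul => //; first exact: d_coef_ge0.
  by apply: d_coef_le => //; lia.
have b2 : \int[P]_w (gp j (M + q) w)%:E <= (1 + k0^-1)%:E * rc i.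
  have [m mE] : exists m, (M + q = m.+1)%N by exists (M + q).-1; rewrite prednK// addn_gt0 q0 orbT.
  rewrite mE; apply: (le_trans (gam_moment P mY mgam mK gam_gt0 K_gt0 j m k00 Kk0)).
  apply: lee_wpmul2l; first by rewrite lee_fin addr_ge0// invr_ge0 ltW.
  by apply: d_coef_le => //; rewrite -mE; lia.
have b3 : \int[P]_w (\sum_(0 <= l < M) Kg (j + (M - l.+1)) (l + q) w)%:E <= rc i.
  (* The index is shifted by [q] so that it equals the number of factors [gam]. *)
  under eq_integral => w _.
    rewrite (_ : \sum_(0 <= l < M) _ = \sum_(0 + q <= l < M + q) Kg (j + (M - (l - q).+1)) l
        w)%R; last first.
      by rewrite big_addn addnK; apply: eq_bigr => l _; rewrite addnK.
    over.
  apply: (le_trans (sum_Kgam_moment P mY mgam mK gam_gt0 K_gt0 _ _ (fun l => j + (M - (l -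
      q).+1))%N)).
  by apply: sum_d_coef_le.
have b4 : \int[P]_w (\sum_(i <= l < q) Kg (j + M + (q - l.+1)) l w)%:E <= rc i.
  apply: (le_trans (sum_Kgam_moment P mY mgam mK gam_gt0 K_gt0 _ _ (fun l => j + M + (q -
      l.+1))%N)).
  exact: sum_d_coef_le.
have intE : \int[P]_w (remainder j M q i w / a)%:E =
   a^-1%:E * (\int[P]_w (V (Xp j w) * gp j (M + q) w)%:E +
   (V x0)%:E * \int[P]_w (gp j (M + q) w)%:E +
   2%:E * \int[P]_w (\sum_(0 <= l < M) Kg (j + (M - l.+1)) (l + q) w)%:E +
   2%:E * \int[P]_w (\sum_(i <= l < q) Kg (j + M + (q - l.+1)) l w)%:E).
  rewrite -(ge0_integralZl _ _ mgp)//; last by rewrite lee_fin.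
  rewrite -(ge0_integralZl _ _ mS1)// -(ge0_integralZl _ _ mS2)//.
  rewrite -ge0_integralD//; last 2 first.
  - by move=> w _; rewrite mule_ge0// lee_fin.
  - exact: measurable_funeM.
  rewrite -ge0_integralD//; last 4 first.
  - by move=> w _; rewrite adde_ge0// mule_ge0// lee_fin.
  - by apply: emeasurable_funD => //; exact: measurable_funeM.
  - by move=> w _; rewrite mule_ge0.
  - exact: measurable_funeM.
  rewrite -ge0_integralD//; last 4 first.
  - by move=> w _; rewrite !adde_ge0// mule_ge0// lee_fin.
  - by apply: emeasurable_funD; [apply: emeasurable_funD => //|]; exact: measurable_funeM.
  - by move=> w _; rewrite mule_ge0.
  - exact: measurable_funeM.
  rewrite -ge0_integralZl//; last 2 first.
  - by apply: emeasurable_funD; [apply: emeasurable_funD; [apply: emeasurable_funD => //|]|];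
      exact: measurable_funeM.
  - by move=> w _; rewrite !adde_ge0// mule_ge0// lee_fin.
  apply: eq_integral => w _; rewrite /= -!EFinM; congr _%:E.
  by rewrite /remainder; ring.
rewrite intE /rate_const mulrC EFinM -muleA lee_wpmul2l ?lee_fin//.
apply: (@le_trans _ _ ((v0 + 1)%:E * rc i + (V x0)%:E * ((1 + k0^-1)%:E * rc i) + 2%:E * rc i +
    2%:E * rc i)).
  apply: leeD; last by apply: lee_wpmul2l => //; rewrite lee_fin.
  apply: leeD; last by apply: lee_wpmul2l => //; rewrite lee_fin.
  by apply: leeD => //; apply: lee_wpmul2l => //; rewrite lee_fin.
have k1 : (0 <= 1 + k0^-1)%R by rewrite addr_ge0// invr_ge0 ltW.
rewrite muleA -EFinM -!ge0_muleDl// ?lee_fin ?addr_ge0// ?mulr_ge0//.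
by rewrite -!EFinD lee_wpmul2r// lee_fin; lra.
Qed.

(** The local part has mean at most [r_0 <= rho / 4], so Markov's inequality gives 1/4; the event on
    [bet] adds 1/4. *)
Lemma prob_bad_env q i (rho bb : R) s : (i <= q)%N -> (0 < rho)%R ->
  rc 0 <= (rho / 4)%:E ->
  (forall t, P [set w | (bb < bet (Yp t w))%R] <= (4^-1)%:E) ->
  P (bad_env q i rho bb s) <= (2^-1)%:E.
Proof.
move=> iq rho0 rcrho hbet.
pose S w := (\sum_(0 <= l < i) Kg (s + (q - l.+1)) l w)%R.
have mS : measurable_fun setT S.
  by apply: measurable_sum => l; exact: measurable_Kgam_prod.
have S0 w : (0 <= S w)%R by apply: sumr_ge0 => l _; exact: Kgam_prod_ge0.
pose A := [set w | (rho < S w)%R].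
have mA : measurable A.
  by apply: measurable_bool_set; exact: measurable_fun_ltr.
pose B := [set w | (bb < bet (Yp (s + q)%N w))%R].
have mB : measurable B.
  by apply: measurable_bool_set; apply: measurable_fun_ltr => //; exact: measurableT_comp.
have PA : P A <= (4^-1)%:E.
  have : rho%:E * P A <= (rho / 4)%:E.
    apply: le_trans rcrho.
    apply: (@le_trans _ _ (\int[P]_w (S w)%:E)); last first.
      apply: (le_trans (sum_Kgam_moment P mY mgam mK gam_gt0 K_gt0 0 i (fun l => s + (q -
          l.+1))%N)).
      exact: sum_d_coef_le.
    rewrite -[X in P X]setIT -integral_indic// -ge0_integralZl//; last 2 first.
    - by apply/measurable_EFinP; exact: measurable_indic.
    - by rewrite lee_fin ltW.
    apply: ge0_le_integral => //.
    - by move=> w _; rewrite mule_ge0// lee_fin// ltW.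
    - apply: measurable_funeM; apply/measurable_EFinP; exact: measurable_indic.
    - exact/measurable_EFinP.
    - move=> w _; rewrite -EFinM lee_fin indicE.
      by case: (boolP (w \in A)); rewrite ?mulr1 ?mulr0// inE /A /= => /ltW.
  have -> : P A = (fine (P A))%:E by rewrite fineK// fin_num_measure.
  by rewrite -EFinM !lee_fin ler_pM2l.
have badE : bad_env q i rho bb s `<=` A `|` B.
  move=> w; rewrite /bad_env /good_env /= negb_and -!ltNge => /orP[h|h]; [left|by right].
  by rewrite /A /= /S big_mkord.
have mbad : measurable (bad_env q i rho bb s).
  by apply: measurable_good_env.
apply: (le_trans (le_measure P _ _ badE)); rewrite ?inE//; first exact: measurableU.
apply: (le_trans (measureU2 _ _ _)) => //.
apply: (le_trans (leeD PA (hbet (s + q)%N))).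
by rewrite -EFinD lee_fin; lra.
Qed.

(** The factor of [step_bound] is [k1 + (1 - k1) * 1_bad] with [k1 = (1 + bb) / 2]. After
    decorrelation the bad event weighs at most 1/2, and [k1 + (1 - k1) / 2 = (3 + bb) / 4]. *)
Lemma meet_fail_step j M q i (rho bb : R) : (i <= q)%N -> (0 < q)%N ->
  (0 <= bb <= 1)%R -> a = (4 * rho)%R ->
  P (bad_env q i rho bb (j + M)) <= (2^-1)%:E ->
  meet_fail j (M + q.+1) <= ((3 + bb) / 4)%:E * meet_fail j M +
    (alpha_coef P Yp (q + 1 - i) + rate_const%:E * rc i).
Proof.
move=> iq q0 bb01 arho Pbad; have /andP[bb0 bb1] := bb01.
set bad := bad_env q i rho bb (j + M).
pose k1 : R := ((1 + bb) / 2)%R.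
pose t w := T j M (@differ R _ X Om) ((Xp j w, x0), w).
have t0 w : 0 <= t w by exact: transfers_differ_ge0.
have mt : measurable_fun setT t by exact: measurable_meet_fail.
have mbad : measurable bad by apply: measurable_good_env.
have ib0 w : 0 <= (\1_bad w)%:E :> \bar R by rewrite lee_fin.
have mib : measurable_fun setT (fun w => (\1_bad w)%:E : \bar R).
  by apply/measurable_EFinP; exact: measurable_indic.
have mibt : measurable_fun setT (fun w => (\1_bad w)%:E * t w) by exact: emeasurable_funM.
have k10 : (0 <= k1)%R by rewrite /k1; lra.
have k11 : (0 <= 1 - k1)%R by rewrite /k1; lra.
have r0 w : 0 <= (remainder j M q i w / a)%:E.
  rewrite lee_fin divr_ge0 ?(ltW a_gt0)// !addr_ge0 ?mulr_ge0 ?addr_ge0 ?gam_prod_ge0//.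
    by apply: sumr_ge0 => l _; exact: Kgam_prod_ge0.
  by apply: sumr_ge0 => l _; exact: Kgam_prod_ge0.
have mr : measurable_fun setT (fun w => (remainder j M q i w / a)%:E).
  apply/measurable_EFinP; apply: measurable_funM => //.
  have mKg s l : measurable_fun setT (Kg s l) by exact: measurable_Kgam_prod.
  apply: measurable_funD; last by apply: measurable_funM => //; exact: measurable_sum.
  apply: measurable_funD; last by apply: measurable_funM => //; exact: measurable_sum.
  apply: measurable_funM; first exact: measurable_gam_prod.
  by apply: measurable_funD => //; exact: measurableT_comp.
apply: (@le_trans _ _ (\int[P]_w (k1%:E * t w + (1 - k1)%:E * ((\1_bad w)%:E * t w) +
    (remainder j M q i w / a)%:E))).
  apply: ge0_le_integral => //.
  - by move=> w _; exact: transfers_differ_ge0.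
  - exact: measurable_meet_fail.
  - by apply: emeasurable_funD => //; apply: emeasurable_funD; exact: measurable_funeM.
  - move=> w _.
    apply: (le_trans (step_bound Yp mf mdiag mV V0 gam_gt0 K_gt0 a_gt0 bet01 driftV
      coupled j M (Xp j w, x0) w iq bb01 arho)).
    rewrite leeD2r// -/(t w) indicE /bad; have [good|nbad] := boolP (good_env _ _ _ _ _ _ _ _ _ _).
      by rewrite memNset//= ?mul0e ?mule0 ?adde0//; rewrite /bad_env /= good.
    rewrite mem_set//= !mul1e -ge0_muleDl ?lee_fin// -EFinD addrC subrK mul1e//.
rewrite ge0_integralD//; last 2 first.
- by move=> w _; rewrite adde_ge0// !mule_ge0.
- by apply: emeasurable_funD; exact: measurable_funeM.
rewrite ge0_integralD//; last 4 first.
- by move=> w _; rewrite mule_ge0.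
- exact: measurable_funeM.
- by move=> w _; rewrite !mule_ge0.
- exact: measurable_funeM.
rewrite ge0_integralZl// ge0_integralZl//; last by move=> w _; rewrite mule_ge0.
rewrite -/(meet_fail j M) [leRHS]addeA; apply: leeD; last exact: remainder_moment.
have al0 : 0 <= alpha_coef P Yp (q + 1 - i).
  apply: le_trans (ereal_sup_ubound _); last by exists 0%R.
  by apply: alpha_dep_ge0 => A; exact: (gen_events_measurable mY).
have e0 := meet_fail_ge0 j M.
apply: (@le_trans _ _ (k1%:E * meet_fail j M + (1 - k1)%:E *
    ((2^-1)%:E * meet_fail j M + alpha_coef P Yp (q + 1 - i)))).
  rewrite leeD2l// lee_wpmul2l ?lee_fin//.
  apply: (le_trans (decorrelate j M rho bb iq)).
  by rewrite leeD2r// lee_wpmul2r.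
have h0 : 0 <= (2^-1)%:E * meet_fail j M by rewrite mule_ge0// lee_fin invr_ge0.
rewrite (ge0_muleDr _ h0 al0) [leLHS]addeA; apply: leeD.
  have k12 : (0 <= (1 - k1) * 2^-1)%R by rewrite mulr_ge0// invr_ge0.
  rewrite muleA -EFinM -ge0_muleDl ?lee_fin// -EFinD lee_wpmul2r// lee_fin /k1; lra.
apply: (@le_trans _ _ (1 * alpha_coef P Yp (q + 1 - i))); last by rewrite mul1e.
by rewrite lee_wpmul2r// lee_fin; lra.
Qed.

Lemma meet_fail_mono j M n : (M <= n)%N -> meet_fail j n <= meet_fail j M.
Proof.
move=> Mn; apply: ge0_le_integral => //.
- by move=> w _; exact: transfers_differ_ge0.
- exact: measurable_meet_fail.
- exact: measurable_meet_fail.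
- move=> w _; rewrite -(subnKC Mn) transfers_add.
  apply: (le_transfers Yp (measurable_step2 mf)).
  + apply: (fibre_measurable_transfers Yp (measurable_step2 mf)); last exact: differ_ge0.
    exact: fibre_measurable_differ.
  + exact: fibre_measurable_differ.
  + exact: transfers_differ_ge0.
  + exact: differ_ge0.
  + by move=> x; exact: (transfers_differ_le Yp mf mdiag).
Qed.

Lemma geometric_recursion (e : nat -> \bar R) (k : R) (D : \bar R) :
  (0 <= k < 1)%R -> 0 <= D -> e 0%N <= 1 ->
  (forall n, e n.+1 <= k%:E * e n + D) ->
  forall n, e n <= (k ^+ n)%:E + ((1 - k)^-1)%:E * D.
Proof.
move=> /andP[k0' k1'] D0 e0 he; have k10 : (0 < 1 - k)%R by rewrite subr_gt0.
(* [D] stands for mixing and moment coefficients, which are extended reals; the bound is trivial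
   when it is infinite. *)
have [Doo|Dfin] := eqVneq D +oo.
  by move=> n; rewrite Doo gt0_muley ?lte_fin ?invr_gt0// addey// leey.
have DE : D = (fine D)%:E by rewrite fineK// ge0_fin_numE// ltey.
elim=> [|n ih].
  by rewrite expr0 (le_trans e0)// leeDl// mule_ge0// lee_fin invr_ge0 ltW.
apply: (le_trans (he n)).
apply: (@le_trans _ _ (k%:E * ((k ^+ n)%:E + ((1 - k)^-1)%:E * D) + D)).
  by rewrite leeD2r// lee_wpmul2l// lee_fin.
rewrite DE -!(EFinM, EFinD) lee_fin exprS le_eqVlt; apply/orP; left; apply/eqP.
by field; rewrite gt_eqF.
Qed.

(** [n] is rounded down to a multiple of [q + 1], which is allowed as [meet_fail] is nonincreasing
    in time. *)
Lemma meet_fail_bound j q i n (rho bb : R) : (i <= q)%N -> (0 < q)%N ->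
  (0 <= bb < 1)%R -> (0 < rho)%R -> a = (4 * rho)%R -> rc 0 <= (rho / 4)%:E ->
  (forall t, P [set w | (bb < bet (Yp t w))%R] <= (4^-1)%:E) ->
  meet_fail j n <= (((3 + bb) / 4) ^+ (n %/ q.+1))%:E +
    ((1 - (3 + bb) / 4)^-1)%:E *
    (alpha_coef P Yp (q + 1 - i) + rate_const%:E * rc i).
Proof.
move=> iq q0 /andP[bb0 bb1] rho0 arho rcrho hbet.
have al0 : 0 <= alpha_coef P Yp (q + 1 - i).
  apply: le_trans (ereal_sup_ubound _); last by exists 0%R.
  by apply: alpha_dep_ge0 => A; exact: (gen_events_measurable mY).
apply: (le_trans (meet_fail_mono j (leq_divM n q.+1))).
apply: (@geometric_recursion (fun k => meet_fail j (k * q.+1))).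
- by apply/andP; split; lra.
- by rewrite adde_ge0// mule_ge0// lee_fin rate_const_ge0.
- exact: meet_fail_le1.
- move=> k; rewrite mulSnr; apply: (@meet_fail_step _ _ _ _ rho) => //.
    by rewrite bb0 ltW.
  exact: prob_bad_env.
Qed.

End rates.

End estimate.

Section rate.
Context {R : realType}.
Local Open Scope ring_scope.

(** As [q + 1 <= 2 * q], the number of complete blocks is at least [n / (2 * q) - 1]: the 2 turns
    [k] into its square root, and the -1 costs a factor [k^-1]. *)
Lemma geometric_rate (k : R) (n q : nat) : 0 < k < 1 -> (0 < q)%N ->
  k ^+ (n %/ q.+1) <= k^-1 * (k `^ 2^-1) `^ (n%:R / q%:R).
Proof.
move=> /andP[k0 k1] q0; have kn0 : k != 0 by rewrite gt_eqF.
have le1 : (n%:R / (2 * q%:R) : R) <= (n %/ q.+1)%:R + 1.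
  rewrite ler_pdivrMr ?mulr_gt0 ?ltr0n// natr1 -!natrM ler_nat.
  have := divn_eq n q.+1; have := ltn_pmod n (ltn0Sn q); nia.
have -> : (k `^ 2^-1) `^ (n%:R / q%:R) = k `^ (n%:R / (2 * q%:R)).
  by rewrite -powRrM; congr (_ `^ _); rewrite invfM; ring.
rewrite -powR_mulrn; last exact: ltW.
apply: (@le_trans _ _ (k `^ (n%:R / (2 * q%:R) - 1))).
  by apply: ger_powR; [rewrite k0 ltW|rewrite lerBlDr].
by rewrite powRB ?kn0 ?implybT// powRr1 1?mulrC//; exact: ltW.
Qed.

End rate.

(** * The enlarged probability space and its noise *)

Section clip.
Context {R : realType}.
Notation U := (measurableTypeR R).

(** The noise has to lie in [0, 1] at every point, not only almost surely; [clip] changes a uniform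
    variable on a null set. *)
Definition clip (u : R) : R := if (0 <= u <= 1)%R then u else 0%R.

Lemma clip01 u : (0 <= clip u <= 1)%R.
Proof. by rewrite /clip; case: ifP => // _; rewrite lexx ler01. Qed.

Lemma clipK u : clip (clip u) = clip u.
Proof. by rewrite {1}/clip clip01. Qed.

Lemma measurable_clip : measurable_fun [set: U] (clip : U -> U).
Proof.
apply: measurable_fun_ifT; last 2 first.
- exact: measurable_id.
- exact: measurable_cst.
by apply: measurable_and; apply: measurable_fun_ler.
Qed.

Lemma lam_clip (A : set U) : measurable A -> lam R (clip @^-1` A) = lam R A.
Proof.
move=> mA; have mc : measurable ((clip : U -> U) @^-1` A).
  by rewrite -[X in measurable X]setTI; exact: measurable_clip.
rewrite (lam_supp mA) (lam_supp mc); congr (lam R _).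
by apply/seteqP; split => u [] /= + uI; move: (uI); rewrite in_itv /= /clip => ->.
Qed.

End clip.

Section noise_space.
Context {R : realType} {d : measure_display} {Om : measurableType d}.
Variable P : probability Om R.
Notation U := (measurableTypeR R).
Variable tau : U -> U * U.
Hypothesis mtau : measurable_fun setT tau.
Hypothesis tauE : forall A, measurable A -> lam R (tau @^-1` A) = (lam R \x lam R) A.

Notation P' := (P \x lam R)%E.

Definition clip_noise (n : nat) (p : Om * U) : R := clip (noise tau n p.2).

Lemma prod_snd (A : set U) : measurable A -> P' (snd @^-1` A) = lam R A.
Proof.
move=> mA; rewrite -setTX; apply: etrans; first exact: product_measure1E.
by rewrite [X in X * _]probability_setT mul1e.
Qed.

Lemma prod_fst (A : set Om) : measurable A -> P' (fst @^-1` A) = P A.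
Proof.
move=> mA; rewrite -setXT; apply: etrans; first exact: product_measure1E.
by rewrite [X in _ * X]probability_setT mule1.
Qed.

Let mclip_noise n : measurable_fun [set: U] (fun u => clip (noise tau n u)).
Proof. exact: (measurableT_comp measurable_clip (measurable_noise mtau n)). Qed.

Lemma measurable_clip_noise n : measurable_fun setT (clip_noise n).
Proof. exact: (measurableT_comp (mclip_noise n) measurable_snd). Qed.

Let mclip_pre (A : set R) : measurable A -> measurable ((clip : U -> U) @^-1` A).
Proof. by move=> mA; rewrite -[X in measurable X]setTI; exact: measurable_clip. Qed.

Let mpre n (A : set R) : measurable A -> measurable ((fun u => clip (noise tau n u)) @^-1` A).
Proof. by move=> mA; rewrite -[X in measurable X]setTI; exact: mclip_noise. Qed.

Lemma law_clip_noise n (A : set R) : measurable A -> P' (clip_noise n @^-1` A) = lam R A.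
Proof.
move=> mA; transitivity (lam R ((fun u => clip (noise tau n u)) @^-1` A)).
  exact: (prod_snd (mpre n mA)).
transitivity (lam R (noise tau n @^-1` (clip @^-1` A))); first by [].
by rewrite (lam_noise mtau tauE n (mclip_pre mA)) lam_clip.
Qed.

Lemma iid_clip_noise : iid P' clip_noise.
Proof.
split.
- exact: measurable_clip_noise.
- by move=> n B mB; exact: etrans (law_clip_noise n mB) (esym (law_clip_noise 0 mB)).
- move=> s B us mB.
  pose N := (\max_(k <- s) k).+1.
  have sN k : k \in s -> (k < N)%N by move=> ks; rewrite ltnS; exact: (leq_bigmax_seq (F := id)
      _ ks).
  (* Indices below [N] outside [s] receive the full space, so that [lam_noises] applies to an
     initial segment. *)
  pose B' k : set U := if k \in s then clip @^-1` B k else setT.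
  have mB' k : measurable (B' k) by rewrite /B'; case: ifP => // _; exact: mclip_pre.
  transitivity (lam R (\bigcap_(k in [set k | (k < N)%N]) (noise tau k @^-1` B' k))).
    have mcap : measurable (\bigcap_(k in [set k | (k < N)%N]) (noise tau k @^-1` B' k)).
      apply: bigcap_measurableType => k _.
      by rewrite -[X in measurable X]setTI; exact: measurable_noise.
    apply: etrans (prod_snd mcap); apply: (congr1 P'); apply/seteqP; split => p /= h k.
      by move=> _; rewrite /B' /preimage/=; case: ifPn => // ks; exact: h.
    by move=> ks; have := h k (sN k ks); rewrite /B' ks.
  rewrite (lam_noises mtau tauE)//.
  rewrite (bigID (fun k => k \in s)) /= [X in _ * X]big1 ?mule1; last first.
    by move=> k /negbTE ks; rewrite /B' ks; exact: probability_setT.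
  transitivity (\prod_(k <- s) lam R (B k)); last first.
    by apply: eq_bigr => k _; apply/esym; exact: law_clip_noise.
  rewrite -big_filter.
  rewrite (perm_big s); last first.
    apply: uniq_perm => [||k]; [by rewrite filter_uniq// iota_uniq|by []|].
    rewrite mem_filter mem_index_iota.
    by apply/andP/idP => [[]//|ks]; split => //; rewrite (sN k ks).
  by rewrite !big_seq; apply: eq_bigr => k ks; rewrite /B' ks lam_clip//; exact: mB.
Qed.

(** Noise events are preimages under [snd], the others under [fst]: they live on different factors
    of the product. *)
Lemma indep_clip_noise dT dS (T : measurableType dT) (S : measurableType dS)
    (Z : nat -> Om -> T) (W : nat -> Om -> S) :
  (forall n, measurable_fun setT (Z n)) -> (forall n, measurable_fun setT (W n)) ->
  indep_sigma P' <<s gen_events setT clip_noise >>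
    <<s gen_events setT (fun n => Z n \o fst) `|` gen_events setT (fun n => W n \o fst) >>.
Proof.
move=> mZ mW A B hA hB.
have [A' mA' ->] : exists2 A' : set U, measurable A' & A = snd @^-1` A'.
  have : preimage_set_system setT snd (measurable : set (set U)) A.
    move: A hA; apply: smallest_sub.
      by apply: sigma_algebra_preimage; exact: sigma_algebra_measurable.
    move=> _ [n _ [C mC <-]]; rewrite setTI; exists ((fun u => clip (noise tau n u)) @^-1` C).
      exact: mpre.
    by rewrite setTI.
  by move=> [A' mA' <-]; exists A' => //; rewrite setTI.
have [B' mB' ->] : exists2 B' : set Om, measurable B' & B = fst @^-1` B'.
  have : preimage_set_system setT fst (measurable : set (set Om)) B.
    move: B hB; apply: smallest_sub.
      by apply: sigma_algebra_preimage; exact: sigma_algebra_measurable.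
    move=> _ [[n _ [C mC <-]]|[n _ [C mC <-]]]; rewrite setTI.
      exists (Z n @^-1` C); rewrite ?setTI//.
      by rewrite -[X in measurable X]setTI; exact: mZ.
    exists (W n @^-1` C); rewrite ?setTI//.
    by rewrite -[X in measurable X]setTI; exact: mW.
  by move=> [B' mB' <-]; exists B' => //; rewrite setTI.
transitivity (lam R A' * P B'); last first.
  by apply/esym; congr (_ * _); [exact: prod_snd|exact: prod_fst].
rewrite muleC; transitivity (P' (B' `*` A')); last exact: product_measure1E.
by apply: (congr1 P'); apply/seteqP; split => p [].
Qed.

End noise_space.

(** * The random map representing the kernel *)

Section coupled_representation.
Context {R : realType} {dX dY : measure_display} {X : measurableType dX}
  {Y : measurableType dY}.
Notation U := (measurableTypeR R).
Variables (c : X -> R) (psi : R -> X).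
Hypotheses (mc : measurable_fun setT c) (c01 : forall x, (0 <= c x <= 1)%R).
Hypotheses (mpsi : measurable_fun setT psi) (cK : cancel c psi).
Variables (Q : R.-pker (Y * X)%type ~> X) (kap : R.-pker Y ~> X).
Variables (V : X -> R) (bet : Y -> R) (a : R).
Hypotheses (mV : measurable_fun setT V) (mbet : measurable_fun setT bet).
Hypothesis bet01 : forall y, (0 <= bet y < 1)%R.
Hypothesis minor : forall y x A, (V x <= a)%R -> measurable A ->
  (1 - bet y)%:E * kap y A <= Q (y, x) A.

Lemma coupled_representation : exists f : X -> Y -> R -> X,
  [/\ measurable_fun setT (fun q : X * Y * U => f q.1.1 q.1.2 q.2),
      forall y x B, measurable B -> lam R (f x y @^-1` B) = Q (y, x) B,
      forall x x' y u, (V x <= a)%R -> (V x' <= a)%R ->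
        (u <= 1 - bet y)%R -> f x y u = f x' y u &
      forall x y u, f x y (clip u) = f x y u].
Proof.
(* Weight 0 where [V] exceeds [a] makes the minorisation hold at every point, so a single sampler
   serves all states. *)
pose w (s : Y * X) : R := if (V s.2 <= a)%R then (1 - bet s.1)%R else 0%R.
have w01 s : (0 <= w s <= 1)%R.
  by rewrite /w; have := bet01 s.1; case: ifP => _; [lra|rewrite lexx ler01].
have mw : measurable_fun setT w.
  apply: measurable_fun_ifT => //.
    by apply: measurable_fun_ler => //; exact: (measurableT_comp mV measurable_snd).
  by apply: measurable_funB => //; exact: (measurableT_comp mbet measurable_fst).
have QT s : Q s setT = 1 by exact: prob_kernel.
have kT (s : Y * X) : kap s.1 setT = 1 by exact: prob_kernel.
have mQ B : measurable B -> measurable_fun setT (fun s => Q s B) by exact: measurable_kernel.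
have mk B : measurable B -> measurable_fun setT (fun s : Y * X => kap s.1 B).
  by move=> mB; exact: (measurableT_comp (measurable_kernel kap B mB) measurable_fst).
have kQ s A : measurable A -> (w s)%:E * kap s.1 A <= Q s A.
  move=> mA; rewrite /w; case: ifPn => [Va|_]; last by rewrite mul0e.
  by case: s Va => y x Va; exact: minor.
pose smp := sampler c psi (fun s => Q s) (fun s : Y * X => kap s.1) w.
have msmp : measurable_fun setT (fun su : (Y * X) * U => smp su.1 su.2).
  exact: (measurable_sampler mc mpsi QT kT mQ mk mw w01 kQ).
exists (fun x y u => smp (y, x) (clip u)); split.
- apply: (measurableT_comp msmp (g := fun q : X * Y * U => ((q.1.2, q.1.1), clip q.2))).
  apply: measurable_fun_pair; last exact: (measurableT_comp measurable_clip measurable_snd).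
  by apply: measurable_fun_pair; [exact: (measurableT_comp measurable_snd measurable_fst)|
    exact: (measurableT_comp measurable_fst measurable_fst)].
- move=> y x B mB; rewrite -(sampler_law mc c01 mpsi cK QT kT w01 kQ (y, x) mB).
  apply: (@lam_clip _ (smp (y, x) @^-1` B)).
  have m1 : measurable_fun [set: U] (smp (y, x)).
    exact: (measurableT_comp msmp (pair1_measurable (y, x))).
  by rewrite -[X in measurable X]setTI; exact: m1.
- move=> x x' y u Vx Vx' uy; apply: (sampler_coupled psi mc) => //.
    by rewrite /w /= Vx Vx'.
  (* For [u] outside [0, 1] the clipped value 0 is below [1 - bet y], so the common part is still
     selected. *)
  rewrite /w /= Vx /clip; case: ifP => // _; have := bet01 y; lra.
- by move=> x y u; rewrite clipK.
Qed.

End coupled_representation.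

Theorem theorem2p8 (R : realType) (X Y : completeMetricType R)
    (sepX : separable X) (sepY : separable Y)
    (d : measure_display) (Om : measurableType d) (P : probability Om R)
    (Q : R.-pker (borel Y * borel X)%type ~> borel X)
    (Yp : nat -> Om -> borel Y) (Xp : nat -> Om -> borel X)
    (mY : forall n, measurable_fun setT (Yp n))
    (mX : forall n, measurable_fun setT (Xp n))
    (XY_markov : markov_chain_in_env P Q Yp Xp)
    (X0_indep : indep_sigma P <<s gen_events [set 0%N] Xp >>
                              <<s gen_events setT Yp >>)
    (V : borel X -> R) (gam K : borel Y -> R) (bet : R -> borel Y -> R)
    (drift : drift_condition Q V gam K)
    (minorization : minorization_condition Q V bet)
    (A1 : condition_A1 P Yp gam K)
    (A2 : condition_A2 P Yp bet)
    (K_away0 : exists k0 : R, (0 < k0)%R /\ forall y, (k0 <= K y)%R)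
    (VX0 : 'E_P[V \o Xp 0%N] < +oo)
    (Y_mixing : alpha_mixing P Yp) :
  exists (d' : measure_display) (Om' : measurableType d')
    (P' : probability Om' R) (p : Om' -> Om),
    enlarges P P' p /\
  let Yp' := fun n => Yp n \o p in
  let Xp' := fun n => Xp n \o p in
  exists (f : borel X -> borel Y -> R -> borel X) (eps : nat -> Om' -> R),
    [/\ measurable_fun ([set: borel X * borel Y] `*` (`[0%R, 1%R]%classic : set R))
          (fun q : borel X * borel Y * R => f q.1.1 q.1.2 q.2),
        (forall n w, (0 <= eps n w <= 1)%R) /\ iid P' eps,
        indep_sigma P' <<s gen_events setT eps >>
          <<s gen_events setT Yp' `|` gen_events setT Xp' >>,
        forall (y : borel Y) (x : borel X) (B : set (borel X)),
          measurable B ->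
          Q (y, x) B = 'E_P'[\1_[set w | B (f x y (eps 0%N w))]] &
        exists (x0 : borel X) (kap c : R),
          [/\ (0 < kap < 1)%R, (0 < c)%R &
            forall n : nat, (1 <= n)%N ->
              b_coef P' f Yp' Xp' eps x0 n <=
              c%:E * ereal_inf [set z | exists i q : nat,
                [/\ (1 <= i)%N, (i <= q)%N, (q <= n)%N &
                    z = r_coef P Yp gam K i
                        + (kap `^ (n%:R / q%:R))%:E
                        + alpha_coef P Yp (q + 1 - i)]]]].
Proof.
have [[mV V0] [mgam gam0] [mK K0] driftQ] := drift.
have [mbet bet01 minor] := minorization.
have [k0 [k00 Kk0]] := K_away0.
have [c [psi [mc c01 mpsi cK]]] := polish_coding sepX.
have [tau [mtau tauE]] := @uniform_doubling R.
have [_ rc0oo] := A1.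
set rc := r_coef P Yp gam K.
have rc0 i : 0 <= rc i.
  apply: nneseries_ge0 => l _ _; exact: d_coef_ge0.
pose r0 := fine (rc 0%N).
have r0E : rc 0%N = r0%:E by rewrite /r0 fineK// ge0_fin_numE.
have r00 : (0 <= r0)%R by rewrite /r0 fine_ge0.
(* [4 * r0] is what Markov's inequality needs for 1/4, and [+ 1] keeps [rho] positive when [r0 = 0].
   With [a = 4 * rho] the local parts of two trajectories take up half of the threshold. *)
pose rho : R := (4 * r0 + 1)%R; pose a : R := (4 * rho)%R.
have rho0 : (0 < rho)%R by rewrite /rho; lra.
have a0 : (0 < a)%R by rewrite /a; lra.
have [kap minor_kap] := minor a a0.
have bet01a y : (0 <= bet a y < 1)%R by apply: bet01; exact: ltW.
have mbeta : measurable_fun setT (bet a).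
  apply: (measurable_comp (F := [set r : R | (0 <= r)%R] `*` setT)
    (f := fun p : R * borel Y => bet p.1 p.2) (g := pair a)) => //.
    apply: measurableX => //; rewrite (_ : [set _ | _] = `[0%R, +oo[%classic)//.
    by apply/seteqP; split => r /=; rewrite in_itv/= andbT.
  by move=> _ [y _ <-]; split => //=; exact: ltW.
have [f [mf f_law f_coupled f_clip]] := coupled_representation mc c01 mpsi cK
  mV mbeta bet01a minor_kap.
(* The injective code [c] reduces equality of points to equality of reals. *)
have mdiag : measurable_fun setT (fun p : borel X * borel X => p.1 != p.2).
  rewrite (_ : (fun p => _) = (fun p => ~~ (c p.1 == c p.2))); last first.
    by apply/funext => p; rewrite (inj_eq (can_inj cK)).
  apply: measurable_neg; apply: measurable_fun_eqr.
    exact: (measurableT_comp mc measurable_fst).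
  exact: (measurableT_comp mc measurable_snd).
(* The level [a] is fixed first, as (A2) provides a cut-off [bb < 1] for each level separately. *)
have [bb bb01 hbb] : exists2 bb : R, (0 <= bb < 1)%R &
    forall t, P [set w | (bb < bet a (Yp t w))%R] <= (4^-1)%:E.
  have near4 : \forall b \near (1%R : R)^'-,
      ereal_sup [set P [set w | (b < bet a (Yp t w))%R] | t in [set: nat]] < (4^-1)%:E.
    apply: (A2 a a0 [set z | z < (4^-1)%:E]).
    by apply: (@open_ereal_lt' _ (0 : \bar R)); rewrite lte_fin invr_gt0.
  have near0 : \forall b \near (1%R : R)^'-, (0 < b < 1)%R.
    near=> b; apply/andP; split; near: b.
      exact: nbhs_left_gt.
    exact: nbhs_left_lt.
  have [b [hb /andP[b0 b1]]] := @filter_ex _ _ _ _ (filterI near4 near0).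
  exists b; first by rewrite ltW.
  by move=> t; apply: le_trans (ltW hb); apply: ereal_sup_ubound; exists t.
pose v0 := fine 'E_P[V \o Xp 0%N].
have EV0 : 0 <= 'E_P[V \o Xp 0%N] by apply: expectation_ge0 => w; exact: V0.
have EVE : \int[P]_w (V (Xp 0%N w))%:E <= v0%:E.
  by rewrite /v0 fineK ?ge0_fin_numE// unlock.
have v00 : (0 <= v0)%R by rewrite fine_ge0.
have driftV x y : \int[lam R]_u (V (f x y u))%:E <= (gam y * V x + K y)%:E.
  have mfxy : measurable_fun [set: measurableTypeR R] (f x y).
    exact: (measurableT_comp (measurable_step mf y) (pair1_measurable x)).
  have mVE : measurable_fun setT (fun z => (V z)%:E) by exact/measurable_EFinP.
  have VE0 z : 0 <= (V z)%:E by rewrite lee_fin.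
  apply: le_trans (driftQ y x).
  by rewrite (ge0_integral_image mfxy (f_law y x) mVE VE0).
(* The adjoined factor carries one uniform variable, from which [clip_noise tau] draws the whole
   sequence. *)
exists _, (Om * measurableTypeR R)%type, (P \x lam R)%E, fst; split.
  by split; [exact: measurable_fst|exact: prod_fst].
move=> Yp' Xp'; exists f, (clip_noise tau); split.
- by apply: measurable_funTS; exact: mf.
- split; first by move=> n w; exact: clip01.
  exact: iid_clip_noise.
- exact: indep_clip_noise.
- move=> y x B mB.
  have mfB : measurable (f x y @^-1` B : set (measurableTypeR R)).
    rewrite -[X in measurable X]setTI.
    exact: (measurableT_comp (measurable_step mf y) (pair1_measurable x)).
  rewrite expectation_indic.
    rewrite -(f_law y x B mB); apply/esym; exact: (law_clip_noise P mtau tauE 0%N mfB).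
  rewrite -[X in measurable X]setTI.
  exact: (measurable_clip_noise mtau 0%N measurableT mfB).
pose k2 : R := ((3 + bb) / 4)%R.
have k201 : (0 < k2 < 1)%R by rewrite /k2; lra.
pose D : R := (1 - k2)^-1%R.
pose C : R := rate_const V a (point : borel X) v0 k0.
have /andP[k20 k21] := k201.
have kap01 : (0 < k2 `^ 2^-1 < 1)%R.
  rewrite powR_gt0//= powR12_sqrt ?(ltW k20)//.
  have : (Num.sqrt k2 < Num.sqrt 1)%R by rewrite ltr_sqrt.
  by rewrite sqrtr1.
have C0 : (0 <= C)%R by exact: rate_const_ge0.
have D0 : (0 <= D)%R by rewrite invr_ge0 subr_ge0 ltW.
have k2V0 : (0 < k2^-1)%R by rewrite invr_gt0.
have DC0 : (0 <= D * (1 + C))%R by rewrite mulr_ge0// addr_ge0.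
have cc0 : (0 < k2^-1 + D * (1 + C))%R by rewrite ltr_pwDl.
(* The rate is the square root of [k2]. In the constant, [k2^-1] pays for rounding to complete
   blocks, [D = 1 / (1 - k2)] sums the geometric series, and [1 + C] covers the coefficients 1 of
   alpha and [C] of [r_i]. *)
exists point, (k2 `^ 2^-1)%R, (k2^-1 + D * (1 + C))%R; split => //.
move=> n n1.
rewrite -lee_pdivrMl//; apply: le_ereal_inf_tmp => _ [i [q [i1 iq qn ->]]].
rewrite lee_pdivrMl//; apply: ge_ereal_sup => _ [j _ <-].
have q0 : (0 < q)%N by exact: leq_trans iq.
have arho : rc 0%N <= (rho / 4)%:E by rewrite r0E lee_fin /rho; lra.
have al0 : 0 <= alpha_coef P Yp (q + 1 - i).
  apply: le_trans (ereal_sup_ubound _); last by exists 0%R.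
  by apply: alpha_dep_ge0 => A; exact: (gen_events_measurable mY).
(* [f] reads its noise through [clip], so trajectories may be computed with the unclipped noise, to
   which the splitting by [tau] applies directly. *)
have f_eps x y m (w : Om * measurableTypeR R) : f x y (clip_noise tau m w) = f x y (noise tau m
    w.2) by exact: f_clip.
apply: (@le_trans _ _ (meet_fail P Yp Xp f (point : borel X) j n)).
  rewrite le_eqVlt; apply/orP; left; apply/eqP.
  exact: (prob_Z_iter_neq mtau tauE Yp mf mdiag f_eps P (Xp j) point j n).
apply: (le_trans (meet_fail_bound mY mX XY_markov X0_indep mf f_law mdiag mV V0 mgam mK mbeta
  gam0 K0 a0 bet01a driftV f_coupled point v00 EVE k00 Kk0 j n iq q0 bb01 rho0 erefl arho hbb)).
rewrite -/k2 -/D -/C -/(rc i).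
have rate := geometric_rate n k201 q0.
set al := alpha_coef _ _ _ in al0 *.
set kr := ((k2 `^ 2^-1) `^ _)%R in rate *.
have kr0 : (0 <= kr)%R by exact: powR_ge0.
have rcE : rc i = (fine (rc i))%:E.
  rewrite fineK// ge0_fin_numE//; apply: le_lt_trans rc0oo.
  rewrite /rc /r_coef (nneseries_split 0 i); last by move=> l _; exact: d_coef_ge0.
  by rewrite add0n leeDr// sume_ge0// => l _; exact: d_coef_ge0.
have rf0 : (0 <= fine (rc i))%R by rewrite fine_ge0.
(* An infinite coefficient makes the right-hand side infinite; otherwise the comparison is one
   between reals. *)
have [aloo|alfin] := eqVneq al +oo.
  by apply: (le_trans (leey _)); rewrite rcE aloo -EFinD addey// gt0_muley// lte_fin.
have alE : al = (fine al)%:E by rewrite fineK// ge0_fin_numE// ltey.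
have af0 : (0 <= fine al)%R by rewrite fine_ge0.
rewrite alE rcE -!(EFinM, EFinD) lee_fin.
move: (fine (rc i)) (fine al) rf0 af0 => r s r_ge0 s_ge0.
have h1 := mulr_ge0 D0 s_ge0.
have h2 := mulr_ge0 (mulr_ge0 D0 C0) s_ge0.
have h3 := mulr_ge0 D0 r_ge0.
have h4 := mulr_ge0 (ltW k2V0) r_ge0.
have h5 := mulr_ge0 (ltW k2V0) s_ge0.
have h6 := mulr_ge0 DC0 kr0.
move: rate; lra.
Unshelve. all: end_near. Qed.
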